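(* Let $f\in L_2(\Omega)$ and assume the Poincaré–Friedrichs inequality: there is $C_{\mathrm{PF}}>0$ with $\|v\|\le C_{\mathrm{PF}}\|Av\|$ for all $v\in H_0(A)$. Let $(u,\psi)\in\widetilde H(A,\mathcal T)\times H(A^*,\mathcal S)$ be the solution of \[ (\mathcal C Au, A\delta u)_{\mathcal T}+\langle\psi,\delta u\rangle_{\mathcal S}=(f,\delta u)\quad\forall \delta u\in\widetilde H(A,\mathcal T),\qquad \langle\delta\psi,u\rangle_{\mathcal S}=0\quad\forall\delta\psi\in H(A^*,\mathcal S). \] Let $\widetilde H_h(A,\mathcal T)\subset\widetilde H(A,\mathcal T)$ and $H_h(A^*,\mathcal S)\subset H(A^*,\mathcal S)$ be finite-dimensional subspaces. Assume that there is an operator $\mathcal F:\widetilde H(A,\mathcal T)\to\widetilde H_h(A,\mathcal T)$ and a constant $C_{\mathrm F}>0$ with \[ \langle\delta\psi,v-\mathcal Fv\rangle_{\mathcal S}=0\quad\forall\delta\psi\in H_h(A^*,\mathcal S),\ \forall v\in\widetilde H(A,\mathcal T),\qquad \|\mathcal Fv\|_{A,\mathcal T}\le C_{\mathrm F}\|v\|_{A,\mathcal T}\quad\forall v\in\widetilde H(A,\mathcal T), \] and that there is a constant $C_{\mathrm{PF,d}}>0$ with \[ \|v\|\le C_{\mathrm{PF,d}}\|Av\|_{\mathcal T}\quad\forall v\in\widetilde H_h(A,\mathcal T)\ \text{ with }\ \langle\delta\psi,v\rangle_{\mathcal S}=0\ \ \forall\delta\psi\in H_h(A^*,\mathcal S),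 \] where $C_{\mathrm F}$ and $C_{\mathrm{PF,d}}$ are independent of $\mathcal T$ and the discrete subspaces. Then the scheme: find $u_h\in\widetilde H_h(A,\mathcal T)$ and $\psi_h\in H_h(A^*,\mathcal S)$ such that \[ (\mathcal C Au_h, A\delta u)_{\mathcal T}+\langle\psi_h,\delta u\rangle_{\mathcal S}=(f,\delta u)\quad\forall \delta u\in\widetilde H_h(A,\mathcal T),\qquad \langle\delta\psi,u_h\rangle_{\mathcal S}=0\quad\forall\delta\psi\in H_h(A^*,\mathcal S) \] has a unique solution $(u_h,\psi_h)$. It satisfies \[ \|u-u_h\|_{A,\mathcal T}+\|\psi-\psi_h\|_{A^*,\mathcal S}\le C\bigl(\|u-v\|_{A,\mathcal T}+\|\psi-\eta\|_{A^*,\mathcal S}\bigr)\quad\forall v\in\widetilde H_h(A,\mathcal T),\ \forall\eta\in H_h(A^*,\mathcal S) \] with a constant $C$ that is independent of $f$, $\mathcal T$ and the discrete subspaces.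
   Context: Setting. $\Omega\subset\mathbb R^d$ ($d\in\mathbb N$) is a bounded Lipschitz domain and $U\in\{\mathbb R,\mathbb R^d,\mathbb R^{d\times d}\}$ or $U=\mathbb S:=\{w\in\mathbb R^{d\times d}: w=w^\top\}$. $A$ is a linear differential operator with constant coefficients taking scalar functions to $U$-valued functions, and $A^*$ is its formal adjoint (taking $U$-valued functions to scalar functions); both are applied in the distributional sense. $(\cdot,\cdot)$ and $\|\cdot\|$ are the $L_2(\Omega)$ inner product and norm (for scalar or $U$-valued functions). Set $H(A)=\{v\in L_2(\Omega): Av\in L_2(\Omega;U)\}$ with $\|v\|_A^2=\|v\|^2+\|Av\|^2$, and $H(A^* )=\{w\in L_2(\Omega;U): A^*w\in L_2(\Omega)\}$ with $\|w\|_{A^*}^2=\|w\|^2+\|A^*w\|^2$. The trace operator $\gamma_{A,\Gamma}:H(A)\to H(A^* )^*$ is $\langle\gamma_{A,\Gamma}(v),w\rangle_\Gamma:=(Av,w)-(v,A^*w)$, and $H_0(A):=\{v\in H(A):\gamma_{A,\Gamma}(v)=0\}$. $\mathcal C\in L_\infty(\Omega;U\times U)$ is a symmetric, (uniformly) positive definite tensor field, acting pointwise as a linear map $U\to U$. $\mathcal T=\{T\}$ is a regular mesh of polyhedral elements covering $\Omega$, with skeleton $\mathcal S=\bigcup\{\partial T: T\in\mathcal T\}$. $(\cdot,\cdot)_{\mathcal T}$ is the sum over $T\in\mathcal T$ of the $L_2(T)$ inner products, differential operators inside it being taken elementwise, and $\|\cdot\|_{\mathcal T}^2=(\cdot,\cdot)_{\mathcal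 T}$. Set $H(A,\mathcal T)=\{v\in L_2(\Omega): A(v|_T)\in L_2(T;U)\ \forall T\in\mathcal T\}$ with $\|v\|_{A,\mathcal T}^2=\|v\|^2+\|Av\|_{\mathcal T}^2$. $\widetilde H(A,\mathcal T)$ is a given closed subspace of $H(A,\mathcal T)$ with $H_0(A)\subset\widetilde H(A,\mathcal T)\subset H(A,\mathcal T)$. Trace operator: $\gamma_{A^*,\mathcal S}:H(A^* )\to\widetilde H(A,\mathcal T)^*$, $\langle\gamma_{A^*,\mathcal S}(w),v\rangle_{\mathcal S}:=(A^*w,v)-(w,Av)_{\mathcal T}$. Trace space: $H(A^*,\mathcal S):=\gamma_{A^*,\mathcal S}(H(A^* ))$ with norm $\|\psi\|_{A^*,\mathcal S}:=\inf\{\|w\|_{A^*}: w\in H(A^* ),\ \gamma_{A^*,\mathcal S}(w)=\psi\}$; for $\psi\in H(A^*,\mathcal S)$ and $v\in\widetilde H(A,\mathcal T)$, $\langle\psi,v\rangle_{\mathcal S}:=\langle\gamma_{A^*,\mathcal S}(w),v\rangle_{\mathcal S}$ for any $w\in H(A^* )$ with $\gamma_{A^*,\mathcal S}(w)=\psi$. Under the stated Poincaré–Friedrichs inequality the continuous problem has a unique solution. *)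

(* Defs.v *)
From HB Require Import structures.
From mathcomp Require Import all_boot all_order all_algebra.
From mathcomp Require Import all_classical all_reals all_analysis.
Import Order.TTheory GRing.Theory Num.Theory.
Import numFieldNormedType.Exports.
Set Implicit Arguments.
Unset Strict Implicit.
Unset Printing Implicit Defensive.
Local Open Scope classical_set_scope.
Local Open Scope ring_scope.

(* R^n is ['rV[R]_n]; its sigma-algebra is generated by the coordinates, which
   is the Borel one. *)
Section Borel.
Context (R : realType) (n : nat).

Definition rV_measurable : set (set 'rV[R]_n) :=
  g_sigma_preimage (fun (i : 'I_n) (x : 'rV[R]_n) => x ord0 i : measurableTypeR R).

Let rV_set0 : rV_measurable set0. Proof. exact: sigma_algebra0. Qed.

Let rV_setC A : rV_measurable A -> rV_measurable (~` A).
Proof. exact: sigma_algebraC. Qed.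

Let rV_bigcup (F : (set 'rV[R]_n)^nat) : (forall i, rV_measurable (F i)) ->
  rV_measurable (\bigcup_i F i).
Proof. exact: sigma_algebra_bigcup. Qed.

HB.instance Definition _ := @isMeasurable.Build default_measure_display
  'rV[R]_n rV_measurable rV_set0 rV_setC rV_bigcup.
End Borel.

Section Borel_theory.
Context (R : realType).

Lemma measurable_coord n (i : 'I_n) :
  measurable_fun [set: 'rV[R]_n]
    (fun x : 'rV[R]_n => x ord0 i : measurableTypeR R).
Proof.
move=> _ Y mY; rewrite setTI; apply: sub_sigma_algebra => /=.
rewrite -bigcup_seq/=; exists i => /=; first by rewrite mem_index_enum.
by exists Y => //; rewrite setTI.
Qed.

Lemma measurable_fun_coordP d (T : measurableType d) n (f : T -> 'rV[R]_n) :
  (forall i, measurable_fun [set: T] (fun t => f t ord0 i : measurableTypeR R)) ->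
  measurable_fun [set: T] f.
Proof.
move=> mf _ A mA; rewrite setTI.
have : [set B | measurable (f @^-1` B)] A; last by [].
move: A mA; apply: smallest_sub => [|B].
  split=> [|B|F] /=; first by rewrite preimage_set0.
  - by rewrite setTD preimage_setC => mB; exact: measurableC.
  - by move=> mF; rewrite preimage_bigcup; exact: bigcup_measurable.
rewrite -bigcup_seq => -[i _ [Y mY <-]] /=; rewrite setTI.
by have := mf i measurableT Y mY; rewrite setTI.
Qed.

Definition rV_cons n (p : measurableTypeR R * 'rV[R]_n) : 'rV[R]_n.+1 :=
  \row_i oapp (fun j => p.2 ord0 j) (p.1 : R) (unlift ord0 i).

Lemma measurable_rV_cons n : measurable_fun setT (@rV_cons n).
Proof.
apply: measurable_fun_coordP => i; case: (unliftP ord0 i) => [j|] ->.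
- rewrite (_ : (fun _ => _) = (fun x : 'rV[R]_n => x ord0 j) \o snd).
    by apply: measurableT_comp; [exact: measurable_coord|].
  by apply/funext => p /=; rewrite mxE liftK.
- by rewrite (_ : (fun _ => _) = fst)//; apply/funext => p; rewrite mxE unlift_none.
Qed.

Section lebesgue_cons.
Context n (mu : {sigma_finite_measure set 'rV[R]_n -> \bar R}).

Definition lebesgue_cons : set 'rV[R]_n.+1 -> \bar R :=
  pushforward (@lebesgue_measure R \x mu)%E (@rV_cons n).

Let mcons (A : set 'rV[R]_n.+1) : measurable A -> measurable (@rV_cons n @^-1` A).
Proof. by move=> mA; rewrite -[X in measurable X]setTI; exact: measurable_rV_cons. Qed.

Let lebesgue_cons0 : lebesgue_cons set0 = 0%E.
Proof. by rewrite /lebesgue_cons /pushforward preimage_set0 measure0. Qed.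

Let lebesgue_cons_ge0 A : (0 <= lebesgue_cons A)%E.
Proof. by apply: integral_ge0 => // *. Qed.

Let lebesgue_cons_sigma_additive : semi_sigma_additive lebesgue_cons.
Proof.
move=> F mF tF mUF; rewrite /lebesgue_cons /pushforward preimage_bigcup.
apply: measure_semi_sigma_additive.
- by move=> k; exact: mcons.
- apply/trivIsetP => /= i j _ _ ij; rewrite -preimage_setI.
  by move/trivIsetP : tF => /(_ _ _ _ _ ij) ->//; rewrite preimage_set0.
- by rewrite -preimage_bigcup; exact: mcons.
Qed.

HB.instance Definition _ := isMeasure.Build _ _ _ lebesgue_cons
  lebesgue_cons0 lebesgue_cons_ge0 lebesgue_cons_sigma_additive.

Let lebesgue_cons_sigma_finite : sigma_finite setT lebesgue_cons.
Proof.
have /sigma_finiteP[F [TF ndF Foo]] := sigma_finiteT (@lebesgue_measure R).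
have /sigma_finiteP[G [TG ndG Goo]] := sigma_finiteT mu.
pose g (x : 'rV[R]_n.+1) : measurableTypeR R * 'rV[R]_n :=
  (x ord0 ord0, \row_j x ord0 (lift ord0 j)).
have mg : measurable_fun setT g.
  apply: measurable_fun_pair; first exact: measurable_coord.
  apply: measurable_fun_coordP => i.
  rewrite (_ : (fun _ => _) = (fun x : 'rV[R]_n.+1 => x ord0 (lift ord0 i))).
    exact: measurable_coord.
  by apply/funext => x /=; rewrite mxE.
have gK p : g (rV_cons p) = p.
  case: p => a b; rewrite /g mxE unlift_none; congr pair.
  by apply/rowP => j; rewrite !mxE liftK.
exists (fun k => g @^-1` (F k `*` G k)).
  apply/esym; rewrite -preimage_bigcup -subTset => x _.
  have [[a _ Fa] [b _ Gb]] :
      (\bigcup_k F k) (g x).1 /\ (\bigcup_k G k) (g x).2 by rewrite -TF -TG.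
  exists (maxn a b) => //; split => /=.
  - by move: Fa; apply/subsetPset/ndF/leq_maxl.
  - by move: Gb; apply/subsetPset/ndG/leq_maxr.
move=> k; have [mF Fkoo] := Foo k; have [mG Gkoo] := Goo k; split.
  by rewrite -[X in measurable X]setTI; apply: mg => //; exact: measurableX.
rewrite /lebesgue_cons /pushforward (_ : _ @^-1` _ = F k `*` G k).
  by rewrite product_measure1E// lte_mul_pinfty// ge0_fin_numE.
by rewrite -comp_preimage (_ : _ \o _ = id) ?preimage_id//; apply/funext => p; exact: gK.
Qed.

HB.instance Definition _ := Measure_isSigmaFinite.Build _ _ _ lebesgue_cons
  lebesgue_cons_sigma_finite.
End lebesgue_cons.

(* n-dimensional Lebesgue measure: the n-fold product of [lebesgue_measure]. *)
Fixpoint lebesgue_rV n : {sigma_finite_measure set 'rV[R]_n -> \bar R} :=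
  match n with
  | 0 => \d_(0 : 'rV[R]_0)
  | n'.+1 => lebesgue_cons (lebesgue_rV n')
  end.
End Borel_theory.

Definition frob (R : realType) m n (w z : 'M[R]_(m, n)) : R :=
  \sum_i \sum_j w i j * z i j.

Definition linear_subspace (R : realType) (V : lmodType R) (S : set V) :=
  S 0 /\ forall (a : R) x y, S x -> S y -> S (a *: x + y).

Section Geometry.
Context (R : realType) (d : nat).
Implicit Types (D T : set 'rV[R]_d).

Definition bounded_domain D :=
  [/\ open D, D !=set0, connected D & bounded_set D].

(* Near each boundary point D is the strict epigraph, in some direction nu, of
   a Lipschitz function of the component orthogonal to nu; the latter is
   encoded as a function on R^d invariant under translations along nu. *)
Definition lipschitz_boundary D :=
  forall x0, (closure D `\` D) x0 ->
  exists (nu : 'rV[R]_d) (r L : R) (g : 'rV[R]_d -> R),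
    [/\ frob nu nu = 1, 0 < r,
        forall x y, `|g x - g y| <= L * `|x - y|,
        forall x t, g (x + t *: nu) = g x &
        forall x, ball x0 r x -> (D x <-> g x < frob nu x)].

Definition bounded_lipschitz_domain D :=
  bounded_domain D /\ lipschitz_boundary D.

Definition closed_halfspace (h : 'rV[R]_d * R) : set 'rV[R]_d :=
  [set x | frob h.1 x <= h.2].

(* A bounded domain without slits whose closure is a finite union of convex
   polytopes, each cut out by finitely many half-spaces. *)
Definition polyhedral_domain T :=
  [/\ bounded_domain T, (closure T)° = T &
      exists P : seq (seq ('rV[R]_d * R)),
        (forall p h, p \in P -> h \in p -> h.1 != 0) /\
        closure T =
          [set x | exists2 p, p \in P &
                   forall h, h \in p -> closed_halfspace h x]].

(* Open, non-overlapping elements covering Omega. No face-to-face or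
   shape-regularity condition is imposed: the class contains the regular
   meshes in either sense. *)
Definition polyhedral_mesh D (N : nat) (T : 'I_N -> set 'rV[R]_d) :=
  [/\ forall k, polyhedral_domain (T k),
      forall k l, k != l -> T k `&` T l = set0 &
      closure D = \bigcup_k closure (T k)].

End Geometry.

Inductive Ukind := Uscalar | Uvector | Umatrix | Usym.

Definition Urows (k : Ukind) (d : nat) : nat :=
  match k with Uscalar => 1 | _ => d end.

Definition Ucols (k : Ukind) (d : nat) : nat :=
  match k with Umatrix | Usym => d | _ => 1 end.

Definition inU (R : realType) (k : Ukind) (d : nat) :
    set 'M[R]_(Urows k d, Ucols k d) :=
  match k return set 'M[R]_(Urows k d, Ucols k d) with
  | Usym => [set w : 'M[R]_d | w = w^T]
  | _ => setT
  end.
Arguments inU {R} k d.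

(* \sum_(|alpha| <= order) coef alpha * D^alpha, with coefficients in U. *)
Record diffop (R : realType) (d : nat) (k : Ukind) := DiffOp {
  order : nat;
  coef : {ffun 'I_d -> 'I_order.+1} -> 'M[R]_(Urows k d, Ucols k d);
  coef_inU : forall alpha, inU k d (coef alpha)
}.
Arguments coef {R d k} _ _.

Section Calculus.
Context (R : realType) (d : nat) (k : Ukind).
Local Notation E := 'rV[R]_d.
Local Notation U := 'M[R]_(Urows k d, Ucols k d).
Local Notation mu := (lebesgue_rV R d).

Definition partial (i : 'I_d) (f : E -> R) : E -> R :=
  fun x => 'D_(delta_mx ord0 i) f x.

Definition partial_mi m (alpha : {ffun 'I_d -> 'I_m.+1}) (f : E -> R) :
    E -> R :=
  foldr (fun i g => iter (alpha i) (partial i) g) f (enum 'I_d).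

Definition mi_abs m (alpha : {ffun 'I_d -> 'I_m.+1}) : nat :=
  (\sum_i alpha i)%N.

Definition smooth (f : E -> R) :=
  forall (s : seq 'I_d) (x : E), differentiable (foldr partial f s) x.

Definition test (D : set E) (f : E -> R) :=
  smooth f /\
  exists K : set E, [/\ compact K, K `<=` D & forall x, ~ K x -> f x = 0].

Definition testU (D : set E) (f : E -> U) :=
  (forall i j, test D (fun x => f x i j)) /\ forall x, inU k d (f x).

Definition applyA (A : diffop R d k) (f : E -> R) : E -> U :=
  fun x => \sum_(alpha | (mi_abs alpha <= order A)%N)
             partial_mi alpha f x *: coef A alpha.

Definition applyAs (A : diffop R d k) (f : E -> U) : E -> R :=
  fun x => \sum_(alpha | (mi_abs alpha <= order A)%N)
    (-1) ^+ mi_abs alpha *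
      partial_mi alpha (fun y => frob (coef A alpha) (f y)) x.

(* Elements of L_2(D) and L_2(D; U) are represented by functions on R^d, whose
   values outside D are irrelevant. *)
Definition L2 (D : set E) : set (E -> R) :=
  [set v : E -> R | measurable_fun D v /\
           mu.-integrable D (fun x => (v x ^+ 2)%:E)].

Definition L2U (D : set E) : set (E -> U) :=
  [set w : E -> U | (forall i j, L2 D (fun x => w x i j)) /\
           forall x, D x -> inU k d (w x)].

Definition ip (D : set E) (v v' : E -> R) : R :=
  \int[mu]_(x in D) (v x * v' x).

Definition ipU (D : set E) (w w' : E -> U) : R :=
  \int[mu]_(x in D) frob (w x) (w' x).

Definition norm2 (D : set E) (v : E -> R) : R := Num.sqrt (ip D v v).
Definition norm2U (D : set E) (w : E -> U) : R := Num.sqrt (ipU D w w).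

(* The tensor field acts on matrices; only its action on U is constrained. *)
Definition spd_tensor (D : set E) (C : E -> {linear U -> U}) :=
  [/\ forall x w, D x -> inU k d w -> inU k d (C x w),
      forall w i j, inU k d w -> measurable_fun D (fun x => C x w i j : R),
      exists M : R, {ae mu, forall x, D x -> forall w, inU k d w ->
        frob (C x w) (C x w) <= M * frob w w},
      {ae mu, forall x, D x -> forall w z, inU k d w -> inU k d z ->
        frob (C x w) z = frob w (C x z)} &
      exists2 c : R, 0 < c & {ae mu, forall x, D x -> forall w, inU k d w ->
        c * frob w w <= frob (C x w) w}].

Section Spaces.
Variable A : diffop R d k.

Definition is_weakA (D : set E) (v : E -> R) (g : E -> U) :=
  L2U D g /\ forall phi, testU D phi -> ip D v (applyAs A phi) = ipU D g phi.

Definition is_weakAs (D : set E) (w : E -> U) (g : E -> R) :=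
  L2 D g /\ forall phi, test D phi -> ipU D w (applyA A phi) = ip D g phi.

(* Distributional A v and A^* w on D: a chosen L_2 representative when one
   exists, 0 otherwise. *)
Definition wA (D : set E) (v : E -> R) : E -> U := xget 0 (is_weakA D v).
Definition wAs (D : set E) (w : E -> U) : E -> R := xget 0 (is_weakAs D w).

Variable Omega : set E.

Definition HA : set (E -> R) :=
  [set v | L2 Omega v /\ exists g, is_weakA Omega v g].

Definition HAs : set (E -> U) :=
  [set w | L2U Omega w /\ exists g, is_weakAs Omega w g].

Definition normAs (w : E -> U) : R :=
  Num.sqrt (norm2U Omega w ^+ 2 + norm2 Omega (wAs Omega w) ^+ 2).

(* Functionals on a set of functions are extended by 0 outside of it, so that
   equality of functionals is Leibniz equality. *)
Definition gammaG (v : E -> R) : (E -> U) -> R :=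
  fun w => if `[< HAs w >] then
    ipU Omega (wA Omega v) w - ip Omega v (wAs Omega w) else 0.

Definition H0A : set (E -> R) := [set v | HA v /\ gammaG v = 0].

Definition poincare_friedrichs (c : R) :=
  forall v, H0A v -> norm2 Omega v <= c * norm2U Omega (wA Omega v).

Variables (N : nat) (T : 'I_N -> set E).

Definition ipT (w w' : 'I_N -> E -> U) : R := \sum_k ipU (T k) (w k) (w' k).
Definition normT (w : 'I_N -> E -> U) : R := Num.sqrt (ipT w w).

Definition AT (v : E -> R) : 'I_N -> E -> U := fun k => wA (T k) v.

Definition HAT : set (E -> R) :=
  [set v | L2 Omega v /\ forall k, exists g, is_weakA (T k) v g].

Definition normAT (v : E -> R) : R :=
  Num.sqrt (norm2 Omega v ^+ 2 + normT (AT v) ^+ 2).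

Definition closed_subspace_AT (V : set (E -> R)) :=
  [/\ V `<=` HAT, linear_subspace V &
      forall (s : nat -> E -> R) v, (forall n, V (s n)) -> HAT v ->
        normAT (s n - v) @[n --> \oo] --> (0 : R) -> V v].

(* Finite-dimensional after identification of a.e. equal functions. *)
Definition finite_dim_L2 (V : set (E -> R)) :=
  exists (n : nat) (b : 'I_n -> E -> R), (forall i, V (b i)) /\
    forall v, V v -> exists c : 'I_n -> R,
      ae_eq mu Omega v (\sum_i c i *: b i).

Variable HtA : set (E -> R).

Definition gammaS (w : E -> U) : (E -> R) -> R :=
  fun v => if `[< HtA v >] then
    ip Omega (wAs Omega w) v - ipT (fun=> w) (AT v) else 0.

Definition HAsS : set ((E -> R) -> R) := gammaS @` HAs.

Definition normS (psi : (E -> R) -> R) : R :=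
  inf [set normAs w | w in [set w | HAs w /\ gammaS w = psi]].

Definition finite_dim (V : set ((E -> R) -> R)) :=
  exists (n : nat) (b : 'I_n -> (E -> R) -> R), (forall i, V (b i)) /\
    forall psi, V psi -> exists c : 'I_n -> R, psi = \sum_i c i *: b i.

(* The mixed system, posed on V x P for both the trial and the test space. *)
Definition mixed_solution (C : E -> {linear U -> U}) (f : E -> R)
    (V : set (E -> R)) (P : set ((E -> R) -> R))
    (u : E -> R) (psi : (E -> R) -> R) :=
  [/\ V u, P psi,
      forall du, V du ->
        ipT (fun k x => C x (AT u k x)) (AT du) + psi du = ip Omega f du &
      forall dpsi, P dpsi -> dpsi u = 0].

End Spaces.
End Calculus.

(* Main.v *)
(** On H~(A,T) the broken norm is a complete semi-inner-product norm modulo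
    a.e. equality, because weak derivatives are closed in L_2.  If a functional
    chi on it satisfies |chi v| <= K ||v||_(A,T) and kills test functions, its
    Riesz representative z gives w := - A z (elementwise) with A^* w = z,
    gamma(w) = chi and ||w||_(A^* ) = ||z||_(A,T) <= K.  Hence the trace norm of
    a difference of traces is controlled by its action on H~(A,T).

    F is a Fortin operator: v0 := v + F (u - v) satisfies the discrete
    constraint, with ||u - v0|| <= (1 + C_F) ||u - v||.  The error u_h - v0 lies
    in the discrete kernel, where the form is coercive by the discrete
    Poincaré-Friedrichs inequality; testing with it bounds u - u_h.  Then
    psi_h - eta is bounded on any x through its value at F x.  Existence holds
    since the discrete system is a symmetric linear system whose right-hand side
    is orthogonal to its kernel: this also covers spanning families that are
    redundant, and functions that are only determined a.e. *)
Require Import Defs.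
From mathcomp Require Import all_boot all_order all_algebra.
From mathcomp Require Import all_classical all_reals all_analysis.
From mathcomp Require Import measurable_realfun ring lra.
Import Order.TTheory GRing.Theory Num.Theory.
Import numFieldNormedType.Exports.
Set Implicit Arguments.
Unset Strict Implicit.
Unset Printing Implicit Defensive.
Local Open Scope classical_set_scope.
Local Open Scope ring_scope.

(** * Semi-inner products and Riesz representation *)

Section PsdForm.
Context (R : realType) (V : lmodType R).
Implicit Types (S : set V) (b : V -> V -> R).

(** Functions are representatives and weak derivatives are chosen by [xget], so [AT] is linear only
    almost everywhere and the bilinear forms are degenerate. Hence the Hilbert space arguments are
    run for semi-inner products restricted to a set. That the choice of representative is harmless
    rests on the fundamental lemma of the calculus of variations; smooth bumps, symmetry of mixed
    partials and integration by parts on ['rV[R]_d] are developed for the theory of weak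
    derivatives.

    The geometry enters through two facts. Elements lie inside [Omega], although the mesh relates
    closures only: a Lipschitz domain is the interior of its closure. The skeleton is negligible,
    because polyhedral boundaries lie in finitely many hyperplanes: integrals over [Omega] split
    into elementwise ones, and fields glued from elementwise pieces are determined a.e.

    The final constant is built from the bounds of the tensor, [CF] and [CPFd]: the extension
    argument bounds the trace norm with constant one, so no mesh-dependent factor arises. *)

Lemma linear_subspaceD S x y : linear_subspace S -> S x -> S y -> S (x + y).
Proof. by move=> [_ h] Sx Sy; have := h 1 x y Sx Sy; rewrite scale1r. Qed.

Lemma linear_subspaceZ S a x : linear_subspace S -> S x -> S (a *: x).
Proof. by move=> [S0 h] Sx; have := h a x 0 Sx S0; rewrite addr0. Qed.

Lemma linear_subspaceB S x y : linear_subspace S -> S x -> S y -> S (x - y).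
Proof.
by move=> [_ h] Sx Sy; have := h (-1) y x Sy Sx; rewrite scaleN1r addrC.
Qed.

Lemma linear_subspace_sum S n (c : 'I_n -> R) (x : 'I_n -> V) :
  linear_subspace S -> (forall i, S (x i)) -> S (\sum_i c i *: x i).
Proof.
move=> lS Sx; elim/big_ind : _ => [|y z Sy Sz|i _].
- by case: lS.
- exact: linear_subspaceD.
- exact: linear_subspaceZ.
Qed.

(** The form may be degenerate and the axioms hold on [S] only: an integral form is definite up to
    a.e. equality, and is known to be linear only where the integrals converge. Linearity in the
    second argument comes from symmetry. *)
Record psd_form S b := PsdForm {
  psd_sub : linear_subspace S ;
  psd_lin : forall a x y z, S x -> S y -> S z ->
    b (a *: x + y) z = a * b x z + b y z ;
  psd_sym : forall x y, S x -> S y -> b x y = b y x ;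
  psd_ge0 : forall x, S x -> 0 <= b x x }.

Section theory.
Context S b (pb : psd_form S b).
Let lS := psd_sub pb.
Let S0 : S 0. Proof. by case: lS. Qed.

Lemma psdDl x y z : S x -> S y -> S z -> b (x + y) z = b x z + b y z.
Proof.
by move=> Sx Sy Sz; have := psd_lin pb 1 Sx Sy Sz; rewrite scale1r mul1r.
Qed.

Lemma psd0l z : S z -> b 0 z = 0.
Proof. by move=> Sz; have := psdDl S0 S0 Sz; rewrite addr0; lra. Qed.

Lemma psdZl a x z : S x -> S z -> b (a *: x) z = a * b x z.
Proof.
by move=> Sx Sz; have := psd_lin pb a Sx S0 Sz; rewrite !addr0 psd0l// addr0.
Qed.

Lemma psdBl x y z : S x -> S y -> S z -> b (x - y) z = b x z - b y z.
Proof.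
move=> Sx Sy Sz; have := psd_lin pb (-1) Sy Sx Sz.
by rewrite scaleN1r addrC => ->; rewrite mulN1r addrC.
Qed.

Lemma psdDr x y z : S x -> S y -> S z -> b z (x + y) = b z x + b z y.
Proof.
move=> Sx Sy Sz; rewrite (psd_sym pb Sz); last exact: linear_subspaceD.
by rewrite psdDl// (psd_sym pb Sx)// (psd_sym pb Sy).
Qed.

Lemma psdBr x y z : S x -> S y -> S z -> b z (x - y) = b z x - b z y.
Proof.
move=> Sx Sy Sz; rewrite (psd_sym pb Sz); last exact: linear_subspaceB.
by rewrite psdBl// (psd_sym pb Sx)// (psd_sym pb Sy).
Qed.

Lemma psdZr a x z : S x -> S z -> b z (a *: x) = a * b z x.
Proof.
move=> Sx Sz; rewrite (psd_sym pb Sz); last exact: linear_subspaceZ.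
by rewrite psdZl// (psd_sym pb Sx).
Qed.

Lemma psd_suml n (c : 'I_n -> R) (x : 'I_n -> V) z :
  (forall i, S (x i)) -> S z -> b (\sum_i c i *: x i) z = \sum_i c i * b (x i) z.
Proof.
move=> Sx Sz.
have [] : S (\sum_i c i *: x i) /\
    b (\sum_i c i *: x i) z = \sum_i c i * b (x i) z; last by [].
elim/big_ind2 : _ => [|u r v s [Su ur] [Sv vs]|i _].
- by split => //; exact: psd0l.
- by split; [exact: linear_subspaceD|rewrite psdDl// ur vs].
- by split; [exact: linear_subspaceZ|rewrite psdZl].
Qed.

Lemma psd_polar t x y : S x -> S y ->
  b (x + t *: y) (x + t *: y) = b x x + t * b x y *+ 2 + t ^+ 2 * b y y.
Proof.
move=> Sx Sy; have Sty := linear_subspaceZ t lS Sy.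
rewrite psdDl ?psdDr ?psdZl ?psdZr//; try exact: linear_subspaceD.
rewrite (psd_sym pb Sy Sx); ring.
Qed.

(** Nonnegativity of the quadratic polynomial [b (x + t *: y) (x + t *: y)] in [t]. If [b y y = 0]
    it is affine, so its slope vanishes; otherwise it is evaluated at its minimiser. *)
Lemma psd_schwarz x y : S x -> S y -> b x y ^+ 2 <= b x x * b y y.
Proof.
move=> Sx Sy; have xx := psd_ge0 pb Sx; have yy := psd_ge0 pb Sy.
have pos t : 0 <= b x x + t * b x y *+ 2 + t ^+ 2 * b y y.
  rewrite -psd_polar//; apply: (psd_ge0 pb).
  by apply: linear_subspaceD => //; exact: linear_subspaceZ.
have [y0|y0] := eqVneq (b y y) 0.
  suff -> : b x y = 0 by rewrite expr0n mulr_ge0.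
  apply/eqP; apply/negPn/negP => xy0.
  (* This [t] would give the value [- b x x - 2 < 0]. *)
  have := pos (- (b x x + 1) / b x y); rewrite y0 mulr0 addr0.
  by rewrite divfK//; lra.
have := pos (- b x y / b y y).
have -> : b x x + - b x y / b y y * b x y *+ 2 + (- b x y / b y y) ^+ 2 * b y y =
  (b x x * b y y - b x y ^+ 2) / b y y by field.
by rewrite pmulr_lge0 ?invr_gt0 ?lt_def ?y0// subr_ge0.
Qed.

Definition psd_norm x := Num.sqrt (b x x).

Lemma psd_norm_ge0 x : 0 <= psd_norm x. Proof. exact: sqrtr_ge0. Qed.

Lemma sqr_psd_norm x : S x -> psd_norm x ^+ 2 = b x x.
Proof. by move=> Sx; rewrite sqr_sqrtr// (psd_ge0 pb). Qed.

Lemma psd_cauchy x y : S x -> S y -> `|b x y| <= psd_norm x * psd_norm y.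
Proof.
move=> Sx Sy; rewrite -sqrtr_sqr -sqrtrM ?(psd_ge0 pb)//.
by rewrite ler_wsqrtr// psd_schwarz.
Qed.

Lemma psd_normD x y : S x -> S y -> psd_norm (x + y) <= psd_norm x + psd_norm y.
Proof.
move=> Sx Sy; have Sxy := linear_subspaceD lS Sx Sy.
rewrite -(@ler_pXn2r _ 2)// ?nnegrE ?addr_ge0 ?psd_norm_ge0//.
rewrite sqr_psd_norm// sqrrD !sqr_psd_norm// psdDl// !psdDr//.
rewrite (psd_sym pb Sy Sx); have := psd_cauchy Sx Sy.
by move=> /(le_trans (ler_norm _)); lra.
Qed.

Lemma psd_normZ a x : S x -> psd_norm (a *: x) = `|a| * psd_norm x.
Proof.
move=> Sx; rewrite /psd_norm psdZl ?psdZr//; last exact: linear_subspaceZ.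
by rewrite mulrA -expr2 sqrtrM ?sqr_ge0// sqrtr_sqr.
Qed.

Lemma psd_norm_eq0 x y : S x -> S y -> b x x = 0 -> b x y = 0.
Proof.
move=> Sx Sy x0; have := psd_schwarz Sx Sy; rewrite x0 mul0r.
by rewrite real_exprn_even_le0//= ?num_real// => /eqP.
Qed.

End theory.

Lemma psd_formS S S' b : linear_subspace S' -> S' `<=` S ->
  psd_form S b -> psd_form S' b.
Proof.
move=> lS' SS' pb; split => //.
- by move=> a x y z /SS' ? /SS' ? /SS' ?; exact: (psd_lin pb).
- by move=> x y /SS' ? /SS' ?; exact: (psd_sym pb).
- by move=> x /SS' ?; exact: (psd_ge0 pb).
Qed.

Lemma psd_formD S b1 b2 : psd_form S b1 -> psd_form S b2 ->
  psd_form S (fun x y => b1 x y + b2 x y).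
Proof.
move=> p1 p2; split; first exact: psd_sub p1.
- by move=> a x y z Sx Sy Sz; rewrite (psd_lin p1)// (psd_lin p2)//; ring.
- by move=> x y Sx Sy; rewrite (psd_sym p1)// (psd_sym p2).
- by move=> x Sx; rewrite addr_ge0 ?(psd_ge0 p1) ?(psd_ge0 p2).
Qed.

Lemma psd_form_sum S n (b : 'I_n -> V -> V -> R) : linear_subspace S ->
  (forall i, psd_form S (b i)) -> psd_form S (fun x y => \sum_i b i x y).
Proof.
move=> lS pb; split => //.
- move=> a x y z Sx Sy Sz; rewrite mulr_sumr -big_split/=.
  by apply: eq_bigr => i _; rewrite (psd_lin (pb i)).
- by move=> x y Sx Sy; apply: eq_bigr => i _; rewrite (psd_sym (pb i)).
- by move=> x Sx; apply: sumr_ge0 => i _; exact: psd_ge0 (pb i) _ _.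
Qed.

End PsdForm.

(* A minimising sequence of the energy is Cauchy by the parallelogram identity. *)
Lemma psd_riesz (R : realType) (V : lmodType R) (S : set V) (b : V -> V -> R)
    (l : V -> R) (K : R) : psd_form S b ->
  (forall a x y, S x -> S y -> l (a *: x + y) = a * l x + l y) ->
  (forall x, S x -> `|l x| <= K * psd_norm b x) ->
  (forall s : nat -> V, (forall n, S (s n)) ->
    (forall e : R, 0 < e -> exists N, forall m n, (N <= m)%N -> (N <= n)%N ->
      b (s m - s n) (s m - s n) <= e) ->
    exists2 z, S z & forall e : R, 0 < e -> exists N, forall n, (N <= n)%N ->
      b (s n - z) (s n - z) <= e) ->
  exists2 z, S z & forall v, S v -> b z v = l v.
Proof.
move=> pb ll blK compl.
have bl x : S x -> `|l x| <= `|K| * psd_norm b x.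
  by move=> /blK /le_trans; apply; rewrite ler_wpM2r ?psd_norm_ge0// ler_norm.
have lS := psd_sub pb; have S0 : S 0 by case: lS.
have l0 : l 0 = 0 by have := ll 1 0 0 S0 S0; rewrite scale1r addr0; lra.
have lZ a x : S x -> l (a *: x) = a * l x.
  by move=> Sx; have := ll a x 0 Sx S0; rewrite !addr0 l0 addr0.
have lD x y : S x -> S y -> l (x + y) = l x + l y.
  by move=> Sx Sy; have := ll 1 x y Sx Sy; rewrite scale1r mul1r.
(* Quadratic energy: [b z v = l v] is its Euler-Lagrange equation. *)
pose J x := b x x - l x *+ 2.
have JK x : S x -> - `|K| ^+ 2 <= J x.
  move=> Sx; rewrite /J -(sqr_psd_norm pb Sx).
  have := bl x Sx; have := ler_norm (l x); have := sqr_ge0 (psd_norm b x - `|K|).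
  by rewrite sqrrB; lra.
pose j := inf (J @` S).
have hi : has_inf (J @` S).
  split; first by exists (J 0), 0.
  by exists (- `|K| ^+ 2) => _ [x Sx <-]; exact: JK.
have jle x : S x -> j <= J x by move=> Sx; apply: ge_inf; [case: hi|exists x].
pose ep (n : nat) : R := n.+1%:R^-1.
have sex (n : nat) : exists x, S x /\ J x < j + ep n.
  have n0 : 0 < ep n by rewrite invr_gt0.
  by have [_ [x Sx <-] xlt] := inf_adherent n0 hi; exists x.
pose s n := projT1 (cid (sex n)).
have Ss n : S (s n) := (projT2 (cid (sex n))).1.
have Js n : J (s n) < j + ep n := (projT2 (cid (sex n))).2.
have polar t x y : S x -> S y ->
    J (x + t *: y) = J x + t * (b x y - l y) *+ 2 + t ^+ 2 * b y y.
  move=> Sx Sy; rewrite /J (psd_polar pb)// lD ?lZ//; last exact: linear_subspaceZ.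
  by lra.
(* [J] is at least [j] at the midpoint of [s m] and [s n], so a quarter of their squared distance is
   at most [(J (s m) + J (s n)) / 2 - j]. *)
have cauchy m n : b (s m - s n) (s m - s n) <= (ep m + ep n) *+ 2.
  have Smn := linear_subspaceB lS (Ss m) (Ss n).
  have := jle _ (linear_subspaceD lS (Ss n) (linear_subspaceZ 2^-1 lS Smn)).
  rewrite polar//; have := polar 1 _ _ (Ss n) Smn.
  rewrite scale1r addrC subrK => Jm.
  have := Js m; rewrite Jm; have := Js n.
  move: (J (s n)) (b (s m - s n) (s m - s n)) (b (s n) (s m - s n) - _).
  move: (ep m) (ep n) => x y; move: (j) => jj A q c.
  have -> : 2^-1 ^+ 2 * q = q / 4 by field.
  rewrite expr1n !mul1r; lra.
have small (e : R) : 0 < e -> exists N : nat, ep N < e.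
  by move=> e0; have [N _ h] := near_infty_natSinv_lt (PosNum e0); exists N; apply: h => /=.
have lei (N m : nat) : (N <= m)%N -> ep m <= ep N.
  by move=> Nm; rewrite /ep lef_pV2 ?posrE ?ltr0n// ler_nat.
have [e e0|z Sz sz] := compl s Ss.
  have e4 : 0 < e / 4 by lra.
  have [N Ne] := small _ e4; exists N => m n Nm Nn.
  have := cauchy m n; have := lei _ _ Nm; have := lei _ _ Nn; lra.
have Jz : J z <= j.
  apply/ler_addgt0Pr => e e0.
  (* Up to a factor two, [M] bounds the slope of [J] at [z]; the added one makes it positive. *)
  pose M := `|K| + psd_norm b z + 1.
  have M0 : 0 < M by rewrite ltr_wpDl// addr_ge0// psd_norm_ge0.
  have e1 : 0 < e / (4 * M) by rewrite divr_gt0// mulr_gt0.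
  have [N1 h1] := sz _ (exprn_gt0 2 e1).
  have e2 : 0 < e / 2 by lra.
  have [N2 h2] := small _ e2.
  pose n := maxn N1 N2.
  have Sd := linear_subspaceB lS (Ss n) Sz.
  have := polar 1 z _ Sz Sd; rewrite scale1r addrC subrK => JE.
  have := Js n; rewrite JE.
  have nd : psd_norm b (s n - z) <= e / (4 * M).
    rewrite -(@ler_pXn2r _ 2)// ?nnegrE ?psd_norm_ge0// ?(ltW e1)//.
    by rewrite (sqr_psd_norm pb)// h1// leq_maxl.
  have := psd_ge0 pb Sd; have := bl _ Sd; have := psd_cauchy pb Sz Sd.
  rewrite !ler_norml => /andP[c1 _] /andP[_ c2] dd.
  have c3 : psd_norm b z * psd_norm b (s n - z) + `|K| * psd_norm b (s n - z) <= e / 4.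
    rewrite -mulrDl.
    apply: (@le_trans _ _ (M * (e / (4 * M)))).
      apply: ler_pM => //; rewrite ?psd_norm_ge0//.
        by rewrite addr_ge0 ?psd_norm_ge0.
      by rewrite /M; lra.
    rewrite le_eqVlt; apply/orP; left; apply/eqP; field; lra.
  have := lei _ _ (leq_maxr N1 N2); rewrite -/n; lra.
exists z => // v Sv.
apply/eqP; apply/negPn/negP => ne.
pose q := b v v; have q0 : 0 <= q := psd_ge0 pb Sv.
pose dlt := b z v - l v; have d0 : 0 < dlt ^+ 2 by rewrite exprn_even_gt0//= subr_eq0.
(* The optimal step along [v] would be [- dlt / q]; the denominator [q + 1] also covers [q = 0] and
   still lowers the energy strictly. *)
have := jle _ (linear_subspaceD lS Sz (linear_subspaceZ (- dlt / (q + 1)) lS Sv)).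
rewrite polar// -/q -/dlt => /(le_trans Jz); rewrite -addrA lerDl.
have -> : - dlt / (q + 1) * dlt *+ 2 + (- dlt / (q + 1)) ^+ 2 * q =
  - (dlt ^+ 2 * (q + 2) / (q + 1) ^+ 2) by field; lra.
rewrite oppr_ge0 leNgt => /negP; apply.
by apply: divr_gt0; [apply: mulr_gt0 => //; lra|apply: exprn_gt0; lra].
Qed.

(** * Lebesgue measure on row vectors *)

Section Borel.
Context (R : realType) (n : nat).
Implicit Types (x : 'rV[R]_n) (O D : set 'rV[R]_n).

Lemma measurable_coord_preimage (i : 'I_n) (Y : set R) :
  measurable Y -> measurable [set x : 'rV[R]_n | Y (x ord0 i)].
Proof.
move=> mY; have := @measurable_coord R n i measurableT _ mY.
by rewrite setTI.
Qed.

Lemma measurable_ball_rV x (r : R) : measurable (ball x r).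
Proof.
have [r0|r0] := ltP 0 r; last first.
  rewrite (_ : ball x r = set0)//; apply/seteqP; split => // y [r1 _].
  by move: r0; rewrite leNgt r1.
rewrite (_ : ball x r = \bigcap_(i in [set: 'I_n])
    [set y : 'rV[R]_n | ball (x ord0 i) r (y ord0 i)]).
  apply: fin_bigcap_measurable => [|i _]; first exact: finite_finset.
  apply: (@measurable_coord_preimage i (ball (x ord0 i) r)).
  by rewrite ball_itv; exact: measurable_itv.
apply/seteqP; split => y /=.
  by move=> [_ h] i _; exact: h.
by move=> h; split => // i j; rewrite (ord1 i); exact: h.
Qed.

(** Balls with rational centres and radii [1 / (m + 1)] are countably many. The doubled balls stay
    in [O], so the closure of a box contained in one of the balls is still in [O], as compact
    supports require. *)
Lemma open_rV_bigcup_ball O : open O ->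
  exists (x : nat -> 'rV[R]_n) (r : nat -> R),
    (forall k, ball (x k) (r k *+ 2) `<=` O) /\
    O = \bigcup_k ball (x k) (r k).
Proof.
move=> oO.
pose c (p : 'rV[rat]_n * nat) : 'rV[R]_n := map_mx (ratr : rat -> R) p.1.
pose s (p : 'rV[rat]_n * nat) : R := p.2.+1%:R^-1.
pose ok (p : 'rV[rat]_n * nat) := `[< ball (c p) (s p *+ 2) `<=` O >].
exists (fun k => oapp c 0 (unpickle k)).
(* Indices that code no pair, or a pair whose doubled ball leaves [O], get radius zero, hence the
   empty ball. *)
exists (fun k => oapp (fun p => if ok p then s p else 0) 0 (unpickle k)).
have ball0 (y : 'rV[R]_n) : ball y (0 : R) `<=` set0.
  by move=> z []; rewrite ltxx.
have cO k : ball (oapp c 0 (unpickle k))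
    (oapp (fun p => if ok p then s p else 0) 0 (unpickle k) *+ 2) `<=` O.
  case: unpickle => [p|] /=; last by rewrite mul0rn => y /ball0.
  by case: ifPn => [/asboolP//|_]; rewrite mul0rn => y /ball0.
split => //; apply/seteqP; split => [x Ox|x [k _ kx]]; last first.
  apply: (cO k); apply: le_ball kx; rewrite mulr2n lerDl.
  by case: unpickle => //= p; case: ifP => // _; rewrite invr_ge0.
have /nbhs_ballP[e/= e0 xe] : nbhs x O by exact: open_nbhs_nbhs.
(* Three radii must fit in [e]: the centre is within one of [x], and the doubled ball adds two. *)
have [m me] : exists m : nat, m.+1%:R^-1 < e / 3.
  have := near_infty_natSinv_lt (PosNum (divr_gt0 e0 (ltr0n R 3))).
  by move=> [N _ /(_ N (leqnn _))]; exists N.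
have m0 : 0 < m.+1%:R^-1 :> R by rewrite invr_gt0.
have qex (i : 'I_n) : exists q : rat, ball (x ord0 i) m.+1%:R^-1 (ratr q : R).
  have [y [h [q _ qy]]] := @dense_rat R (ball (x ord0 i) m.+1%:R^-1)
    (ex_intro _ (x ord0 i) (ballxx _ m0)) (ball_open _ _).
  by exists q; rewrite qy.
pose q i := projT1 (cid (qex i)).
have qP i := projT2 (cid (qex i)).
pose Q : 'rV[rat]_n := \row_i q i.
have xQ : ball x m.+1%:R^-1 (map_mx ratr Q : 'rV[R]_n).
  by split => // i j; rewrite !mxE (ord1 i); exact: qP.
exists (pickle (Q, m)) => //; rewrite pickleK /= /ok asboolT; last first.
  move=> y yQ; apply: xe.
  apply: (@le_ball _ _ _ (m.+1%:R^-1 + m.+1%:R^-1 *+ 2)).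
    by rewrite -mulrS -[leLHS]mulr_natr -ler_pdivlMr ?ltr0n// ltW.
  exact: ball_triangle xQ yQ.
exact: ball_sym.
Qed.

Lemma open_rV_measurable O : open O -> measurable O.
Proof.
move=> /open_rV_bigcup_ball[x [r [_ ->]]].
by apply: bigcupT_measurable => k; exact: measurable_ball_rV.
Qed.

Lemma continuous_rV_measurable (f : 'rV[R]_n -> R) : continuous f ->
  measurable_fun setT f.
Proof.
move=> cf; apply: (measurability (@RGenOpens.G R)).
  exact: RGenOpens.measurableE.
move=> _ [_ [a [b ->] <-]]; rewrite setTI; apply: open_rV_measurable.
by apply: open_comp => [x _|]; [exact: cf|exact: interval_open].
Qed.

(** Boxes form a pi-system that generates the sigma-algebra, and the balls of the sup norm are cubes
    among them. *)
Definition obox (a b : 'rV[R]_n) : set 'rV[R]_n :=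
  [set x | forall i, a ord0 i < x ord0 i < b ord0 i].

Lemma oboxI a b a' b' : obox a b `&` obox a' b' =
  obox (\row_i Num.max (a ord0 i) (a' ord0 i))
       (\row_i Num.min (b ord0 i) (b' ord0 i)).
Proof.
apply/seteqP; split => x /=.
  by move=> [h h'] i; rewrite !mxE gt_max lt_min; have /andP[-> ->] := h i; rewrite h'.
move=> h; split => i; have := h i; rewrite !mxE gt_max lt_min;
  by move=> /andP[/andP[? ?] /andP[? ?]]; apply/andP.
Qed.

Lemma ball_obox x (r : R) : 0 < r -> ball x r = obox (x - const_mx r) (x + const_mx r).
Proof.
move=> r0; apply/seteqP; split => y /=.
  by move=> [_ h] i; have := h ord0 i; rewrite !mxE ball_itv /= in_itv.
move=> h; split => // i j; have := h j; rewrite (ord1 i) !mxE.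
by rewrite ball_itv /= in_itv.
Qed.

Lemma measurable_obox a b : measurable (obox a b).
Proof.
rewrite (_ : obox a b = \bigcap_(i in [set: 'I_n])
    [set x : 'rV[R]_n | `]a ord0 i, b ord0 i[%classic (x ord0 i)]).
  apply: fin_bigcap_measurable => [|i _]; first exact: finite_finset.
  exact: measurable_coord_preimage.
apply/seteqP; split => x /=; first by move=> h i _ /=; rewrite in_itv/= h.
by move=> h i; have := h i I; rewrite /= in_itv.
Qed.

(** A slab in one coordinate is the union over [k] of boxes whose other sides are []-k, k[], and
    open intervals generate the sigma-algebra of the line. *)
Lemma obox_generate : @measurable _ 'rV[R]_n =
  <<s [set Q | exists a b, Q = obox a b] >>.
Proof.
apply/seteqP; split; last first.
  apply: smallest_sub; first exact: sigma_algebra_measurable.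
  by move=> _ [a [b ->]]; exact: measurable_obox.
apply: smallest_sub; first exact: smallest_sigma_algebra.
rewrite -bigcup_seq => A [i _] [Y mY <-] /=; rewrite setTI.
have H : sigma_algebra setT [set B : set R |
    <<s [set Q | exists a b, Q = obox a b] >> [set x : 'rV[R]_n | B (x ord0 i)]].
  split=> [|B mB|F mF] /=.
  - exact: sigma_algebra0.
  - have := sigma_algebraC mB; congr (<<s _ >> _); apply/seteqP; split => x /=.
    + by move=> h; split.
    + by case.
  - by move: mF => /sigma_algebra_bigcup; rewrite -preimage_bigcup.
have : (@RGenOpens.G R).-sigma.-measurable Y.
  by rewrite -RGenOpens.measurableE.
move: Y {mY}; apply: smallest_sub => // _ [a [b ->]].
change (<<s [set Q | exists a b, Q = obox a b] >> [set x : 'rV[R]_n | `]a, b[%classic (x ord0 i)]).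
rewrite (_ : [set x : 'rV[R]_n | `]a, b[%classic (x ord0 i)] = \bigcup_k obox
  (\row_j if j == i then a else - k%:R) (\row_j if j == i then b else k%:R)).
  apply: sigma_algebra_bigcup => k; apply: sub_sigma_algebra.
  by eexists; eexists; reflexivity.
apply/seteqP; split => x /=.
  move=> xi; exists (Num.bound `|x|) => // j; rewrite !mxE.
  case: eqP => [->//|_]; rewrite -ltr_norml.
  apply: le_lt_trans (archi_boundP _); last exact: normr_ge0.
  rewrite [leRHS]/Num.norm/= mx_normrE.
  exact: (le_bigmax _ (fun ij => `|x ij.1 ij.2|) (ord0, j)).
by move=> [k _ /(_ i)]; rewrite !mxE eqxx in_itv.
Qed.

End Borel.

(** * Integrals over boxes and finiteness on bounded sets *)

Section BorelIntegral.
Context (R : realType) (n : nat).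
Implicit Types (a b : 'rV[R]_n).

(** Dynkin's theorem: the measurable [S] for which [g] has zero integral over [S] inside the given
    box form a lambda-system containing the pi-system of boxes; zero integrals over all measurable
    subsets force [g = 0] a.e. *)
Lemma ae_eq0_obox (mu : {measure set 'rV[R]_n -> \bar R}) (g : 'rV[R]_n -> R) a b :
  mu.-integrable (obox a b) (EFin \o g) ->
  (forall a' b', \int[mu]_(x in obox a' b' `&` obox a b) (g x)%:E = 0)%E ->
  ae_eq mu (obox a b) g (cst 0).
Proof.
move=> gi h; have mD := measurable_obox a b.
have key S : measurable S ->
    (\int[mu]_(x in S `&` obox a b) (g x)%:E = 0)%E.
  rewrite obox_generate; move: S; apply: dynkin_induction.
  - exact: obox_generate.
  - move=> _ _ [a1 [b1 ->]] [a2 [b2 ->]]; rewrite oboxI; by eexists; eexists.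
  - by have := h a b; rewrite setIid setTI.
  - by move=> _ [a1 [b1 ->]]; exact: h.
  - move=> S mS S0.
    have DE : obox a b = (S `&` obox a b) `|` (~` S `&` obox a b).
      by rewrite -setIUl setUv setTI.
    have : (\int[mu]_(x in obox a b) (g x)%:E = 0)%E.
      by have := h a b; rewrite setIid.
    rewrite [in X in X -> _]DE integral_setU_EFin//.
    + by rewrite S0 add0e.
    + exact: measurableI.
    + by apply: measurableI => //; exact: measurableC.
    + by rewrite -DE; apply/measurable_EFinP; exact: measurable_int gi.
    + rewrite disj_set2E setIACA setICr set0I; exact/eqP.
  - move=> F mF tF F0; rewrite setI_bigcupl integral_bigcup.
    + by rewrite eseries0// => i _ _; exact: F0.
    + apply/trivIsetP => i j _ _ ij; rewrite setIACA setIid.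
      by move/trivIsetP : tF => -> //; rewrite set0I.
    + by move=> k; exact: measurableI.
    + apply: integrableS gi => //; last by rewrite -setI_bigcupl; exact: subIsetr.
      by apply: bigcupT_measurable => k; exact: measurableI.
have : ae_eq mu (obox a b) (EFin \o g) (cst 0%E).
  apply: integral_ae_eq => // E ED mE; rewrite integral0 -(key E mE).
  by rewrite setIidl.
by apply: filterS => x /= h1 /h1 [].
Qed.

Lemma lebesgue_rV_cube_lty m (M : R) :
  (lebesgue_rV R m (obox (const_mx (- M)%R) (const_mx M)) < +oo)%E.
Proof.
elim: m => [|m IH].
  rewrite /= diracE; exact: ltry.
change (lebesgue_rV R m.+1 (obox (const_mx (- M)%R) (const_mx M))) with
  ((@lebesgue_measure R \x lebesgue_rV R m)%E
     ((@rV_cons R m) @^-1` (obox (const_mx (- M)%R) (const_mx M)))).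
rewrite (_ : (@rV_cons R m) @^-1` _ =
    (`](- M)%R, M[%classic : set (measurableTypeR R)) `*`
    obox (const_mx (- M)) (const_mx M)).
  rewrite product_measure1E//; last exact: measurable_obox.
  rewrite lte_mul_pinfty//.
  by rewrite ge0_fin_numE//= lebesgue_measure_itv/=; case: ifP; rewrite ?ltry.
apply/seteqP; split => -[x y] /=.
  move=> h; split.
    by rewrite in_itv/=; have := h ord0; rewrite !mxE unlift_none.
  by move=> i; have := h (lift ord0 i); rewrite !mxE liftK.
rewrite in_itv/= => -[hx hy] i; rewrite !mxE.
by case: unliftP => [j ji|ji] //=; have := hy j; rewrite !mxE.
Qed.

Lemma bounded_rV_sub (D : set 'rV[R]_n) : bounded_set D ->
  exists2 M, 0 < M & D `<=` obox (const_mx (- M)) (const_mx M).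
Proof.
move=> [M [_ hM]]; exists (`|M| + 2); first by rewrite ltr_wpDl.
move=> x Dx i; rewrite !mxE -ltr_norml.
apply: (@le_lt_trans _ _ `|x|).
  rewrite [leRHS]/Num.norm/= mx_normrE.
  exact: (le_bigmax _ (fun ij => `|x ij.1 ij.2|) (ord0, i)).
apply: (@le_lt_trans _ _ (`|M| + 1)); last by rewrite ltrD2l ltr1n.
by apply: hM => //; rewrite (le_lt_trans (ler_norm M))// ltrDl.
Qed.

Lemma bounded_rV_lty (D : set 'rV[R]_n) : measurable D -> bounded_set D ->
  (lebesgue_rV R n D < +oo)%E.
Proof.
move=> mD /bounded_rV_sub[M _ DM].
apply: le_lt_trans (lebesgue_rV_cube_lty n M).
by apply: le_measure => //; rewrite inE//; exact: measurable_obox.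
Qed.

End BorelIntegral.

(** * Square-integrable functions *)

Section SquareIntegrable.
Context d (T : measurableType d) (R : realType) (mu : {measure set T -> \bar R}).
Context (D : set T) (mD : measurable D).
Implicit Types (f g h : T -> R).

(** A version of [L2] over an arbitrary measure space; [L2] and [ip] are instances of [sqint] and
    [sqip] by conversion. *)
Definition sqint : set (T -> R) :=
  [set v : T -> R | measurable_fun D v /\ mu.-integrable D (fun x => (v x ^+ 2)%:E)].

Definition sqip f g : R := \int[mu]_(x in D) (f x * g x).

Lemma integrable_sqr_mul f g : sqint f -> sqint g ->
  mu.-integrable D (EFin \o (fun x => f x * g x)).
Proof.
move=> [mf f2] [mg g2]; have := integrableD mD f2 g2; apply: le_integrable => //.
  by apply/measurable_EFinP; exact: measurable_funM.
move=> x _ /=; rewrite lee_fin [leRHS]ger0_norm ?addr_ge0 ?sqr_ge0//.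
have := sqr_ge0 (`|f x| - `|g x|); rewrite sqrrB !real_normK ?num_real// normrM.
have := sqr_ge0 (f x); have := sqr_ge0 (g x).
move: (f x ^+ 2) (g x ^+ 2) (`|f x| * `|g x|) => a b c; lra.
Qed.

Lemma sqint0 : sqint 0.
Proof.
split; first exact: measurable_cst.
by under eq_fun do rewrite expr0n/=; exact: integrable0.
Qed.

Lemma sqint_lin (a : R) f g : sqint f -> sqint g -> sqint (a *: f + g).
Proof.
move=> sf sg; have [mf f2] := sf; have [mg g2] := sg; split.
  by apply: measurable_funD => //; apply: measurable_funM => //; exact: measurable_cst.
have i1 := integrableD mD (integrableZl mD (a ^+ 2) f2) (integrableD mD
  (integrableZl mD (a *+ 2) (integrable_sqr_mul sf sg)) g2).
apply: eq_integrable i1 => // x _ /=; rewrite -!EFinM -!EFinD; congr EFin.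
rewrite [in RHS]/GRing.add/= [in RHS]/GRing.scale/=.
by change ((a ^+ 2 * f x ^+ 2 + (a *+ 2 * (f x * g x) + g x ^+ 2)) = (a * f x + g x) ^+ 2); ring.
Qed.

Lemma sqint_subspace : linear_subspace sqint.
Proof. by split; [exact: sqint0|move=> a x y; exact: sqint_lin]. Qed.

Lemma sqip_psd : psd_form sqint sqip.
Proof.
split; first exact: sqint_subspace.
- move=> a f g h sf sg sh; rewrite /sqip -RintegralZl//; last exact: integrable_sqr_mul.
  rewrite -RintegralD//; last 2 first.
  + exact: integrableZl (integrable_sqr_mul sf sh).
  + exact: integrable_sqr_mul.
  by apply: eq_Rintegral => x _; rewrite mulrA -mulrDl.
- by move=> f g _ _; apply: eq_Rintegral => x _; rewrite mulrC.
- by move=> f _; apply: Rintegral_ge0 => x _; rewrite -expr2 sqr_ge0.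
Qed.

Lemma ae_eq_Rintegral f g : measurable_fun D f -> measurable_fun D g ->
  ae_eq mu D f g -> \int[mu]_(x in D) f x = \int[mu]_(x in D) g x.
Proof.
move=> mf mg fg; congr fine; apply: ae_eq_integral => //; [exact/measurable_EFinP..|].
by apply: filterS fg => x /= h /h ->.
Qed.

Lemma sqip_ae_eq f f' g g' : sqint f -> sqint f' -> sqint g -> sqint g' ->
  ae_eq mu D f f' -> ae_eq mu D g g' -> sqip f g = sqip f' g'.
Proof.
move=> [mf _] [mf' _] [mg _] [mg' _] ff' gg'; apply: ae_eq_Rintegral.
- exact: measurable_funM.
- exact: measurable_funM.
- by apply: filterS2 ff' gg' => x h1 h2 Dx; rewrite h1// h2.
Qed.

Lemma sqip_eq0 f : sqint f -> sqip f f = 0 -> ae_eq mu D f (cst 0).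
Proof.
move=> sf f0; have [_ f2] := sf.
have I0 : (\int[mu]_(x in D) `|(f x ^+ 2)%:E| = 0)%E.
  under eq_integral => x _ do rewrite gee0_abs ?lee_fin ?sqr_ge0//.
  rewrite -[LHS]fineK; first exact: (congr1 EFin f0).
  exact: integrable_fin_num.
have := (ae_eq_integral_abs mu mD (measurable_int _ f2)).1 I0.
by apply: filterS => x /= h /h [] /eqP; rewrite sqrf_eq0 => /eqP.
Qed.

Lemma ae_eq_sqip0 f : sqint f -> ae_eq mu D f (cst 0) -> sqip f f = 0.
Proof.
move=> sf f0; rewrite (sqip_ae_eq sf sqint0 sf sqint0)//.
by rewrite (psd0l sqip_psd sqint0).
Qed.

End SquareIntegrable.
Arguments sqint {d T R} mu D.
Arguments sqip {d T R} mu D f g.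

Lemma sqint_sub d (T : measurableType d) (R : realType)
    (mu : {measure set T -> \bar R}) (D E : set T) (f : T -> R) :
  measurable D -> measurable E -> E `<=` D -> sqint mu D f -> sqint mu E f.
Proof.
move=> mD mE ED [mf f2]; split; first exact: measurable_funS mf.
exact: integrableS f2.
Qed.

Lemma nneseries_lty_cvg (R : realType) (u : nat -> R) :
  (forall n, 0 <= u n) -> (\sum_(n <oo) (u n)%:E < +oo)%E -> cvgn (series u).
Proof.
move=> u0 uoo; have uge n : (0 <= (u n)%:E)%E by rewrite lee_fin.
apply: nondecreasing_is_cvgn.
  by apply/nondecreasing_seqP => n; rewrite seriesSr lerDl.
exists (fine (\sum_(n <oo) (u n)%:E)) => _ [n _ <-].
rewrite -lee_fin fineK; last by rewrite ge0_fin_numE// nneseries_ge0.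
by rewrite /series/= -sumEFin; apply: nneseries_lim_ge => k _ _.
Qed.

(** * Completeness of square-integrable functions *)

Section SqintComplete.
Context d (T : measurableType d) (R : realType) (mu : {measure set T -> \bar R}).
Context (D : set T) (mD : measurable D) (muD : (mu D < +oo)%E).
Implicit Types (f g h : T -> R).
Let pip := sqip_psd mu mD.

Lemma sqint_cst (c : R) : sqint mu D (cst c).
Proof.
split; first exact: measurable_cst.
apply/integrableP; split.
  by apply/measurable_EFinP; exact: (measurable_cst (c ^+ 2)).
rewrite (_ : \int[mu]_(x in D) _ = `|(c ^+ 2)%:E| * mu D)%E ?lte_mul_pinfty//.
exact: (integral_cst mu mD `|(c ^+ 2)%:E|%E).
Qed.

Lemma sqint_norm f : sqint mu D f -> sqint mu D (fun x => `|f x|).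
Proof.
move=> [mf f2]; split; first exact: measurableT_comp.
by under eq_fun do rewrite real_normK ?num_real//.
Qed.

(** Cauchy-Schwarz against the constant one: on a set of finite measure, increments small in [L_2]
    are small in [L_1], where their sum can be integrated term by term. *)
Lemma sqint_abs_integral_le f : sqint mu D f ->
  (\int[mu]_(x in D) `|f x|%:E <=
    (psd_norm (sqip mu D) f * psd_norm (sqip mu D) (cst 1%R))%:E)%E.
Proof.
move=> sf; have s1 := sqint_cst 1.
have fi := integrable_sqr_mul mD (sqint_norm sf) s1.
have -> : (\int[mu]_(x in D) `|f x|%:E = (sqip mu D (fun x => `|f x|%R) (cst 1%R))%:E)%E.
  rewrite /sqip /Rintegral fineK.
    by apply: eq_integral => x _; rewrite mulr1.
  by apply: integrable_fin_num.
have -> : psd_norm (sqip mu D) f = psd_norm (sqip mu D) (fun x => `|f x|).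
  congr Num.sqrt; apply: eq_Rintegral => x _.
  by rewrite -normrM -expr2 ger0_norm ?sqr_ge0.
rewrite lee_fin; apply: le_trans (ler_norm _) _.
apply: (psd_cauchy pip) => //; exact: sqint_norm.
Qed.

(* A subsequence with summable increments converges a.e., and Fatou's lemma
   bounds the distance to its limit. *)
Lemma sqint_complete (s : nat -> T -> R) : (forall n, sqint mu D (s n)) ->
  (forall e : R, 0 < e -> exists N, forall m n, (N <= m)%N -> (N <= n)%N ->
    sqip mu D (s m - s n) (s m - s n) <= e) ->
  exists2 f, sqint mu D f & forall e : R, 0 < e -> exists N, forall n, (N <= n)%N ->
    sqip mu D (s n - f) (s n - f) <= e.
Proof.
move=> ss cs.
have e0 k : 0 < (2^-1 ^+ k) ^+ 2 :> R by rewrite !exprn_gt0.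
pose N k := projT1 (cid (cs _ (e0 k))).
have NP k := projT2 (cid (cs _ (e0 k))).
(* [p k] dominates [N 0, ..., N k], and also [k], so that the subsequence is cofinal. *)
pose p k := (k + \sum_(j < k.+1) N j)%N.
have pN k j : (k <= j)%N -> (N k <= p j)%N.
  by move=> kj; rewrite /p (bigD1 (Ordinal (kj : k < j.+1)%N)) //= addnCA leq_addr.
pose g k := s (p k).
have sg k : sqint mu D (g k) by exact: ss.
have sB f1 f2 : sqint mu D f1 -> sqint mu D f2 -> sqint mu D (f1 - f2).
  by move=> ? ?; apply: linear_subspaceB => //; exact: sqint_subspace.
pose h k x := `|g k.+1 x - g k x|.
have h0 k x : (0 <= (h k x)%:E)%E by rewrite lee_fin /h.
have gN k : psd_norm (sqip mu D) (g k.+1 - g k) <= 2^-1 ^+ k.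
  rewrite -(@ler_pXn2r _ 2)// ?nnegrE ?psd_norm_ge0 ?exprn_ge0//.
  by rewrite (sqr_psd_norm pip)//; [apply: NP; exact: pN|exact: sB].
pose c := psd_norm (sqip mu D) (cst 1).
have c0 : 0 <= c by exact: psd_norm_ge0.
have mh k : measurable_fun D (fun x => (h k x)%:E).
  by apply/measurable_EFinP; exact: (sqint_norm (sB _ _ (sg k.+1) (sg k))).1.
have hint k : (\int[mu]_(x in D) (h k x)%:E <= (2^-1 ^+ k * c)%:E)%E.
  apply: le_trans (sqint_abs_integral_le (sB _ _ (sg k.+1) (sg k))) _.
  by rewrite lee_fin ler_wpM2r.
have sumh : (\int[mu]_(x in D) (\sum_(k <oo) (h k x)%:E) < +oo)%E.
  rewrite integral_nneseries//.
  apply: (@le_lt_trans _ _ (2 * c)%:E); last exact: ltry.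
  apply: lime_le.
    by apply: is_cvg_nneseries => k _ _; apply: integral_ge0 => x _; exact: h0.
  apply: nearW => n.
  apply: (@le_trans _ _ (\sum_(0 <= k < n) (2^-1 ^+ k * c)%:E)%E).
    by apply: lee_sum => k _; exact: hint.
  rewrite sumEFin lee_fin -mulr_suml ler_wpM2r//.
  suff -> : \sum_(0 <= k < n) 2^-1 ^+ k = 2 - 2 * 2^-1 ^+ n :> R.
    by rewrite lerBlDr lerDl mulr_ge0// exprn_ge0.
  elim: n => [|n IH]; first by rewrite big_geq// expr0; lra.
  by rewrite big_nat_recr//= IH exprS; lra.
(* The sum of the absolute increments is integrable, so the telescoping series converges absolutely
   at almost every point. *)
have cvg_g : {ae mu, forall x, D x -> cvgn (g ^~ x)}.
  have : mu.-integrable D (fun x => \sum_(k <oo) (h k x)%:E)%E.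
    apply/integrableP; split.
      by apply: ge0_emeasurable_sum => // k x _ _; exact: h0.
    under eq_integral => x _.
      rewrite gee0_abs; last by apply: nneseries_ge0 => k _ _; exact: h0.
      over.
    exact: sumh.
  move=> /(integrable_ae mD); apply: filterS => x hx Dx.
  have hfin : (\sum_(k <oo) (h k x)%:E < +oo)%E.
    by rewrite -ge0_fin_numE ?hx//; apply: nneseries_ge0 => k _ _; exact: h0.
  have : cvgn (series (telescope (g ^~ x))).
    by apply: normed_cvg; by apply: (nneseries_lty_cvg _ hfin); move=> k; exact: normr_ge0.
  rewrite (_ : series _ = (fun n => g n x - g 0%N x)); last first.
    by apply/funext => n; rewrite telescopeK.
  move=> /cvg_ex[l cl]; apply/cvg_ex; exists (l + g 0%N x).
  rewrite (_ : g ^~ x = (fun n => g n x - g 0%N x) \+ cst (g 0%N x)).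
    exact: cvgD cl (cvg_cst _).
  by apply/funext => n /=; rewrite subrK.
(* An upper limit is measurable whether or not the sequence converges; its value on the exceptional
   null set does not matter. *)
pose f x := fine (limn_esup (fun k => (g k x)%:E)).
have gf : {ae mu, forall x, D x -> g k x @[k --> \oo] --> f x}.
  apply: filterS cvg_g => x cx Dx; have /cvg_ex[l cl] := cx Dx.
  have : (g k x)%:E @[k --> \oo] --> l%:E by apply: cvg_EFin => //; exact: nearW.
  by move=> /cvg_limn_einf_sup[_ lE]; rewrite /f lE.
have mf : measurable_fun D f.
  apply: measurableT_comp => //; apply: measurable_fun_limn_esup => k.
  by apply/measurable_EFinP; case: (sg k).
have key (e : R) n k0 : (forall k, (k0 <= k)%N -> sqip mu D (s n - g k) (s n - g k) <= e) ->
    (\int[mu]_(x in D) ((s n x - f x) ^+ 2)%:E <= e%:E)%E.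
  move=> he.
  (* Shifted by [k0], so that the bound [he] holds for every term and not just eventually. *)
  pose u k x := ((s n x - g (k + k0)%N x) ^+ 2)%:E.
  have mu_ k : measurable_fun D (u k).
    apply/measurable_EFinP; apply: measurable_funX; exact: (sB _ _ (ss n) (sg _)).1.
  have u0 k x : D x -> (0 <= u k x)%E by rewrite lee_fin sqr_ge0.
  have -> : (\int[mu]_(x in D) ((s n x - f x) ^+ 2)%:E =
      \int[mu]_(x in D) limn_einf (u ^~ x))%E.
    apply: ae_eq_integral => //.
    - apply/measurable_EFinP; apply: measurable_funX; apply: measurable_funB => //.
      by case: (ss n).
    - apply: (@emeasurable_fun_cvg _ _ _ _ (fun k x => einfs (u ^~ x) k)).
        by move=> k; exact: measurable_fun_einfs.
      by move=> x _; rewrite limn_einf_lim; exact: is_cvg_einfs.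
    - apply: filterS gf => x cx Dx.
      have : (u k x) @[k --> \oo] --> ((s n x - f x) ^+ 2)%:E.
        apply: cvg_EFin; first exact: nearW.
        have c1 : g (k + k0)%N x @[k --> \oo] --> f x.
          by have := cx Dx; rewrite -(cvg_shiftn k0 (g ^~ x)).
        have c2 : s n x - g (k + k0)%N x @[k --> \oo] --> s n x - f x.
          by apply: cvgB => //; exact: cvg_cst.
        have c3 : (s n x - g (k + k0)%N x) * (s n x - g (k + k0)%N x) @[k --> \oo]
          --> (s n x - f x) * (s n x - f x) by apply: cvgM.
        exact: c3.
      by move=> /cvg_limn_einf_sup[-> _].
  apply: le_trans (fatou mu mD mu_ u0) _.
  rewrite limn_einf_lim; apply: lime_le; first exact: is_cvg_einfs.
  apply: nearW => k.
  apply: (@le_trans _ _ (\int[mu]_(x in D) u k x)%E).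
    by apply: ereal_inf_lbound; exists k => /=.
  have /fineK <- : (\int[mu]_(x in D) u k x \is a fin_num)%E.
    by apply: integrable_fin_num => //; exact: (sB _ _ (ss n) (sg _)).2.
  by rewrite lee_fin; apply: he; rewrite leq_addl.
have small (e : R) : 0 < e -> exists K, forall n k, (K <= n)%N -> (K <= k)%N ->
    sqip mu D (s n - g k) (s n - g k) <= e.
  move=> e1; have [N1 hN1] := cs _ e1.
  by exists N1 => n k n1 k1; apply: hN1 => //; exact: leq_trans (leq_addr _ _).
have sf : sqint mu D f.
  have [K hK] := small 1 ltr01.
  have sKf : sqint mu D (s K - f).
    split; first by apply: measurable_funB => //; case: (ss K).
    apply/integrableP; split.
      apply/measurable_EFinP; apply: measurable_funX; apply: measurable_funB => //.
      by case: (ss K).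
    under eq_integral => x _ do rewrite gee0_abs ?lee_fin ?sqr_ge0//.
    apply: le_lt_trans (key 1 K K _) (ltry _) => k; exact: hK.
  by have -> : f = s K - (s K - f); [rewrite subKr|exact: sB].
exists f => // e e1; have [K hK] := small _ e1; exists K => n Kn.
have := key e n K (fun k => hK n k Kn).
have /fineK <- : (\int[mu]_(x in D) ((s n x - f x) ^+ 2)%:E \is a fin_num)%E.
  by apply: integrable_fin_num => //; exact: (sB _ _ (ss n) sf).2.
by rewrite lee_fin.
Qed.
End SqintComplete.

(** * Smooth functions and test functions *)

(** A directional derivative sees a function along one line only, so it can be transported between
    functions on different spaces: slices, translates, affine reparametrisations. *)
Lemma eq_growth_derive (R : numFieldType) (V1 V2 W : normedModType R)
    (f1 : V1 -> W) (f2 : V2 -> W) (a1 v1 : V1) (a2 v2 : V2) :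
  (forall h : R, f1 (h *: v1 + a1) = f2 (h *: v2 + a2)) ->
  (derivable f1 a1 v1 <-> derivable f2 a2 v2) /\ 'D_v1 f1 a1 = 'D_v2 f2 a2.
Proof.
move=> f12; have f0 : f1 a1 = f2 a2 by have := f12 0; rewrite !scale0r !add0r.
have E : (fun h : R => h^-1 *: ((f1 \o shift a1) (h *: v1) - f1 a1)) =
    (fun h => h^-1 *: ((f2 \o shift a2) (h *: v2) - f2 a2)).
  by apply/funext => h /=; rewrite f12 f0.
by rewrite /derivable /derive E.
Qed.

Section Smooth.
Context (R : realType) (d : nat).
Local Notation E := 'rV[R]_d.
Implicit Types (f g : E -> R) (i j : 'I_d) (D : set E).

(** Coinduction: [smooth] is the largest class of differentiable functions stable under [partial].
    Closure properties are proved by exhibiting such a class. *)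
Lemma smooth_coind (P : set (E -> R)) :
  (forall f, P f -> forall x, differentiable f x) ->
  (forall f i, P f -> P (partial i f)) -> P `<=` @smooth R d.
Proof.
move=> Pd Pp f Pf s; apply: Pd.
by elim: s => //= i s IH; exact: Pp.
Qed.

Lemma smooth_differentiable f x : smooth f -> differentiable f x.
Proof. by move=> /(_ [::] x). Qed.

Lemma smooth_partial i f : smooth f -> smooth (partial i f).
Proof. by move=> sf s x; have := sf (rcons s i) x; rewrite foldr_rcons. Qed.

Lemma smooth_foldr s f : smooth f -> smooth (foldr (@partial R d) f s).
Proof. by move=> sf; elim: s => //= i s IH; exact: smooth_partial. Qed.

Lemma smooth_derivable f x v : smooth f -> derivable f x v.
Proof. by move=> /(@smooth_differentiable f x); exact: diff_derivable. Qed.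

Lemma smooth_continuous f : smooth f -> continuous f.
Proof. by move=> sf x; apply: differentiable_continuous; exact: smooth_differentiable. Qed.

Lemma partialD i f g : (forall x, differentiable f x) ->
  (forall x, differentiable g x) ->
  partial i (f + g) = partial i f + partial i g.
Proof.
by move=> df dg; apply/funext => x; rewrite /partial deriveD//; exact: diff_derivable.
Qed.

Lemma partialZ i (a : R) f : (forall x, differentiable f x) ->
  partial i (a *: f) = a *: partial i f.
Proof.
by move=> df; apply/funext => x; rewrite /partial deriveZ//; exact: diff_derivable.
Qed.

Lemma partialM i f g : (forall x, differentiable f x) ->
  (forall x, differentiable g x) ->
  partial i (f * g) = f * partial i g + g * partial i f.
Proof.
by move=> df dg; apply/funext => x; rewrite /partial deriveM//; exact: diff_derivable.
Qed.

Lemma smoothD f g : smooth f -> smooth g -> smooth (f + g).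
Proof.
move=> sf sg; apply: (@smooth_coind [set h | exists f' g',
    [/\ smooth f', smooth g' & h = f' + g']]); last by exists f, g.
  move=> _ [f' [g' [sf' sg' ->]]] x; apply: differentiableD;
  exact: smooth_differentiable.
move=> _ i [f' [g' [sf' sg' ->]]]; exists (partial i f'), (partial i g').
split; [exact: smooth_partial..|].
by rewrite partialD// => x; exact: smooth_differentiable.
Qed.

Lemma smoothZ (a : R) f : smooth f -> smooth (a *: f).
Proof.
move=> sf; apply: (@smooth_coind [set h | exists2 f', smooth f' & h = a *: f']);
  last by exists f.
  by move=> _ [f' sf' ->] x; apply: differentiableZ; exact: smooth_differentiable.
move=> _ i [f' sf' ->]; exists (partial i f'); first exact: smooth_partial.
by rewrite partialZ// => x; exact: smooth_differentiable.
Qed.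

(* Finite sums of products form a class stable under [partial]. *)
Lemma smoothM f g : smooth f -> smooth g -> smooth (f * g).
Proof.
move=> sf sg; apply: (@smooth_coind [set h | exists s : seq ((E -> R) * (E -> R)),
    (forall p, List.In p s -> smooth p.1 /\ smooth p.2) /\
    h = foldr (fun p h => p.1 * p.2 + h) 0 s]); last first.
  by exists [:: (f, g)]; split=> [p [<-|]//|]; rewrite /= addr0.
- move=> f' i [s [ss f'E]]; rewrite f'E {f' f'E}; elim: s ss => [|p s IH] ss /=.
    exists [::]; split => //; apply/funext => x; exact: derive_cst.
  have [s1 s2] := ss p (or_introl erefl).
  have [|t [ts tE]] := IH; first by move=> q qs; apply: ss; right.
  exists [:: (p.1, partial i p.2), (p.2, partial i p.1) & t]; split.
    move=> q [<-|[<-|/ts//]] /=; split => //; exact: smooth_partial.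
  rewrite /= -tE partialD ?partialM -?addrA//.
  + by move=> x; exact: smooth_differentiable.
  + by move=> x; exact: smooth_differentiable.
  + by move=> x; apply: differentiableM; exact: smooth_differentiable.
  + move=> x; have : forall q, List.In q s -> smooth q.1 /\ smooth q.2.
      by move=> q qs; apply: ss; right.
    move: {ss IH t ts tE} s; elim => [|q s IH] ss /=; first exact: differentiable_cst.
    have [q1 q2] := ss q (or_introl erefl).
    apply: differentiableD.
      by apply: differentiableM; exact: smooth_differentiable.
    by apply: IH => r rs; apply: ss; right.
- move=> f' [s [ss f'E]] x; rewrite f'E {f' f'E}; elim: s ss => [|p s IH] ss /=.
    exact: differentiable_cst.
  apply: differentiableD; last by apply: IH => q qs; apply: ss; right.
  have [s1 s2] := ss p (or_introl erefl).
  by apply: differentiableM; exact: smooth_differentiable.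
Qed.

Lemma smooth_cst (c : R) : smooth (cst c : E -> R).
Proof.
apply: (@smooth_coind [set h | exists c, h = cst c]); last by exists c.
  by move=> _ [a ->] x; exact: differentiable_cst.
by move=> _ i [a ->]; exists 0; apply/funext => x; exact: derive_cst.
Qed.

Lemma smooth_sum (I : Type) (r : seq I) (P : pred I) (F : I -> E -> R) :
  (forall k, smooth (F k)) -> smooth (\sum_(k <- r | P k) F k).
Proof.
move=> sF; elim/big_ind : _ => //; first exact: smooth_cst.
exact: smoothD.
Qed.

Lemma smooth_prod (I : Type) (r : seq I) (P : pred I) (F : I -> E -> R) :
  (forall k, smooth (F k)) -> smooth (\prod_(k <- r | P k) F k).
Proof.
move=> sF; elim/big_ind : _ => //; first exact: smooth_cst.
exact: smoothM.
Qed.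

(* The difference quotients of [t |-> f (x + t v)] at [t] are those of [f] at
   [x + t v]. *)
Lemma is_derive_line f x v (t : R) : derivable f (x + t *: v) v ->
  is_derive t 1 (fun t => f (x + t *: v)) ('D_v f (x + t *: v)).
Proof.
move=> df; have [h1 h2] : (derivable (fun t : R => f (x + t *: v)) t 1 <->
    derivable f (x + t *: v) v) /\
    'D_1 (fun t : R => f (x + t *: v)) t = 'D_v f (x + t *: v).
  by apply: eq_growth_derive => h; rewrite [h *: 1]mulr1 scalerDl addrCA.
by split=> //; apply/h1.
Qed.

Lemma MVT_line f x v (h : R) : 0 < h -> (forall y, derivable f y v) ->
  exists2 t, 0 < t < h & f (x + h *: v) - f x = h * 'D_v f (x + t *: v).
Proof.
move=> h0 df.
have dl t := is_derive_line (df (x + t *: v)).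
have [|t] := MVT h0 (fun t _ => dl t).
  apply: continuous_subspaceT => t; apply: differentiable_continuous.
  by apply/derivable1_diffP; case: (dl t).
rewrite in_itv/= => th; rewrite scale0r addr0 subr0 => ->.
by exists t => //; rewrite mulrC.
Qed.

Lemma norm_delta_rV i : `|delta_mx ord0 i : E| <= 1.
Proof.
rewrite [leLHS]/Num.norm/= mx_normrE; apply/bigmax_leP; split=> // -[a b] _ /=.
by rewrite mxE; case: (_ && _); rewrite ?normr1 ?normr0.
Qed.

(** The mean value theorem twice: in direction [i] for the increment of [f] along [j], then in
    direction [j] for [partial i f]. *)
Lemma second_difference f i j x (h : R) : 0 < h -> smooth f ->
  exists2 p, `|p - x| <= h *+ 2 &
   f (x + h *: delta_mx ord0 i + h *: delta_mx ord0 j) - f (x + h *: delta_mx ord0 i)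
     - (f (x + h *: delta_mx ord0 j) - f x) =
   h ^+ 2 * partial j (partial i f) p.
Proof.
move=> h0 sf; pose ei : E := delta_mx ord0 i; pose ej : E := delta_mx ord0 j.
rewrite -/ei -/ej.
pose g : E -> R := (fun z => f (z + h *: ej)) - f.
have dsh y v : is_derive y v (fun z => f (z + h *: ej)) ('D_v f (y + h *: ej)).
  have [h1 h2] : (derivable (fun z => f (z + h *: ej)) y v <->
      derivable f (y + h *: ej) v) /\
      'D_v (fun z => f (z + h *: ej)) y = 'D_v f (y + h *: ej).
    by apply: eq_growth_derive => k; rewrite addrA.
  by split=> //; apply/h1; exact: smooth_derivable.
have dg y : is_derive y ei g (partial i f (y + h *: ej) - partial i f y).
  exact: (is_deriveB (dsh y ei) (derivableP (smooth_derivable sf))).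
have [t t0 gE] := MVT_line x h0 (fun y => @ex_derive _ _ _ _ _ _ _ (dg y)).
have [s s0 pE] := MVT_line (x + t *: ei) h0
  (fun y => @smooth_derivable _ y ej (smooth_partial i sf)).
exists (x + t *: ei + s *: ej).
  rewrite (_ : _ - x = t *: ei + s *: ej); last first.
    by rewrite -(addrA x) (addrC x) addrK.
  rewrite mulr2n; apply: le_trans (ler_normD _ _) _.
  rewrite !normrZ; apply: lerD.
    rewrite -[leRHS]mulr1 ler_pM ?norm_delta_rV// ger0_norm ltW//; by case/andP: t0.
  rewrite -[leRHS]mulr1 ler_pM ?norm_delta_rV// ger0_norm ltW//; by case/andP: s0.
apply: (eq_trans gE); have [_ ->] := dg (x + t *: ei).
have -> : partial i f (x + t *: ei + h *: ej) - partial i f (x + t *: ei) =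
  h * partial j (partial i f) (x + t *: ei + s *: ej) by exact: pE.
by rewrite expr2 mulrA.
Qed.

(** The second difference is symmetric in [i] and [j], so the two mixed derivatives agree at points
    [p] and [q] within [2 h] of [x]; continuity does the rest. *)
Lemma partialC f i j : smooth f -> partial i (partial j f) = partial j (partial i f).
Proof.
move=> sf; apply/funext => x.
have cij : continuous (partial i (partial j f)).
  by apply: smooth_continuous; do 2 apply: smooth_partial.
have cji : continuous (partial j (partial i f)).
  by apply: smooth_continuous; do 2 apply: smooth_partial.
apply/eqP; rewrite -subr_eq0 -normr_le0; apply/ler_addgt0Pr => e e0; rewrite add0r.
have e2 : 0 < e / 2 by rewrite divr_gt0.
have /nbhs_normP[r1 /= r10 h1] : \forall y \near x,
    `|partial i (partial j f) x - partial i (partial j f) y| < e / 2.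
  by have /cvgr_dist_lt := cij x; apply.
have /nbhs_normP[r2 /= r20 h2] : \forall y \near x,
    `|partial j (partial i f) x - partial j (partial i f) y| < e / 2.
  by have /cvgr_dist_lt := cji x; apply.
pose h := Num.min r1 r2 / 4.
have m0 : 0 < Num.min r1 r2 by rewrite lt_min r10.
have h0 : 0 < h by rewrite divr_gt0.
have hr : h *+ 2 < Num.min r1 r2 by rewrite /h; lra.
have [p px pE] := second_difference i j x h0 sf.
have [q qx qE] := second_difference j i x h0 sf.
have pq : partial j (partial i f) p = partial i (partial j f) q.
  have h2' : h ^+ 2 != 0 by rewrite expf_neq0// gt_eqF.
  apply: (mulfI h2'); rewrite -pE -qE.
  rewrite [x + h *: delta_mx ord0 i + h *: _]addrAC; ring.
move: hr; rewrite lt_min => /andP[hr1 hr2].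
have hp := h2 p; rewrite /ball_/= distrC in hp; have {}hp := hp (le_lt_trans px hr2).
have hq := h1 q; rewrite /ball_/= distrC in hq; have {}hq := hq (le_lt_trans qx hr1).
rewrite (_ : _ - _ = (partial i (partial j f) x - partial i (partial j f) q) -
   (partial j (partial i f) x - partial j (partial i f) p)); last first.
  by rewrite pq opprB addrA subrK.
apply: le_trans (ler_normB _ _) _.
by apply: le_trans (lerD (ltW hq) (ltW hp)) _; rewrite -splitr.
Qed.

Lemma foldr_partial_perm f s t : smooth f -> perm_eq s t ->
  foldr (@partial R d) f s = foldr (@partial R d) f t.
Proof.
move=> sf; elim: s t => [|i s IH] t; first by rewrite perm_sym => /perm_nilP ->.
move=> st; have it : i \in t by rewrite -(perm_mem st) mem_head.
have [t1 [t2 tE]] : exists t1 t2, t = t1 ++ i :: t2.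
  by case/splitPr: it => t1 t2; exists t1, t2.
rewrite /= (IH (t1 ++ t2)); last first.
  by move: st; rewrite tE -[i :: t2]cat1s perm_sym perm_catCA /= perm_cons perm_sym.
rewrite tE {st it tE}; elim: t1 => //= k t1 <-.
by rewrite partialC//; exact: smooth_foldr.
Qed.

End Smooth.

(** * Integrals of compactly supported partial derivatives *)

Section IntegralPartial.
Context (R : realType).

Lemma closed_cube_compact n (M : R) :
  compact [set x : 'rV[R]_n | forall i, - M <= x ord0 i <= M].
Proof.
have := @rV_compact R n (fun=> `[- M, M]%classic) (fun=> segment_compact (a := - M) (b := M)).
by congr compact; apply/seteqP; split => x /= h i; have := h i; rewrite /= in_itv.
Qed.

Lemma continuous_bounded_supp n (g : 'rV[R]_n -> R) (M : R) : continuous g ->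
  (forall x, g x != 0 -> obox (const_mx (- M)) (const_mx M) x) ->
  exists B, forall x, `|g x| <= B.
Proof.
move=> cg gM.
have cgK : compact (g @` [set x : 'rV[R]_n | forall i, - M <= x ord0 i <= M]).
  apply: continuous_compact; last exact: closed_cube_compact.
  exact: continuous_subspaceT.
have [B [_ hB]] := compact_bounded cgK.
exists (`|B| + 1) => x; have [->|gx] := eqVneq (g x) 0; first by rewrite normr0 addr_ge0.
apply: hB; first by rewrite ltr_pwDr// ler_norm.
exists x => // i; have := gM _ gx i; rewrite !mxE => /andP[a b].
by rewrite !ltW.
Qed.

Lemma continuous_integrable_supp n (g : 'rV[R]_n -> R) (M : R) : continuous g ->
  (forall x, g x != 0 -> obox (const_mx (- M)) (const_mx M) x) ->
  (lebesgue_rV R n).-integrable setT (EFin \o g).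
Proof.
move=> cg gM; have mQ := @measurable_obox R n (const_mx (- M)) (const_mx M).
have [B hB] := continuous_bounded_supp cg gM.
have mg := continuous_rV_measurable cg.
have : (lebesgue_rV R n).-integrable (obox (const_mx (- M)) (const_mx M)) (EFin \o g).
  apply: measurable_bounded_integrable => //; first exact: lebesgue_rV_cube_lty.
    exact: measurable_funTS.
  by exists B; split; [exact: num_real|move=> C BC x _; exact: le_trans (hB x) (ltW BC)].
move=> /(integrable_mkcond _ mQ); apply: eq_integrable => // x _.
rewrite patchE; case: ifPn => // /negP xQ; apply/esym; congr EFin; apply/eqP.
by apply/negPn/negP => /gM /mem_set.
Qed.

Lemma rV_cons_line0 n (a h : R) (y : 'rV[R]_n) :
  rV_cons (h + a, y) = h *: delta_mx ord0 ord0 + rV_cons (a, y).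
Proof.
apply/rowP => k; rewrite !mxE /=; case: unliftP => [j ->|->] /=.
  by rewrite mulr0 add0r.
by rewrite mulr1.
Qed.

Lemma rV_cons_line n (a h : R) (y : 'rV[R]_n) (j : 'I_n) :
  rV_cons (a, h *: delta_mx ord0 j + y) =
  h *: delta_mx ord0 (lift ord0 j) + rV_cons (a, y).
Proof.
apply/rowP => k; rewrite !mxE /=; case: unliftP => [l ->|->] /=.
  by rewrite !mxE (inj_eq lift_inj).
by rewrite mulr0 add0r.
Qed.

Lemma continuous_rV_cons2 n (a : R) : continuous (fun y : 'rV[R]_n => rV_cons (a, y)).
Proof.
move=> y; apply/(@cvgrPdist_lt _ _ _ _ (nbhs_filter y)) => e e0; near=> z.
rewrite [ltLHS]/Num.norm/= mx_normrE; apply/bigmax_ltP; split => // -[i k] _ /=.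
rewrite !mxE; case: unliftP => [l _|_] /=; last by rewrite subrr normr0.
have : `|y - z| < e by near: z; exact: cvgr_dist_lt.
apply: le_lt_trans; rewrite [leRHS]/Num.norm/= mx_normrE.
apply: le_trans (le_bigmax _ (fun ij => `|(y - z) ij.1 ij.2|) (ord0, l)).
by rewrite !mxE.
Unshelve. all: by end_near. Qed.

Lemma continuous_rV_cons1 n (y : 'rV[R]_n) : continuous (fun a : R => rV_cons (a, y)).
Proof.
move=> a; apply/(@cvgrPdist_lt _ _ _ _ (nbhs_filter a)) => e e0; near=> b.
rewrite [ltLHS]/Num.norm/= mx_normrE; apply/bigmax_ltP; split => // -[i k] _ /=.
rewrite !mxE; case: unliftP => [l _|_] /=; first by rewrite subrr normr0.
by near: b; exact: cvgr_dist_lt.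
Unshelve. all: by end_near. Qed.

Lemma integral_derivative0 (u : R -> R) (M : R) : 0 < M ->
  (forall t, derivable u t 1) -> continuous (fun t => 'D_1 u t) ->
  (forall t, M <= `|t| -> u t = 0) ->
  (forall t, M <= `|t| -> 'D_1 u t = 0) ->
  (\int[lebesgue_measure]_t ('D_1 u t)%:E = 0)%E.
Proof.
move=> M0 du cu u0 du0.
rewrite (_ : (\int[_]_t _)%E = (\int[lebesgue_measure]_(t in `[(- M)%R, M]) ('D_1 u t)%:E)%E).
  have cuu : continuous u by move=> t; apply: differentiable_continuous; exact/derivable1_diffP.
  rewrite (@continuous_FTC2 _ _ u)//.
  - rewrite (u0 M); last exact: ler_norm.
    rewrite (u0 (- M)); last by rewrite normrN ler_norm.
    by rewrite sube0.
  - by rewrite gtrN.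
  - exact: continuous_subspaceT.
  - split => //.
    + by apply: cvg_at_right_filter; exact: cuu.
    + by apply: cvg_at_left_filter; exact: cuu.
  - by move=> t _; rewrite derive1E.
rewrite [RHS]integral_mkcond/=; apply: eq_integral => t _.
rewrite patchE; case: ifPn => // /negP tM; rewrite du0//.
rewrite leNgt; apply/negP => h; apply: tM; rewrite inE/= in_itv/=.
by rewrite -ler_norml ltW.
Qed.

(** Fubini along [rV_cons], by induction on the dimension: the fundamental theorem of calculus if
    [i] is the first coordinate, the induction hypothesis on slices otherwise. Derivability is asked
    in the single direction [i], so that slices inherit the hypotheses. *)
Lemma integral_partial0 n (i : 'I_n) (f : 'rV[R]_n -> R) (M : R) : 0 < M ->
  (forall x, derivable f x (delta_mx ord0 i)) -> continuous (partial i f) ->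
  (forall x, f x != 0 -> obox (const_mx (- M)) (const_mx M) x) ->
  (forall x, partial i f x != 0 -> obox (const_mx (- M)) (const_mx M) x) ->
  (\int[lebesgue_rV R n]_x (partial i f x)%:E = 0)%E.
Proof.
move=> M0; elim: n i f => [[]//|n IH] i f df cdf fM dfM.
have mdf := continuous_rV_measurable cdf.
have /integrableP[_ ifoo] := continuous_integrable_supp cdf dfM.
have mF : measurable_fun setT (fun p => (partial i f (@rV_cons R n p))%:E).
  by apply/measurable_EFinP; apply: measurableT_comp => //; exact: measurable_rV_cons.
(* [lebesgue_rV R n.+1] is the image of the product measure under [rV_cons], so integrability is
   pulled back to the product. *)
have iF : (lebesgue_measure \x lebesgue_rV R n)%E.-integrable setT
    (fun p => (partial i f (@rV_cons R n p))%:E).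
  apply/integrableP; split => //.
  have := ifoo; rewrite (_ : (\int[lebesgue_rV R n.+1]_x _)%E =
    (\int[pushforward (lebesgue_measure \x lebesgue_rV R n)%E (@rV_cons R n)]_(x in setT)
      `|(EFin \o partial i f) x|)%E)//.
  rewrite ge0_integral_pushforward ?preimage_setT//.
  - exact: measurable_rV_cons.
  - by apply: measurableT_comp => //; apply/measurable_EFinP.
rewrite (_ : (\int[lebesgue_rV R n.+1]_x _)%E =
    (\int[pushforward (lebesgue_measure \x lebesgue_rV R n)%E (@rV_cons R n)]_(x in setT)
      (partial i f x)%:E)%E)//.
rewrite integral_pushforward ?preimage_setT//; last 2 first.
- exact: measurable_rV_cons.
- exact/measurable_EFinP.
case: (unliftP ord0 i) => [j|] ij; subst i.
- rewrite -(integral12_prod_meas1 iF) integral0_eq// => a _ /=.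
  have E y : (derivable (fun y => f (rV_cons (a, y))) y (delta_mx ord0 j) <->
      derivable f (rV_cons (a, y)) (delta_mx ord0 (lift ord0 j))) /\
      partial j (fun y => f (rV_cons (a, y))) y =
      partial (lift ord0 j) f (rV_cons (a, y)).
    by apply: eq_growth_derive => h; rewrite rV_cons_line.
  have pE : (fun y => partial (lift ord0 j) f (rV_cons (a, y))) =
      partial j (fun y => f (rV_cons (a, y))).
    by apply/funext => y; rewrite (E y).2.
  rewrite /fubini_F /=; under eq_integral do rewrite -(E _).2.
  apply: IH.
  + by move=> y; apply/(E y).1.
  + rewrite -pE => y; apply: continuous_comp; [exact: continuous_rV_cons2|exact: cdf].
  + by move=> y /fM h k; have := h (lift ord0 k); rewrite !mxE liftK.
  + by move=> y; rewrite (E y).2 => /dfM h k; have := h (lift ord0 k); rewrite !mxE liftK.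
- rewrite -(integral21_prod_meas1 iF) integral0_eq// => y _ /=.
  have E a : (derivable (fun a : R => f (rV_cons (a, y))) a 1 <->
      derivable f (rV_cons (a, y)) (delta_mx ord0 ord0)) /\
      'D_1 (fun a : R => f (rV_cons (a, y))) a = partial ord0 f (rV_cons (a, y)).
    by apply: eq_growth_derive => h; rewrite [h *: 1]mulr1 rV_cons_line0.
  have pE : (fun a => 'D_1 (fun a : R => f (rV_cons (a, y))) a) =
      (fun a => partial ord0 f (rV_cons (a, y))).
    by apply/funext => a; rewrite (E a).2.
  rewrite /fubini_G /=; under eq_integral do rewrite -(E _).2.
  apply: (integral_derivative0 M0).
  + by move=> a; apply/(E a).1.
  + rewrite pE => a; apply: continuous_comp; [exact: continuous_rV_cons1|exact: cdf].
  + move=> t Mt; apply/eqP/negPn/negP => /fM /(_ ord0).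
    by rewrite !mxE unlift_none /= -ltr_norml ltNge Mt.
  + move=> t Mt; rewrite (E t).2; apply/eqP/negPn/negP => /dfM /(_ ord0).
    by rewrite !mxE unlift_none /= -ltr_norml ltNge Mt.
Qed.

End IntegralPartial.

Section Frob.
Context (R : realType) (m n : nat).
Implicit Types (w z : 'M[R]_(m, n)).

Lemma frobC w z : frob w z = frob z w.
Proof. by apply: eq_bigr => i _; apply: eq_bigr => j _; rewrite mulrC. Qed.

Lemma frobDl w w' z : frob (w + w') z = frob w z + frob w' z.
Proof.
rewrite /frob -big_split; apply: eq_bigr => i _; rewrite -big_split.
by apply: eq_bigr => j _; rewrite mxE mulrDl.
Qed.

Lemma frobZl a w z : frob (a *: w) z = a * frob w z.
Proof.
rewrite /frob mulr_sumr; apply: eq_bigr => i _; rewrite mulr_sumr.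
by apply: eq_bigr => j _; rewrite mxE mulrA.
Qed.

Lemma frob0l z : frob 0 z = 0.
Proof. by have := frobZl 0 0 z; rewrite scale0r mul0r. Qed.

Lemma frob_suml (I : Type) (r : seq I) (P : pred I) (F : I -> 'M[R]_(m, n)) z :
  frob (\sum_(i <- r | P i) F i) z = \sum_(i <- r | P i) frob (F i) z.
Proof. by elim/big_rec2 : _ => [|i x y _ <-]; rewrite ?frob0l ?frobDl. Qed.

Lemma frob_ge0 w : 0 <= frob w w.
Proof. by apply: sumr_ge0 => i _; apply: sumr_ge0 => j _; rewrite -expr2 sqr_ge0. Qed.

Lemma frob_psd : psd_form setT (@frob R m n).
Proof.
split => //.
- by move=> a x y z _ _ _; rewrite frobDl frobZl.
- by move=> x y _ _; exact: frobC.
- by move=> x _; exact: frob_ge0.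
Qed.

End Frob.

Lemma Rintegral_sum d (T : measurableType d) (R : realType)
    (mu : {measure set T -> \bar R}) (D : set T) (I : Type) (r : seq I)
    (P : pred I) (f : I -> T -> R) : measurable D ->
  (forall i, P i -> mu.-integrable D (EFin \o f i)) ->
  \int[mu]_(x in D) (\sum_(i <- r | P i) f i x) =
    \sum_(i <- r | P i) \int[mu]_(x in D) f i x.
Proof.
move=> mD fi.
suff [] : mu.-integrable D (EFin \o (fun x => \sum_(i <- r | P i) f i x)) /\
  \int[mu]_(x in D) (\sum_(i <- r | P i) f i x) =
    \sum_(i <- r | P i) \int[mu]_(x in D) f i x by [].
elim: r => [|i r [IHi IH]].
  have -> : (fun x => \sum_(i <- [::] | P i) f i x) = cst 0.
    by apply/funext => x; rewrite big_nil.
  by rewrite big_nil Rintegral_cst// mul0r; split => //; exact: integrable0.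
rewrite big_cons; have [Pi|Pi] := boolP (P i); last first.
  by under eq_fun do rewrite big_cons (negbTE Pi).
have -> : (fun x => \sum_(j <- i :: r | P j) f j x) =
    (fun x => f i x + \sum_(j <- r | P j) f j x).
  by apply/funext => x; rewrite big_cons Pi.
split; last by rewrite RintegralD ?IH//; exact: fi.
by have := integrableD mD (fi _ Pi) IHi; apply: eq_integrable.
Qed.

(** * Test functions and integration by parts *)

Section TestFunctions.
Context (R : realType) (d : nat).
Local Notation E := 'rV[R]_d.
Local Notation mu := (lebesgue_rV R d).
Implicit Types (f g phi chi : E -> R) (i : 'I_d) (D : set E).

Lemma test_smooth D f : test D f -> smooth f.
Proof. by case. Qed.

Lemma test_notin D f x : test D f -> ~ D x -> f x = 0.
Proof. by move=> [_ [K [_ KD K0]]] Dx; apply: K0 => /KD. Qed.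

(** The same compact [K] serves: its complement is open, so [f] vanishes near each point outside
    it. *)
Lemma test_partial D i f : test D f -> test D (partial i f).
Proof.
move=> [sf [K [cK KD K0]]]; split; first exact: smooth_partial.
exists K; split => // x Kx; rewrite /partial.
rewrite (@near_eq_derive _ _ _ f (cst 0)); first exact: derive_cst.
have /open_nbhs_nbhs : open_nbhs x (~` K).
  by split => //; apply: closed_openC; apply: compact_closed => //; exact: norm_hausdorff.
by apply: filterS => y; exact: K0.
Qed.

Lemma test_foldr D s f : test D f -> test D (foldr (@partial R d) f s).
Proof. by move=> tf; elim: s => //= i s; exact: test_partial. Qed.

Lemma testM D f g : smooth f -> test D g -> test D (f * g).
Proof.
move=> sf [sg [K [cK KD K0]]]; split; first exact: smoothM.
exists K; split => // x /K0 gx.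
by have -> : (f * g) x = f x * g x by []; rewrite gx mulr0.
Qed.

Lemma test0 D : test D (0 : E -> R).
Proof.
by split; [exact: smooth_cst|exists set0; split => //; exact: compact0].
Qed.

Lemma testD D f g : test D f -> test D g -> test D (f + g).
Proof.
move=> [sf [K [cK KD K0]]] [sg [K' [cK' KD' K0']]]; split; first exact: smoothD.
exists (K `|` K'); split; first exact: compactU.
  by move=> x [/KD|/KD'].
move=> x /not_orP[h h']; have -> : (f + g) x = f x + g x by [].
by rewrite K0// K0'// addr0.
Qed.

Lemma testZ D (a : R) f : test D f -> test D (a *: f).
Proof.
move=> [sf [K [cK KD K0]]]; split; first exact: smoothZ.
exists K; split => // x /K0 fx.
by have -> : (a *: f) x = a * f x by []; rewrite fx mulr0.
Qed.

Lemma test_sum D (I : Type) (r : seq I) (P : pred I) (F : I -> E -> R) :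
  (forall k, test D (F k)) -> test D (\sum_(k <- r | P k) F k).
Proof.
move=> sF; elim/big_ind : _ => //; first exact: test0.
exact: testD.
Qed.

Lemma test_supp D f : test D f -> exists2 M, 0 < M &
  forall x, f x != 0 -> obox (const_mx (- M)) (const_mx M) x.
Proof.
move=> [_ [K [cK _ K0]]].
have [M M0 KM] := bounded_rV_sub (compact_bounded cK).
exists M => // x fx; apply: KM; apply/not_notP => /K0 /eqP.
by rewrite (negbTE fx).
Qed.

Lemma test_integrable D f (B : set E) : test D f -> measurable B ->
  mu.-integrable B (EFin \o f).
Proof.
move=> tf mB; have [M _ fM] := test_supp tf.
apply: (@integrableS _ _ _ mu setT) => //.
exact: continuous_integrable_supp (smooth_continuous (test_smooth tf)) fM.
Qed.

Lemma Rintegral_partial D i f : test D f -> \int[mu]_x partial i f x = 0.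
Proof.
move=> tf; have [M M0 fM] := test_supp tf.
have [M' M'0 fM'] := test_supp (test_partial i tf).
pose L := Num.max M M'.
have sub N : N <= L -> obox (const_mx (- N)) (const_mx N : E) `<=`
    obox (const_mx (- L)) (const_mx L).
  move=> NL x h k; have := h k; rewrite !mxE => /andP[h1 h2].
  by rewrite (lt_le_trans h2)// andbT (le_lt_trans _ h1)// lerN2.
rewrite /Rintegral (@integral_partial0 _ _ i f L)//.
- by rewrite lt_max M0.
- by move=> x; exact/smooth_derivable/(test_smooth tf).
- exact/smooth_continuous/smooth_partial/(test_smooth tf).
- by move=> x /fM; apply: sub; rewrite le_max lexx.
- by move=> x /fM'; apply: sub; rewrite le_max lexx orbT.
Qed.

Lemma integration_by_parts D i phi chi : smooth phi -> test D chi ->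
  \int[mu]_x (phi x * partial i chi x) = - \int[mu]_x (partial i phi x * chi x).
Proof.
move=> sp tc; apply/eqP; rewrite -subr_eq0 opprK; apply/eqP.
rewrite -RintegralD//; last 2 first.
- exact: (test_integrable (testM sp (test_partial i tc))).
- exact: (test_integrable (testM (smooth_partial i sp) tc)).
rewrite -(Rintegral_partial i (testM sp tc)); apply: eq_Rintegral => x _.
rewrite partialM; last 2 first.
- by move=> y; exact: smooth_differentiable.
- by move=> y; apply: smooth_differentiable; exact: test_smooth tc.
by rewrite [partial i phi x * _]mulrC.
Qed.

(** Integrating by parts one derivative at a time reverses their order; [rev s] compensates, which
    is legitimate because partials commute. *)
Lemma integration_by_parts_foldr D s phi chi : smooth phi -> test D chi ->
  \int[mu]_x (phi x * foldr (@partial R d) chi s x) =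
  (-1) ^+ size s * \int[mu]_x (foldr (@partial R d) phi s x * chi x).
Proof.
move=> sp tc; have pr : perm_eq (rev s) s by rewrite perm_rev.
rewrite -(foldr_partial_perm sp pr) {pr}.
elim: s phi sp => [|i s IH] phi sp /=; first by rewrite expr0 mul1r.
rewrite (integration_by_parts _ sp (test_foldr s tc)).
rewrite IH; last exact: smooth_partial.
by rewrite exprS mulN1r mulNr rev_cons foldr_rcons.
Qed.

(** The multi-index as a list of directions, so that facts on iterated partials along lists apply to
    [partial_mi]. *)
Definition mi_seq m (alpha : {ffun 'I_d -> 'I_m.+1}) : seq 'I_d :=
  flatten [seq nseq (alpha i) i | i <- enum 'I_d].

Lemma partial_miE m (alpha : {ffun 'I_d -> 'I_m.+1}) f :
  partial_mi alpha f = foldr (@partial R d) f (mi_seq alpha).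
Proof.
rewrite /partial_mi /mi_seq; elim: (enum 'I_d) => //= i s ->.
by rewrite foldr_cat; elim: (nat_of_ord (alpha i)) => //= k ->.
Qed.

Lemma size_mi_seq m (alpha : {ffun 'I_d -> 'I_m.+1}) :
  size (mi_seq alpha) = mi_abs alpha.
Proof.
rewrite /mi_seq size_flatten sumnE /shape -map_comp big_map big_enum /=.
by apply: eq_bigr => i _; rewrite size_nseq.
Qed.

Lemma Rintegral_supp D (g : E -> R) : (forall x, ~ D x -> g x = 0) ->
  \int[mu]_x g x = \int[mu]_(x in D) g x.
Proof.
move=> g0; rewrite [RHS]Rintegral_mkcond; apply: eq_Rintegral => x _.
by rewrite patchE; case: ifPn => // /negP xD; apply: g0 => /mem_set.
Qed.

Lemma integration_by_parts_mi D m (alpha : {ffun 'I_d -> 'I_m.+1}) phi chi :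
  smooth phi -> test D chi ->
  \int[mu]_(x in D) (phi x * partial_mi alpha chi x) =
  (-1) ^+ mi_abs alpha * \int[mu]_(x in D) (partial_mi alpha phi x * chi x).
Proof.
move=> sp tc; rewrite -[LHS]Rintegral_supp; last first.
  by move=> x Dx; rewrite partial_miE (test_notin (test_foldr _ tc))// mulr0.
rewrite -[X in _ * X]Rintegral_supp; last first.
  by move=> x Dx; rewrite (test_notin tc)// mulr0.
by rewrite !partial_miE (integration_by_parts_foldr _ sp tc) size_mi_seq.
Qed.

Lemma continuous_L2 D (g : E -> R) : measurable D -> bounded_set D ->
  continuous g -> L2 D g.
Proof.
move=> mD bD cg; have mg := continuous_rV_measurable cg.
split; first exact: measurable_funTS.
have [M _ DM] := bounded_rV_sub bD.
have cgK : compact (g @` [set x : E | forall i, - M <= x ord0 i <= M]).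
  apply: continuous_compact; last exact: closed_cube_compact.
  exact: continuous_subspaceT.
have [B [_ hB]] := compact_bounded cgK.
apply: (@measurable_bounded_integrable _ _ _ mu (fun x => g x ^+ 2)) => //.
- exact: bounded_rV_lty.
- by apply: measurable_funX; exact: measurable_funTS.
exists ((`|B| + 1) ^+ 2); split; first exact: num_real.
move=> C BC x Dx /=; rewrite normrX; apply: le_trans (ltW BC).
rewrite ler_pXn2r ?nnegrE ?addr_ge0//; apply: hB; first by rewrite ltr_pwDr// ler_norm.
exists x => // i; have := DM _ Dx i; rewrite !mxE => /andP[a b].
by rewrite !ltW.
Qed.

End TestFunctions.

(** * Smooth bumps approximating indicators of boxes *)

Section Bump.
Context (R : realType).
Implicit Types (t : R) (m : nat).

(** [t^-m exp(-1/t)] extended by zero. The span of these functions is stable under differentiation,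
    whence smoothness at the origin. *)
Definition flat m t : R := if 0 < t then t^-1 ^+ m * expR (- t^-1) else 0.

Lemma flat_ge0 m t : 0 <= flat m t.
Proof.
by rewrite /flat; case: ifPn => // t0; rewrite mulr_ge0 ?expR_ge0// exprn_ge0// invr_ge0 ltW.
Qed.

(** From [e^y >= y^(m+1) / (m+1)!] with [y = 1/t]. The linear bound settles differentiability at the
    origin. *)
Lemma flat_le m t : 0 <= t -> flat m t <= m.+1`!%:R * t.
Proof.
move=> t0; rewrite /flat; case: ifPn => [t1|_]; last by rewrite mulr_ge0.
have y0 : 0 <= t^-1 by rewrite invr_ge0.
have := expR_ge1Dxn m y0; rewrite expRN ler_pdivrMr ?expR_gt0// => h.
have f0 : 0 < m.+1`!%:R :> R by rewrite ltr0n fact_gt0.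
have : t^-1 ^+ m.+1 <= m.+1`!%:R * expR t^-1.
  by rewrite -ler_pdivrMl// mulrC (le_trans _ h)// lerDr.
by rewrite exprSr -ler_pdivlMr ?invr_gt0// invrK mulrAC.
Qed.

Lemma flatS m t : t^-1 * flat m t = flat m.+1 t.
Proof. by rewrite /flat; case: ifP => _; rewrite ?mulr0// mulrA -exprS. Qed.

(** At the origin the difference quotient of [flat m] is [flat m.+1], which [flat_le] drives to
    zero; for positive [t] this is the chain rule through [t^-1]. *)
Lemma is_derive_flat m t :
  is_derive t 1 (flat m) (flat m.+2 t - m%:R * flat m.+1 t).
Proof.
have [t0|t0|t0] := ltgtP t 0.
- have -> : flat m.+2 t - m%:R * flat m.+1 t = 0.
    by rewrite /flat !ltNge (ltW t0)/= mulr0 subr0.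
  apply: (@near_eq_is_derive _ _ _ (cst 0 : R -> R)). 
  near=> s; rewrite /flat ltNge (_ : s <= 0)// ltW//.
  near: s; exact: lt_nbhsl.
- have tn0 : t != 0 by rewrite gt_eqF.
  pose p (y : R) := y ^+ m * expR (- y).
  have dX (y : R) : is_derive y 1 (fun y : R => y ^+ m) (m%:R * y ^+ m.-1).
    by apply: DeriveDef; [exact: exprn_derivable|rewrite exp_derive [LHS]mulr1].
  have dE (y : R) : is_derive y 1 (fun y : R => expR (- y)) (- expR (- y)).
    have := @is_derive1_comp R expR -%R y _ _ (is_derive_expR (- y)) (is_deriveNid y 1).
    by rewrite mulrN1.
  have dp (y : R) : is_derive y 1 p (y ^+ m * (- expR (- y)) + expR (- y) * (m%:R * y ^+ m.-1)).
    exact: is_deriveM (dX y) (dE y).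
  have dV : is_derive t 1 (fun t : R => t^-1) (- t ^- 2).
    by have := is_deriveV tn0 (is_derive_id t 1); rewrite [_ *: _]mulr1.
  have := @is_derive1_comp R p (fun t : R => t^-1) t _ _ (dp t^-1) dV.
  rewrite (_ : _ * _ = flat m.+2 t - m%:R * flat m.+1 t); last first.
    by rewrite /flat t0 -!exprVn; case: (m) => [|k] /=; rewrite !exprS ?expr0; ring.
  apply: near_eq_is_derive; near=> s; rewrite /flat /p /= ifT//.
  by rewrite -oppr_lt0; near: s; apply: Nlt_nbhsl; rewrite oppr_lt0.
- subst t; have f00 k : flat k 0 = 0 by rewrite /flat ltxx.
  rewrite !f00 mulr0 subr0.
  have F0 : h^-1 *: ((flat m \o shift 0) (h *: 1) - flat m 0) @[h --> 0^'] --> (0 : R).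
    apply/cvgr0Pnorm_lt => e e0; near=> h.
    rewrite /= f00 subr0 addr0 [h *: 1]mulr1 [h^-1 *: _]flatS ger0_norm ?flat_ge0//.
    have [h0|h0] := leP h 0; first by rewrite /flat (ltNge 0 h) h0.
    apply: le_lt_trans (flat_le _ (ltW h0)) _.
    have f0 : 0 < m.+2`!%:R :> R by rewrite ltr0n fact_gt0.
    rewrite -ltr_pdivlMl// mulrC; apply: le_lt_trans (ler_norm h) _.
    near: h; apply: dnbhs0_lt; by rewrite divr_gt0.
  by split; [apply/cvg_ex; exists 0|exact: cvg_lim F0].
Unshelve. all: by end_near. Qed.

(** Coefficients and exponents are kept as data, so that differentiation becomes an operation on
    lists and the class fits [smooth_coind]. *)
Definition flat_comb (s : seq (R * nat)) t := \sum_(p <- s) p.1 * flat p.2 t.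

Definition flat_comb_deriv (s : seq (R * nat)) : seq (R * nat) :=
  flatten [seq [:: (p.1, p.2.+2); (- (p.1 * p.2%:R), p.2.+1)] | p <- s].

Lemma is_derive_flat_comb s t :
  is_derive t 1 (flat_comb s) (flat_comb (flat_comb_deriv s) t).
Proof.
elim: s => [|[a m] s IH].
  rewrite (_ : flat_comb [::] = cst 0); last first.
    by apply/funext => u; rewrite /flat_comb big_nil.
  exact: is_derive_cst.
rewrite (_ : flat_comb ((a, m) :: s) = a *: flat m + flat_comb s); last first.
  by apply/funext => u; rewrite /flat_comb big_cons.
rewrite (_ : flat_comb (flat_comb_deriv _) t =
    a *: (flat m.+2 t - m%:R * flat m.+1 t) + flat_comb (flat_comb_deriv s) t); last first.
  by rewrite /flat_comb /= !big_cons /= addrA mulNr -mulrA -mulrBr.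
exact: (is_deriveD (is_deriveZ a (is_derive_flat m t)) IH).
Qed.

Lemma smooth_flat_affine d (i : 'I_d) m (c b : R) :
  smooth (fun x : 'rV[R]_d => flat m (c * x ord0 i + b)).
Proof.
pose P : set ('rV[R]_d -> R) :=
  [set h | exists s, h = fun x : 'rV[R]_d => flat_comb s (c * x ord0 i + b)].
suff : P `<=` @smooth R d.
  apply; exists [:: (1, m)]; apply/funext => x.
  by rewrite /flat_comb big_seq1 mul1r.
apply: smooth_coind => [_ [s ->] x|_ j [s ->]].
  apply: (@differentiable_comp _ _ _ _ (fun x : 'rV[R]_d => c * x ord0 i + b) (flat_comb s)).
    apply: differentiableD; last exact: differentiable_cst.
    apply: (@differentiableZ _ _ _ (fun x : 'rV[R]_d => x ord0 i) c).
    exact: differentiable_coord.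
  by apply/derivable1_diffP; case: (is_derive_flat_comb s (c * x ord0 i + b)).
have [ji|ji] := eqVneq j i.
  exists [seq (c * p.1, p.2) | p <- flat_comb_deriv s]; apply/funext => x.
  have [ds dsE] := is_derive_flat_comb s (c * x ord0 i + b).
  have [_ ->] : (derivable (fun x : 'rV[R]_d => flat_comb s (c * x ord0 i + b)) x
      (delta_mx ord0 j) <-> derivable (flat_comb s) (c * x ord0 i + b) c) /\
      partial j (fun x : 'rV[R]_d => flat_comb s (c * x ord0 i + b)) x =
      'D_c (flat_comb s) (c * x ord0 i + b).
    apply: eq_growth_derive => h; rewrite !mxE ji !eqxx mulr1; congr flat_comb.
    by rewrite /GRing.scale/= mulrDr addrA (mulrC c h).
  have df : differentiable (flat_comb s) (c * x ord0 i + b) by exact/derivable1_diffP.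
  have -> : 'D_c (flat_comb s) (c * x ord0 i + b) =
      c * 'D_1 (flat_comb s) (c * x ord0 i + b).
    rewrite !deriveE//; have := linearZ_LR ('d (flat_comb s) (c * x ord0 i + b)) c 1.
    by rewrite [c *: 1]mulr1.
  rewrite dsE.
  rewrite /flat_comb big_map [LHS]mulr_sumr.
  by apply: eq_bigr => p _; rewrite mulrA.
(* In a direction other than [i] the function is constant: its derivative is the empty
   combination. *)
exists [::]; apply/funext => x; rewrite /flat_comb big_nil.
have [_ ->] : (derivable (fun x : 'rV[R]_d => flat_comb s (c * x ord0 i + b)) x
      (delta_mx ord0 j) <->
      derivable (cst (flat_comb s (c * x ord0 i + b)) : 'rV[R]_d -> R) x (delta_mx ord0 j)) /\
    partial j (fun x : 'rV[R]_d => flat_comb s (c * x ord0 i + b)) x =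
      'D_(delta_mx ord0 j) (cst (flat_comb s (c * x ord0 i + b))) x.
  apply: eq_growth_derive => h; rewrite !mxE /= eq_sym.
  by rewrite (negbTE ji) mulr0 add0r.
exact: derive_cst.
Qed.

Lemma flat0_le1 t : flat 0 t <= 1.
Proof.
rewrite /flat; case: ifPn => // t0; rewrite expr0 mul1r expR_le1.
by rewrite oppr_le0 invr_ge0 ltW.
Qed.

Lemma flat0_le0 t : t <= 0 -> flat 0 t = 0.
Proof. by move=> t0; rewrite /flat ltNge t0. Qed.

Lemma cvg_flat0 t : 0 < t -> flat 0 (n%:R * t) @[n --> \oo] --> (1 : R).
Proof.
move=> t0; rewrite -(cvg_shiftS (fun n => flat 0 (n%:R * t))) /=.
rewrite (_ : (fun n => _) = (fun n => expR (- (t^-1 * n.+1%:R^-1)))); last first.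
  apply/funext => n; rewrite /flat ifT; last by rewrite mulr_gt0// ltr0n.
  by rewrite expr0 mul1r invfM mulrC.
have c : - (t^-1 * n.+1%:R^-1) @[n --> \oo] --> - (t^-1 * 0).
  by apply: cvgN; apply: cvgM; [exact: cvg_cst|exact: cvg_harmonic].
have : expR (- (t^-1 * n.+1%:R^-1)) @[n --> \oo] --> expR (- (t^-1 * 0)).
  by apply: continuous_cvg => //; exact: continuous_expR.
by rewrite mulr0 oppr0 expR0.
Qed.

Section box.
Context (d : nat).
Implicit Types (a b x : 'rV[R]_d).

(** Smooth functions bounded by one, zero outside the open box, and tending pointwise to its
    indicator. The arguments are written as affine functions of a coordinate to fit
    [smooth_flat_affine]. *)
Definition box_bump n a b : 'rV[R]_d -> R := \prod_(i < d)
  ((fun x => flat 0 (n%:R * x ord0 i + n%:R * - a ord0 i)) *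
   (fun x => flat 0 (- n%:R * x ord0 i + n%:R * b ord0 i))).

Lemma box_bumpE n a b x : box_bump n a b x = \prod_(i < d)
  (flat 0 (n%:R * (x ord0 i - a ord0 i)) * flat 0 (n%:R * (b ord0 i - x ord0 i))).
Proof.
rewrite /box_bump.
apply: (big_ind2 (fun (u : 'rV[R]_d -> R) v => u x = v)) => //.
  by move=> u1 v1 u2 v2 <- <-.
move=> i _ /=; rewrite mulrBr -mulrN [n%:R * (b _ _ - _)]mulrBr.
by rewrite [_ - n%:R * x _ _]addrC -mulNr.
Qed.

Lemma smooth_box_bump n a b : smooth (box_bump n a b).
Proof. by apply: smooth_prod => i; apply: smoothM; exact: smooth_flat_affine. Qed.

Lemma box_bump_norm_le1 n a b x : `|box_bump n a b x| <= 1.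
Proof.
rewrite box_bumpE normr_prod; apply: prodr_ile1 => i _.
rewrite normr_ge0 /= ger0_norm ?mulr_ge0 ?flat_ge0// mulr_ile1 ?flat_ge0 ?flat0_le1//.
Qed.

Lemma box_bump_out n a b x : ~ obox a b x -> box_bump n a b x = 0.
Proof.
move=> /existsNP[i /negP]; rewrite negb_and -!leNgt => h.
rewrite box_bumpE (bigD1 i)//=; case/orP: h => h.
  by rewrite flat0_le0 ?mul0r// mulr_ge0_le0// subr_le0.
by rewrite [X in _ * X * _]flat0_le0 ?mulr0 ?mul0r// mulr_ge0_le0// subr_le0.
Qed.

Lemma cvg_box_bump a b x : obox a b x -> box_bump n a b x @[n --> \oo] --> (1 : R).
Proof.
move=> h; under eq_fun do rewrite box_bumpE.
pose F (i : 'I_d) (n : nat) :=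
  flat 0 (n%:R * (x ord0 i - a ord0 i)) * flat 0 (n%:R * (b ord0 i - x ord0 i)).
have : \prod_(i < d) F i n @[n --> \oo] --> \prod_(i < d) (1 * 1 : R).
  apply: (cvg_big (@mul_continuous R)) => i _.
  have /andP[h1 h2] := h i.
  by apply: cvgM; apply: cvg_flat0; rewrite subr_gt0.
by rewrite big1// => i _; rewrite mulr1.
Qed.

Lemma test_box_bump n a b (D : set 'rV[R]_d) :
  [set x : 'rV[R]_d | forall i, a ord0 i <= x ord0 i <= b ord0 i] `<=` D ->
  test D (box_bump n a b).
Proof.
move=> abD; split; first exact: smooth_box_bump.
exists [set x : 'rV[R]_d | forall i, a ord0 i <= x ord0 i <= b ord0 i]; split => //.
  have := @rV_compact R d (fun i => `[a ord0 i, b ord0 i]%classic)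
    (fun i => segment_compact (a := a ord0 i) (b := b ord0 i)).
  by congr compact; apply/seteqP; split => x /= h i; have := h i; rewrite /= in_itv.
move=> x xab; apply: box_bump_out => h; apply: xab => i.
by have /andP[h1 h2] := h i; rewrite !ltW.
Qed.

End box.
End Bump.

(** * The fundamental lemma of the calculus of variations *)

Section Fundamental.
Context (R : realType) (d : nat).
Local Notation mu := (lebesgue_rV R d).
Implicit Types (D : set 'rV[R]_d) (g : 'rV[R]_d -> R).

(** Dominated convergence along [box_bump] replaces test functions by indicators of boxes; integrals
    over boxes determine [g] a.e. on a ball, and countably many balls cover [D]. *)
Lemma test_dense D g : open D -> mu.-integrable D (EFin \o g) ->
  (forall phi, test D phi -> \int[mu]_(x in D) (g x * phi x) = 0) ->
  ae_eq mu D g (cst 0).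
Proof.
move=> oD gi g0; have mD := open_rV_measurable oD.
have [x [r [xrD DE]]] := open_rV_bigcup_ball oD.
have box0 (a b : 'rV[R]_d) :
    [set x : 'rV[R]_d | forall i, a ord0 i <= x ord0 i <= b ord0 i] `<=` D ->
    (\int[mu]_(x in obox a b) (g x)%:E = 0)%E.
  move=> abD; have obD : obox a b `<=` D.
    by move=> y h; apply: abD => i; have /andP[h1 h2] := h i; rewrite !ltW.
  have mab := measurable_obox a b.
  have mg : measurable_fun D g by apply/measurable_EFinP; exact: measurable_int gi.
  have mb n : measurable_fun D (box_bump n a b).
    apply: measurable_funTS; apply: continuous_rV_measurable.
    exact/smooth_continuous/smooth_box_bump.
  pose G n y := (g y * box_bump n a b y)%:E.
  pose G0 y := (g y * \1_(obox a b) y)%:E.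
  have H1 n : measurable_fun D (G n) by apply/measurable_EFinP; exact: measurable_funM.
  have H2 : measurable_fun D G0.
    apply/measurable_EFinP; apply: measurable_funM => //; exact: measurable_indic.
  have H3 : {ae mu, forall y, D y -> G ^~ y @ \oo --> G0 y}.
    apply: aeW => y Dy; apply: cvg_EFin; first exact: nearW.
    apply: cvgM; first exact: cvg_cst.
    rewrite indicE; have [yab|yab] := boolP (y \in obox a b).
      by apply: cvg_box_bump; rewrite inE in yab.
    rewrite (_ : (fun n => _) = cst 0); first exact: cvg_cst.
    by apply/funext => n; rewrite box_bump_out// => /mem_set; apply/negP.
  have H4 : mu.-integrable D (fun y => `|(g y)%:E|%E) by exact: integrable_abse.
  have Gle n y : (`|G n y| <= `|(g y)%:E|)%E.
    by rewrite lee_fin normrM ler_piMr// box_bump_norm_le1.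
  have [_ _] := dominated_convergence mD H1 H2 H3 H4 (aeW _ (fun y n _ => Gle n y)).
  rewrite (_ : [sequence _]_n = cst 0%E); last first.
    apply/funext => n /=; rewrite -[LHS]fineK.
      by congr EFin; exact: g0 (test_box_bump n abD).
    by apply: integrable_fin_num => //; apply: le_integrable gi.
  move=> /cvg_lim; rewrite lim_cst// => /(_ (@ereal_hausdorff R)) I0.
  rewrite [RHS]I0 -(setIidr obD) integral_mkcondr; apply: eq_integral => y _.
  rewrite /G0.
  by rewrite patchE indicE; case: ifP => _; rewrite ?mulr1 ?mulr0.
have aek k : ae_eq mu (ball (x k) (r k)) g (cst 0).
  have [r0|r0] := ltP 0 (r k); last first.
    by apply: aeW => y [r1 _]; move: r0; rewrite leNgt r1.
  rewrite ball_obox//.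
  have sub : obox (x k - const_mx (r k)) (x k + const_mx (r k)) `<=` D.
    by rewrite -ball_obox// DE; move=> y ky; exists k.
  apply: ae_eq0_obox.
    by apply: integrableS gi => //; exact: measurable_obox.
  (* The closed box lies in the doubled ball, hence in [D]; this is what the doubling is for. *)
  move=> a' b'; rewrite oboxI; apply: box0 => y h; apply: (xrD k).
  split; first by rewrite pmulrn_lgt0.
  move=> i j; have := h j; rewrite (ord1 i) !mxE ge_max le_min => /andP[/andP[_ h1] /andP[_ h2]].
  by rewrite ball_itv /= in_itv /= mulr2n; apply/andP; split; lra.
rewrite /ae_eq DE.
have : mu.-negligible (\bigcup_k ~` [set y | ball (x k) (r k) y -> g y = cst 0 y]).
  by apply: negligible_bigcup => k; exact: aek.
apply: negligibleS => y /= /not_implyP[[k _ ky] gy].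
by exists k => //=; apply/not_implyP.
Qed.

End Fundamental.

(** * Weak derivatives *)

Lemma psd_form_preim (R : realType) (V W : lmodType R) (S : set V) (S' : set W)
    (b : W -> W -> R) (f : V -> W) : linear_subspace S ->
  (forall a x y, f (a *: x + y) = a *: f x + f y) ->
  (forall x, S x -> S' (f x)) -> psd_form S' b ->
  psd_form S (fun x y => b (f x) (f y)).
Proof.
move=> lS lf fS pb; split => //.
- by move=> a x y z /fS ? /fS ? /fS ?; rewrite lf (psd_lin pb).
- by move=> x y /fS ? /fS ?; rewrite (psd_sym pb).
- by move=> x /fS ?; exact: (psd_ge0 pb).
Qed.

(** Orthogonal projection of matrices onto the value space [U]. It turns entrywise constructions
    into [U]-valued ones. *)
Record is_Uproj (R : realType) (k : Ukind) (d : nat)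
    (P : 'M[R]_(Urows k d, Ucols k d) -> 'M[R]_(Urows k d, Ucols k d)) := IsUproj {
  Uproj_lin : forall a w z, P (a *: w + z) = a *: P w + P z ;
  Uproj_in : forall w, inU k d (P w) ;
  Uproj_id : forall w, inU k d w -> P w = w ;
  Uproj_sym : forall w z, frob (P w) z = frob w (P z) }.

Section ValueSpace.
Context (R : realType) (k : Ukind) (d : nat).
Local Notation U := 'M[R]_(Urows k d, Ucols k d).

Lemma inU_subspace : linear_subspace (inU k d : set U).
Proof.
case: k => //; split; first by rewrite /= trmx0.
by move=> a x y /= xE yE; rewrite linearD linearZ /= -xE -yE.
Qed.

Lemma frob_tr m n (w z : 'M[R]_(m, n)) : frob w^T z^T = frob w z.
Proof.
rewrite /frob exchange_big; apply: eq_bigr => i _; apply: eq_bigr => j _.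
by rewrite !mxE.
Qed.

(** The symmetric part for [Usym], the identity in the other cases. *)
Lemma ex_Uproj : exists P : U -> U, is_Uproj P.
Proof.
case: k; [by exists id; split|by exists id; split|by exists id; split|].
exists (fun w => 2^-1 *: (w + w^T)); split => /=.
- move=> a w z; have -> : (a *: w + z)^T = a *: w^T + z^T by rewrite linearP.
  by rewrite !scalerDr !scalerA [2^-1 * a]mulrC addrACA.
- move=> w; have -> : (2^-1 *: (w + w^T))^T = 2^-1 *: (w + w^T)^T by rewrite linearZ.
  by have -> : (w + w^T)^T = w + w^T by rewrite linearD /= trmxK addrC.
- by move=> w <-; rewrite scalerDr -scalerDl -[X in _ = X]scale1r; congr (_ *: _); lra.
- move=> w z; rewrite frobZl frobDl [RHS]frobC frobZl frobDl.
  by rewrite ![frob _ w]frobC -(frob_tr w^T) trmxK.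
Qed.

Definition Uproj : U -> U := projT1 (cid ex_Uproj).
Let PP : is_Uproj Uproj := projT2 (cid ex_Uproj).

Lemma UprojP : is_Uproj Uproj. Proof. exact: PP. Qed.

Lemma Uproj0 : Uproj 0 = 0.
Proof. by apply: (Uproj_id PP); case: inU_subspace. Qed.

Lemma UprojB w z : Uproj (w - z) = Uproj w - Uproj z.
Proof. by have := Uproj_lin PP (-1) z w; rewrite !scaleN1r addrC => ->; rewrite addrC. Qed.

Lemma Uproj_sum (I : Type) (r : seq I) (F : I -> R) (G : I -> U) :
  Uproj (\sum_(i <- r) F i *: G i) = \sum_(i <- r) F i *: Uproj (G i).
Proof.
by elim/big_rec2 : _ => [|i x y _ <-]; [exact: Uproj0|rewrite (Uproj_lin PP)].
Qed.

Lemma frob_Uproj_le w : frob (Uproj w) (Uproj w) <= frob w w.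
Proof.
have fp := frob_psd R (Urows k d) (Ucols k d).
have e : frob (Uproj w) (Uproj w) = frob w (Uproj w).
  by rewrite (Uproj_sym PP) (Uproj_id PP (Uproj_in PP w)).
have := frob_ge0 (w - Uproj w).
rewrite (psdBl fp)// !(psdBr fp)// [frob (Uproj w) w]frobC e subrr subr0.
by rewrite subr_ge0.
Qed.

Lemma frob_delta m n (w : 'M[R]_(m, n)) i j : frob w (delta_mx i j) = w i j.
Proof.
rewrite /frob (bigD1 i)//= (bigD1 j)//= mxE !eqxx mulr1.
rewrite big1 ?addr0; last by move=> l lj; rewrite mxE eqxx (negbTE lj) mulr0.
rewrite big1 ?addr0// => l li; rewrite big1// => h _.
by rewrite mxE (negbTE li) mulr0.
Qed.

(** Entries of a [U]-valued matrix are tested in directions that belong to [U], even when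
    [delta_mx i j] does not. *)
Lemma frob_Uproj_delta w i j : inU k d w -> frob w (Uproj (delta_mx i j)) = w i j.
Proof. by move=> wU; rewrite -(Uproj_sym PP) (Uproj_id PP)// frob_delta. Qed.

End ValueSpace.

(** * Square-integrable fields with values in U *)

Section Fields.
Context (R : realType) (d : nat) (k : Ukind).
Local Notation E := 'rV[R]_d.
Local Notation U := 'M[R]_(Urows k d, Ucols k d).
Local Notation mu := (lebesgue_rV R d).
Local Notation P := (@Uproj R k d).
Implicit Types (w z : E -> U) (D : set E).

Lemma L2_psd D : measurable D -> psd_form (@L2 R d D) (ip D).
Proof. exact: sqip_psd. Qed.

Lemma L2_subspace D : measurable D -> linear_subspace (@L2 R d D).
Proof. exact: sqint_subspace. Qed.

Lemma L2_sum D n (c : 'I_n -> R) (f : 'I_n -> E -> R) : measurable D ->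
  (forall i, L2 D (f i)) -> L2 D (fun x => \sum_i c i * f i x).
Proof.
move=> mD Lf; have -> : (fun x => \sum_i c i * f i x) = \sum_i c i *: f i.
  by apply/funext => x; rewrite fct_sumE.
exact: linear_subspace_sum (L2_subspace mD) Lf.
Qed.

Lemma L2U_subspace D : measurable D -> linear_subspace (@L2U R d k D).
Proof.
move=> mD; have [_ UL] := inU_subspace R k d; have [U0 _] := inU_subspace R k d.
split; first split => //.
  move=> i j; rewrite (_ : (fun x => _) = 0); first by case: (L2_subspace mD).
  by apply/funext => x; rewrite mxE.
move=> a w z [Lw Uw] [Lz Uz]; split => [i j|x Dx]; last first.
  exact: UL (Uw _ Dx) (Uz _ Dx).
rewrite (_ : (fun x => _) = a *: (fun x => w x i j) + (fun x => z x i j)).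
  by apply: (L2_subspace mD).2.
by apply/funext => x; rewrite !mxE.
Qed.

Lemma integrable_L2_mul D (f g : E -> R) : measurable D -> L2 D f -> L2 D g ->
  mu.-integrable D (EFin \o (fun x => f x * g x)).
Proof. by move=> mD Lf Lg; exact: (integrable_sqr_mul mD Lf Lg). Qed.

Lemma integrable_frob D w z : measurable D -> L2U D w -> L2U D z ->
  mu.-integrable D (EFin \o (fun x => frob (w x) (z x))).
Proof.
move=> mD [Lw _] [Lz _].
rewrite (_ : _ \o _ = (fun x => \sum_i \sum_j (w x i j * z x i j)%:E)%E); last first.
  apply/funext => x; rewrite /= /frob -sumEFin; apply: eq_bigr => i _.
  by rewrite -sumEFin.
do 2 (apply: integrable_sum => // ? _).
exact: integrable_L2_mul.
Qed.

Lemma ipUE D w z : measurable D -> L2U D w -> L2U D z ->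
  ipU D w z = \sum_i \sum_j ip D (fun x => w x i j) (fun x => z x i j).
Proof.
move=> mD [Lw _] [Lz _]; rewrite /ipU /frob Rintegral_sum//.
  by apply: eq_bigr => i _; rewrite Rintegral_sum// => j _; exact: integrable_L2_mul.
move=> i _.
rewrite (_ : _ \o _ = (fun x => \sum_j (w x i j * z x i j)%:E)%E); last first.
  by apply/funext => x; rewrite /= -sumEFin.
by apply: integrable_sum => // j _; exact: integrable_L2_mul.
Qed.

Lemma L2U_psd D : measurable D -> psd_form (@L2U R d k D) (ipU D).
Proof.
move=> mD; split; first exact: L2U_subspace.
- move=> a w w' z Lw Lw' Lz; rewrite /ipU -RintegralZl//; last exact: integrable_frob.
  rewrite -RintegralD//.
  + by apply: eq_Rintegral => x _; rewrite frobDl frobZl.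
  + exact: integrableZl (integrable_frob mD Lw Lz).
  + exact: integrable_frob.
- by move=> w z _ _; apply: eq_Rintegral => x _; rewrite frobC.
- by move=> w _; apply: Rintegral_ge0 => x _; exact: frob_ge0.
Qed.

Lemma L2_ae_comp D w z : (forall i j, ae_eq mu D (fun x => w x i j) (fun x => z x i j)) ->
  ae_eq mu D w z.
Proof.
move=> h; have : {ae mu, forall x, forall i j, D x -> w x i j = z x i j}.
  by apply: filter_forall => i; apply: filter_forall => j; exact: h.
by apply: filterS => x hx Dx; apply/matrixP => i j; exact: hx.
Qed.

Lemma ipU_ae_eq D w w' z z' : measurable D -> L2U D w -> L2U D w' ->
  L2U D z -> L2U D z' -> ae_eq mu D w w' -> ae_eq mu D z z' ->
  ipU D w z = ipU D w' z'.
Proof.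
move=> mD Lw Lw' Lz Lz' ww' zz'; apply: ae_eq_Rintegral => //.
- by apply/measurable_EFinP; exact: measurable_int (integrable_frob mD Lw Lz).
- by apply/measurable_EFinP; exact: measurable_int (integrable_frob mD Lw' Lz').
- by apply: filterS2 ww' zz' => x h h' Dx; rewrite h// h'.
Qed.

(** Entrywise limits need not lie in [U] at every point, so the limit is projected; the projection
    fixes [g n] on [D] and does not increase distances. *)
Lemma sqint_component_completeU D (g : nat -> E -> U) : measurable D ->
  (mu D < +oo)%E -> (forall n, L2U D (g n)) ->
  (forall e : R, 0 < e -> exists N, forall m n, (N <= m)%N -> (N <= n)%N ->
    ipU D (g m - g n) (g m - g n) <= e) ->
  exists2 z, L2U D z & forall e : R, 0 < e -> exists N, forall n, (N <= n)%N ->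
    ipU D (g n - z) (g n - z) <= e.
Proof.
move=> mD Doo Lg cg.
have LB w z : L2U D w -> L2U D z -> L2U D (w - z).
  by move=> ? ?; apply: linear_subspaceB => //; exact: L2U_subspace.
pose c n i j x := g n x i j.
have ij_le w i j : L2U D w -> ip D (fun x => w x i j) (fun x => w x i j) <= ipU D w w.
  move=> Lw; rewrite ipUE// (bigD1 i)//= (bigD1 j)//= -addrA lerDl addr_ge0//.
    by apply: sumr_ge0 => l _; apply: psd_ge0 (L2_psd mD) _ _; exact: Lw.1.
  apply: sumr_ge0 => h _; apply: sumr_ge0 => l _.
  by apply: psd_ge0 (L2_psd mD) _ _; exact: Lw.1.
have cE n m i j : c n i j - c m i j = (fun x => (g n - g m) x i j).
  by apply/funext => x; rewrite !mxE.
have compl i j : exists2 f, L2 D f & forall e : R, 0 < e -> exists N,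
    forall n, (N <= n)%N -> ip D (c n i j - f) (c n i j - f) <= e.
  apply: (sqint_complete mD Doo) => [n|e e0]; first exact: (Lg n).1.
  have [N hN] := cg e e0; exists N => m n Nm Nn; rewrite cE.
  by apply: le_trans (hN m n Nm Nn); apply: ij_le; exact: LB.
pose f i j : E -> R := projT1 (cid2 (compl i j)).
have Lf i j : L2 D (f i j) by rewrite /f; case: cid2.
have fc i j (e : R) : 0 < e -> exists N, forall n, (N <= n)%N ->
   ip D (c n i j - f i j) (c n i j - f i j) <= e.
  by rewrite /f; case: cid2 => ? ? h /h.
pose F x : U := \matrix_(i, j) f i j x.
pose z x := P (F x).
have Lz : L2U D z.
  split; last by move=> x _; exact: (Uproj_in (UprojP R k d)).
  move=> i j; rewrite (_ : (fun x => _) = (fun x => \sum_a 1 *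
      (fun x => \sum_b P (delta_mx i j) a b * f a b x) x)).
    by apply: L2_sum => // a; apply: L2_sum.
  apply/funext => x; rewrite -frob_delta (Uproj_sym (UprojP R k d)).
  apply: eq_bigr => a _; rewrite mul1r; apply: eq_bigr => b _.
  by rewrite mxE mulrC.
exists z => // e e0.
(* One more than the number of entries, which keeps the divisor positive if there are none. *)
pose M := (Urows k d * Ucols k d).+1.
have e1 : 0 < e / M%:R by rewrite divr_gt0// ltr0n.
have [N hN] : exists N, forall n, (N <= n)%N -> forall i j,
    ip D (c n i j - f i j) (c n i j - f i j) <= e / M%:R.
  pose Nij i j := projT1 (cid (fc i j _ e1)).
  exists (\max_i \max_j Nij i j) => n /bigmax_leqP h i j.
  apply: (projT2 (cid (fc i j _ e1))).
  by have /bigmax_leqP := h i isT; apply.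
exists N => n Nn.
have Lc i j : L2 D (c n i j - f i j).
  apply: linear_subspaceB => //; [exact: L2_subspace|exact: (Lg n).1].
apply: (@le_trans _ _ (\sum_i \sum_j ip D (c n i j - f i j) (c n i j - f i j))).
  have -> : \sum_i \sum_j ip D (c n i j - f i j) (c n i j - f i j) =
      \int[mu]_(x in D) frob (g n x - F x) (g n x - F x).
    rewrite /frob Rintegral_sum//; last first.
      move=> i _.
      rewrite (_ : _ \o _ = (fun x => \sum_j ((c n i j - f i j) x * (c n i j - f i j) x)%:E)%E).
        by apply: integrable_sum => // j _; exact: integrable_L2_mul.
      by apply/funext => x; rewrite /= -sumEFin; apply: eq_bigr => j _; rewrite !mxE.
    apply: eq_bigr => i _; rewrite Rintegral_sum//; last first.
      move=> j _; have := integrable_L2_mul mD (Lc i j) (Lc i j).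
      by congr (integrable _ _ _); apply/funext => x; rewrite /= !mxE.
    by apply: eq_bigr => j _; apply: eq_Rintegral => x _; rewrite !mxE.
  apply: le_Rintegral => //.
  - by apply: integrable_frob => //; exact: LB.
  - rewrite (_ : _ \o _ = (fun x => \sum_i \sum_j
        ((c n i j - f i j) x * (c n i j - f i j) x)%:E)%E).
      by do 2 (apply: integrable_sum => // ? _); exact: integrable_L2_mul.
    apply/funext => x; rewrite /= /frob -sumEFin; apply: eq_bigr => i _.
    by rewrite -sumEFin; apply: eq_bigr => j _; rewrite !mxE.
  - move=> x Dx; have -> : (g n - z) x = P (g n x - F x).
      by rewrite UprojB (Uproj_id (UprojP R k d))//; exact: (Lg n).2.
    exact: frob_Uproj_le.
apply: (@le_trans _ _ (\sum_(i < Urows k d) \sum_(j < Ucols k d) e / M%:R)).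
  by apply: ler_sum => i _; apply: ler_sum => j _; exact: hN.
rewrite !sumr_const !card_ord -mulrnA -[leLHS]mulr_natr mulrAC ler_pdivrMr ?ltr0n//.
apply: ler_wpM2l; first exact: ltW.
by rewrite ler_nat mulnC /M.
Qed.

End Fields.

Section WeakDerivative.
Context (R : realType) (d : nat) (k : Ukind) (A : diffop R d k).
Local Notation E := 'rV[R]_d.
Local Notation U := 'M[R]_(Urows k d, Ucols k d).
Local Notation mu := (lebesgue_rV R d).
Local Notation P := (@Uproj R k d).
Implicit Types (v : E -> R) (w g : E -> U) (D : set E).

Lemma test_L2 D (phi : E -> R) : measurable D -> bounded_set D -> test D phi ->
  L2 D phi.
Proof.
by move=> mD bD [sp _]; apply: continuous_L2 => //; exact: smooth_continuous.
Qed.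

Lemma testU_L2U D (chi : E -> U) : measurable D -> bounded_set D ->
  testU D chi -> L2U D chi.
Proof. by move=> mD bD [tc Uc]; split => // i j; exact: test_L2. Qed.

Lemma test_frob D (c : U) (chi : E -> U) : testU D chi ->
  test D (fun y => frob c (chi y)).
Proof.
move=> [tc _]; rewrite (_ : (fun y => _) =
    \sum_i \sum_j c i j *: (fun y => chi y i j)).
  by apply: test_sum => i; apply: test_sum => j; apply: testZ.
apply/funext => y; rewrite /frob fct_sumE; apply: eq_bigr => i _.
by rewrite fct_sumE.
Qed.

Lemma applyAsE (chi : E -> U) : applyAs A chi =
  \sum_(alpha | (mi_abs alpha <= Defs.order A)%N) (-1) ^+ mi_abs alpha *:
    partial_mi alpha (fun y => frob (coef A alpha) (chi y)).
Proof. by apply/funext => x; rewrite fct_sumE. Qed.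

Lemma test_applyAs D (chi : E -> U) : testU D chi -> test D (applyAs A chi).
Proof.
move=> tc; rewrite applyAsE; apply: test_sum => alpha; apply: testZ.
by rewrite partial_miE; apply: test_foldr; exact: test_frob.
Qed.

Lemma applyA_entry (phi : E -> R) i j : (fun x => applyA A phi x i j) =
  \sum_(alpha | (mi_abs alpha <= Defs.order A)%N)
    coef A alpha i j *: partial_mi alpha phi.
Proof.
apply/funext => x; rewrite fct_sumE /applyA summxE.
by apply: eq_bigr => alpha _; rewrite mxE mulrC.
Qed.

Lemma applyA_inU (phi : E -> R) x : inU k d (applyA A phi x).
Proof.
have lU := inU_subspace R k d.
rewrite /applyA; elim/big_ind : _ => [|u v Uu Uv|alpha _].
- by case: lU.
- exact: linear_subspaceD.
- by apply: linear_subspaceZ => //; exact: coef_inU.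
Qed.

Lemma smooth_applyA (phi : E -> R) i j : smooth phi ->
  smooth (fun x => applyA A phi x i j).
Proof.
move=> sp; rewrite applyA_entry; apply: smooth_sum => alpha; apply: smoothZ.
by rewrite partial_miE; exact: smooth_foldr.
Qed.

Lemma smooth_applyA_L2U D (phi : E -> R) : measurable D -> bounded_set D ->
  smooth phi -> L2U D (applyA A phi).
Proof.
move=> mD bD sp; split; last by move=> x _; exact: applyA_inU.
by move=> i j; apply: continuous_L2 => //; apply: smooth_continuous; exact: smooth_applyA.
Qed.

(** Integration by parts against a compactly supported [chi]; the sign in [applyAs] cancels the one
    it produces. *)
Lemma is_weakA_smooth D (phi : E -> R) : open D -> bounded_set D ->
  smooth phi -> is_weakA A D phi (applyA A phi).
Proof.
move=> oD bD sp; have mD := open_rV_measurable oD.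
split; first exact: smooth_applyA_L2U.
move=> chi tc; rewrite /ip /ipU.
have Lmi alpha : L2 D (partial_mi (m := Defs.order A) alpha phi).
  rewrite partial_miE; apply: continuous_L2 => //.
  exact/smooth_continuous/smooth_foldr.
have tf alpha := test_frob (coef A alpha) tc.
have Lphi : L2 D phi by apply: continuous_L2 => //; exact: smooth_continuous.
have Ldf alpha : L2 D (partial_mi alpha (fun y => frob (coef A alpha) (chi y))).
  by rewrite partial_miE; apply: test_L2 => //; exact: test_foldr.
transitivity (\sum_(alpha | (mi_abs alpha <= Defs.order A)%N)
    \int[mu]_(x in D) (partial_mi alpha phi x * frob (coef A alpha) (chi x))).
- transitivity (\int[mu]_(x in D) \sum_(alpha | (mi_abs alpha <= Defs.order A)%N)
     ((-1) ^+ mi_abs alpha * (phi x *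
        partial_mi alpha (fun y => frob (coef A alpha) (chi y)) x))).
    apply: eq_Rintegral => x _; rewrite /applyAs mulr_sumr.
    by apply: eq_bigr => alpha _; rewrite mulrCA.
  rewrite Rintegral_sum//; last first.
    move=> alpha _.
    exact: (integrableZl mD ((-1) ^+ mi_abs alpha)
      (integrable_L2_mul mD Lphi (Ldf alpha))).
  apply: eq_bigr => alpha _; rewrite RintegralZl//; last exact: integrable_L2_mul.
  by rewrite integration_by_parts_mi// mulrA -exprD -signr_odd oddD addbb expr0 mul1r.
- rewrite -Rintegral_sum//.
    apply: eq_Rintegral => x _; rewrite /applyA frob_suml.
    by apply: eq_bigr => alpha _; rewrite frobZl.
  by move=> alpha _; apply: integrable_L2_mul => //; exact: test_L2.
Qed.

(** Test fields [phi x *: P (delta_mx i j)] isolate one entry of the difference, to which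
    [test_dense] applies. Boundedness of [D] makes square-integrable functions integrable. *)
Lemma is_weakA_unique D v g g' : open D -> bounded_set D ->
  is_weakA A D v g -> is_weakA A D v g' -> ae_eq mu D g g'.
Proof.
move=> oD bD [Lg hg] [Lg' hg']; have mD := open_rV_measurable oD.
have pU := L2U_psd k mD.
have Lh := linear_subspaceB (L2U_subspace k mD) Lg Lg'.
apply: L2_ae_comp => i j.
have : ae_eq mu D (fun x => (g - g') x i j) (cst 0).
  apply: test_dense => //.
    have := sqint_cst mD (bounded_rV_lty mD bD) (1 : R).
    move=> /(integrable_L2_mul mD (Lh.1 i j)); apply: eq_integrable => // x _ /=.
    by rewrite mulr1.
  move=> phi tp; pose chi x : U := phi x *: P (delta_mx i j).
  have tc : testU D chi.
    split; last first.
      move=> x; apply: linear_subspaceZ; first exact: inU_subspace.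
      exact: (Uproj_in (UprojP R k d)).
    move=> a b; rewrite (_ : (fun x => _) = P (delta_mx i j) a b *: phi).
      exact: testZ.
    by apply/funext => x; rewrite mxE mulrC.
  have := hg _ tc; rewrite hg'// => e.
  have : ipU D (g - g') chi = 0.
    by rewrite (psdBl pU)// ?e ?subrr//; exact: testU_L2U.
  move=> <-; apply: eq_Rintegral => x; rewrite inE => Dx.
  rewrite /chi frobC frobZl frobC frob_Uproj_delta 1?mulrC//.
  by apply: Lh.2.
by apply: filterS => x h Dx; have := h Dx; rewrite !mxE => /eqP; rewrite subr_eq0 => /eqP.
Qed.

Lemma is_weakAs_unique D w (g g' : E -> R) : open D -> bounded_set D ->
  is_weakAs A D w g -> is_weakAs A D w g' -> ae_eq mu D g g'.
Proof.
move=> oD bD [Lg hg] [Lg' hg']; have mD := open_rV_measurable oD.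
have pL := L2_psd mD; have Lh := linear_subspaceB (L2_subspace mD) Lg Lg'.
have : ae_eq mu D (g - g') (cst 0).
  apply: test_dense => //.
    have := sqint_cst mD (bounded_rV_lty mD bD) (1 : R).
    move=> /(integrable_L2_mul mD Lh); apply: eq_integrable => // x _ /=.
    by rewrite mulr1.
  move=> phi tp; have := hg _ tp; rewrite hg'// => e.
  have : ip D (g - g') phi = 0.
    by rewrite (psdBl pL)// ?e ?subrr//; exact: test_L2.
  by [].
by apply: filterS => x h Dx; have := h Dx => /eqP; rewrite subr_eq0 => /eqP.
Qed.

Lemma is_weakA_lin D (a : R) v v' g g' : measurable D -> bounded_set D ->
  L2 D v -> L2 D v' -> is_weakA A D v g -> is_weakA A D v' g' ->
  is_weakA A D (a *: v + v') (a *: g + g').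
Proof.
move=> mD bD Lv Lv' [Lg hg] [Lg' hg']; split; first by apply: (L2U_subspace k mD).2.
move=> chi tc; have Lc := testU_L2U mD bD tc.
have LA := test_L2 mD bD (test_applyAs tc).
by rewrite (psd_lin (L2_psd mD))// (psd_lin (L2U_psd k mD))// hg// hg'.
Qed.

Lemma is_weakA_ae D v v' g : measurable D -> bounded_set D ->
  L2 D v -> L2 D v' -> ae_eq mu D v v' -> is_weakA A D v g -> is_weakA A D v' g.
Proof.
move=> mD bD Lv Lv' vv' [Lg hg]; split => // chi tc; rewrite -hg//.
have LA := test_L2 mD bD (test_applyAs tc).
change (sqip mu D v' (applyAs A chi) = sqip mu D v (applyAs A chi)).
apply: (sqip_ae_eq mD) => //.
  by apply: filterS vv' => x h Dx; rewrite h.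
by exact: aeW.
Qed.

Lemma wA_weak D v : (exists g, is_weakA A D v g) -> is_weakA A D v (wA A D v).
Proof. by move=> h; exact: xgetPex. Qed.

Lemma wAs_weak D w : (exists g : E -> R, is_weakAs A D w g) -> is_weakAs A D w (wAs A D w).
Proof. by move=> h; exact: xgetPex. Qed.

Lemma wA_ae D v g : open D -> bounded_set D -> is_weakA A D v g ->
  ae_eq mu D (wA A D v) g.
Proof. by move=> oD bD vg; apply: (is_weakA_unique oD bD _ vg); apply: wA_weak; exists g. Qed.

Lemma wAs_ae D w (g : E -> R) : open D -> bounded_set D -> is_weakAs A D w g ->
  ae_eq mu D (wAs A D w) g.
Proof. by move=> oD bD wg; apply: (is_weakAs_unique oD bD _ wg); apply: wAs_weak; exists g. Qed.

(** For fixed [chi] both sides of the weak identity are continuous in [L_2], and one good index per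
    tolerance is enough. *)
Lemma is_weakA_closed D (s : nat -> E -> R) (g : nat -> E -> U) v h :
  measurable D -> bounded_set D -> (forall n, L2 D (s n)) -> L2 D v ->
  (forall n, is_weakA A D (s n) (g n)) -> L2U D h ->
  (forall e : R, 0 < e -> exists n, ip D (s n - v) (s n - v) <= e /\
     ipU D (g n - h) (g n - h) <= e) ->
  is_weakA A D v h.
Proof.
move=> mD bD Ls Lv sg Lh conv; split => // chi tc.
have pL := L2_psd mD; have pU := L2U_psd k mD.
have Lc := testU_L2U mD bD tc; have LA := test_L2 mD bD (test_applyAs tc).
apply/eqP; rewrite -subr_eq0 -normr_le0; apply/ler_addgt0Pr => e e0; rewrite add0r.
pose M := psd_norm (ip D) (applyAs A chi) + psd_norm (ipU D) chi + 1.
have M0 : 0 < M by rewrite ltr_wpDl// addr_ge0// psd_norm_ge0.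
have e1 : 0 < e / M by rewrite divr_gt0.
have [n [h1 h2]] := conv _ (exprn_gt0 2 e1).
have [Lg hg] := sg n.
have LB1 := linear_subspaceB (L2_subspace mD) (Ls n) Lv.
have LB2 := linear_subspaceB (L2U_subspace k mD) Lg Lh.
have n1 : psd_norm (ip D) (s n - v) <= e / M.
  by rewrite -(@ler_pXn2r _ 2)// ?nnegrE ?psd_norm_ge0 ?(ltW e1)// (sqr_psd_norm pL).
have n2 : psd_norm (ipU D) (g n - h) <= e / M.
  by rewrite -(@ler_pXn2r _ 2)// ?nnegrE ?psd_norm_ge0 ?(ltW e1)// (sqr_psd_norm pU).
have -> : ip D v (applyAs A chi) - ipU D h chi =
    ipU D (g n - h) chi - ip D (s n - v) (applyAs A chi).
  by rewrite (psdBl pL)// (psdBl pU)// hg//; ring.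
apply: le_trans (ler_normB _ _) _.
apply: (@le_trans _ _ (e / M * psd_norm (ipU D) chi +
                       e / M * psd_norm (ip D) (applyAs A chi))).
  apply: lerD.
    by apply: le_trans (psd_cauchy pU LB2 Lc) _; rewrite ler_wpM2r// psd_norm_ge0.
  by apply: le_trans (psd_cauchy pL LB1 LA) _; rewrite ler_wpM2r// psd_norm_ge0.
rewrite -mulrDr mulrAC ler_pdivrMr// ler_pM2l//.
by rewrite /M [psd_norm (ipU D) _ + _]addrC lerDl.
Qed.

End WeakDerivative.

(** * Broken spaces and traces *)

Lemma cauchy_schwarz2 (R : realType) (a b c e : R) :
  a * c + b * e <= Num.sqrt (a ^+ 2 + b ^+ 2) * Num.sqrt (c ^+ 2 + e ^+ 2).
Proof.
rewrite -sqrtrM ?addr_ge0 ?sqr_ge0//; apply: le_trans (ler_norm _) _.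
rewrite -sqrtr_sqr ler_wsqrtr//.
have := sqr_ge0 (a * e - b * c).
have -> : (a ^+ 2 + b ^+ 2) * (c ^+ 2 + e ^+ 2) =
  (a * c + b * e) ^+ 2 + (a * e - b * c) ^+ 2 by ring.
by rewrite lerDl.
Qed.

Section Patch.
Context d (T : measurableType d) (R : realType) (mu : {measure set T -> \bar R}).
Context (D E : set T) (mD : measurable D) (mE : measurable E) (ED : E `<=` D).
Implicit Type f : T -> R.

Lemma integrable_patch f : mu.-integrable E (EFin \o f) ->
  mu.-integrable D (EFin \o (f \_ E)).
Proof.
move=> /(integrable_mkcond _ mE) fE.
have := integrableS measurableT mD (@subsetT _ _) fE.
by apply: eq_integrable => // x _; rewrite restrict_EFin.
Qed.

Lemma Rintegral_patch f : \int[mu]_(x in E) f x = \int[mu]_(x in D) (f \_ E) x.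
Proof. by rewrite -Rintegral_mkcondr setIidr. Qed.

Lemma le_Rintegral_sub f : mu.-integrable D (EFin \o f) ->
  (forall x, 0 <= f x) -> \int[mu]_(x in E) f x <= \int[mu]_(x in D) f x.
Proof.
move=> fi f0; rewrite Rintegral_patch; apply: le_Rintegral => //.
  exact: integrable_patch (integrableS mD mE ED fi).
by move=> x _; rewrite patchE; case: ifP.
Qed.

End Patch.

Section Mesh.
Context (R : realType) (d : nat) (k : Ukind) (A : diffop R d k).
Local Notation E := 'rV[R]_d.
Local Notation U := 'M[R]_(Urows k d, Ucols k d).
Local Notation mu := (lebesgue_rV R d).
Context (Omega : set E) (oO : open Omega) (bO : bounded_set Omega).
Context (N : nat) (T : 'I_N -> set E).
Hypothesis oT : forall i, open (T i).
Hypothesis TO : forall i, T i `<=` Omega.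

Let mO : measurable Omega := open_rV_measurable oO.
Let mT i : measurable (T i) := open_rV_measurable (@oT i).

Let bT i : bounded_set (T i).
Proof. by have [M [Mr h]] := bO; exists M; split=> // x Mx y /TO; exact: h. Qed.

Lemma L2_elem i v : L2 Omega v -> L2 (T i) v.
Proof. by apply: sqint_sub. Qed.

Lemma L2U_elem i (w : E -> U) : L2U Omega w -> L2U (T i) w.
Proof. by move=> [Lw Uw]; split=> [a b|x /TO]; [exact: L2_elem|exact: Uw]. Qed.

Lemma HAT_subspace : linear_subspace (HAT A Omega T).
Proof.
have [L0 LL] := L2_subspace mO; split.
  split => // i; exists (applyA A 0); apply: is_weakA_smooth => //; exact: smooth_cst.
move=> a x y [Lx wx] [Ly wy]; split; first exact: LL.
move=> i; have [g xg] := wx i; have [h yh] := wy i; exists (a *: g + h).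
by apply: is_weakA_lin => //; exact: L2_elem.
Qed.

Lemma AT_L2U i v : HAT A Omega T v -> L2U (T i) (AT A T v i).
Proof. by move=> [_ /(_ i)/wA_weak[]]. Qed.

(** Linearity holds a.e. by uniqueness of weak derivatives; the representatives returned by [xget]
    are not chosen linearly. *)
Lemma AT_lin i (a : R) u v : HAT A Omega T u -> HAT A Omega T v ->
  ae_eq mu (T i) (AT A T (a *: u + v) i) (a *: AT A T u i + AT A T v i).
Proof.
move=> [Lu wu] [Lv wv]; apply: wA_ae => //.
by apply: is_weakA_lin => //; [exact: L2_elem|exact: L2_elem|exact: wA_weak|exact: wA_weak].
Qed.

Lemma ipU_AT_psd i :
  psd_form (HAT A Omega T) (fun u v => ipU (T i) (AT A T u i) (AT A T v i)).
Proof.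
have lH := HAT_subspace; have pU := L2U_psd k (mT i); split; first exact: lH.
- move=> a x y z Hx Hy Hz.
  have Lx := AT_L2U i Hx; have Ly := AT_L2U i Hy; have Lz := AT_L2U i Hz.
  rewrite -(psd_lin pU a Lx Ly Lz).
  apply: (ipU_ae_eq (mT i) _ _ Lz Lz (AT_lin i a Hx Hy) (aeW _ (fun _ _ => erefl))).
    exact: AT_L2U (lH.2 a _ _ Hx Hy).
  exact: (L2U_subspace k (mT i)).2 Lx Ly.
- by move=> x y Hx Hy; rewrite (psd_sym pU)//; exact: AT_L2U.
- by move=> x Hx; apply: (psd_ge0 pU); exact: AT_L2U.
Qed.

Lemma ipT_AT_psd :
  psd_form (HAT A Omega T) (fun u v => ipT T (AT A T u) (AT A T v)).
Proof.
by apply: (psd_form_sum (b := fun i u v => ipU (T i) (AT A T u i) (AT A T v i)));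
  [exact: HAT_subspace|exact: ipU_AT_psd].
Qed.

Lemma ipO_psd : psd_form (HAT A Omega T) (ip Omega).
Proof.
by apply: psd_formS (L2_psd mO); [exact: HAT_subspace|move=> v []].
Qed.

Definition formAT u v := ip Omega u v + ipT T (AT A T u) (AT A T v).

Lemma formAT_psd : psd_form (HAT A Omega T) formAT.
Proof. exact: psd_formD ipO_psd ipT_AT_psd. Qed.

Lemma ipT_ge0 (w : 'I_N -> E -> U) : 0 <= ipT T w w.
Proof. by apply: sumr_ge0 => i _; apply: Rintegral_ge0 => x _; exact: frob_ge0. Qed.

Lemma ip_ge0 D (v : E -> R) : 0 <= ip D v v.
Proof. by apply: Rintegral_ge0 => x _; rewrite -expr2 sqr_ge0. Qed.

Lemma ipU_ge0 D (w : E -> U) : 0 <= ipU D w w.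
Proof. by apply: Rintegral_ge0 => x _; exact: frob_ge0. Qed.

Lemma normATE v : normAT A Omega T v = psd_norm formAT v.
Proof. by rewrite /normAT /norm2 /normT !sqr_sqrtr ?ip_ge0 ?ipT_ge0. Qed.

(** The functions and their elementwise derivatives converge separately in [L_2]; [is_weakA_closed]
    identifies the latter limits as derivatives of the former. *)
Lemma HAT_complete (s : nat -> E -> R) : (forall n, HAT A Omega T (s n)) ->
  (forall e : R, 0 < e -> exists M, forall m n, (M <= m)%N -> (M <= n)%N ->
    formAT (s m - s n) (s m - s n) <= e) ->
  exists2 v, HAT A Omega T v & forall e : R, 0 < e -> exists M, forall n, (M <= n)%N ->
    formAT (s n - v) (s n - v) <= e.
Proof.
move=> Hs cs; have lH := HAT_subspace.
have HB m n := linear_subspaceB lH (Hs m) (Hs n).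
have formO u : ip Omega u u <= formAT u u by rewrite lerDl ipT_ge0.
have formT i u : ipU (T i) (AT A T u i) (AT A T u i) <= formAT u u.
  rewrite /formAT /ipT (bigD1 i)//= addrCA lerDl addr_ge0 ?ip_ge0//.
  by apply: sumr_ge0 => j _; exact: ipU_ge0.
have AB i u v : HAT A Omega T u -> HAT A Omega T v ->
    ae_eq mu (T i) (AT A T (u - v) i) (AT A T u i - AT A T v i).
  move=> Hu Hv; have := AT_lin i (-1) Hv Hu.
  by rewrite !scaleN1r [- v + u]addrC [- AT A T v i + _]addrC.
have [|e e0|v Lv vc] := sqint_complete mO (bounded_rV_lty mO bO) (s := s).
- by move=> n; case: (Hs n).
- have [M hM] := cs _ e0; exists M => m n Mm Mn.
  exact: le_trans (formO _) (hM _ _ Mm Mn).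
have hex i : exists2 h, L2U (T i) h & forall e : R, 0 < e -> exists M, forall n, (M <= n)%N ->
    ipU (T i) (AT A T (s n) i - h) (AT A T (s n) i - h) <= e.
  apply: sqint_component_completeU => //.
  - exact: bounded_rV_lty.
  - by move=> n; exact: AT_L2U.
  - move=> e e0; have [M hM] := cs _ e0; exists M => m n Mm Mn.
    apply: le_trans (hM _ _ Mm Mn); apply: le_trans (formT i _).
    rewrite le_eqVlt; apply/orP; left; apply/eqP; apply/esym.
    apply: ipU_ae_eq => //; try exact: AT_L2U; try exact: AB.
      by apply: linear_subspaceB (L2U_subspace k (mT i)) _ _; exact: AT_L2U.
    by apply: linear_subspaceB (L2U_subspace k (mT i)) _ _; exact: AT_L2U.
pose h i := projT1 (cid2 (hex i)).
have Lh i : L2U (T i) (h i) by rewrite /h; case: cid2.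
have hc i (e : R) : 0 < e -> exists M, forall n, (M <= n)%N ->
    ipU (T i) (AT A T (s n) i - h i) (AT A T (s n) i - h i) <= e.
  by rewrite /h; case: cid2 => ? ? hh /hh.
have wv i : is_weakA A (T i) v (h i).
  apply: (@is_weakA_closed _ _ _ _ (T i) s (fun n => AT A T (s n) i)) => //.
  - by move=> n; apply: L2_elem; case: (Hs n).
  - exact: L2_elem.
  - by move=> n; apply: wA_weak; case: (Hs n).
  - move=> e e0; have [M1 h1] := vc _ e0; have [M2 h2] := hc i _ e0.
    exists (maxn M1 M2); split; last by apply: h2; exact: leq_maxr.
    apply: le_trans (h1 _ (leq_maxl _ _)).
    have LB : L2 Omega (s (maxn M1 M2) - v).
      by apply: linear_subspaceB (L2_subspace mO) _ _ => //; case: (Hs (maxn M1 M2)).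
    apply: le_Rintegral_sub => //; first exact: integrable_L2_mul.
    by move=> x; rewrite -expr2 sqr_ge0.
have Hv : HAT A Omega T v by split => // i; exists (h i).
exists v => // e e0.
(* One share of [e] for the function and one for each of the [N] elements. *)
have e1 : 0 < e / N.+1%:R by rewrite divr_gt0// ltr0n.
have [M0 h0] := vc _ e1.
pose M i := projT1 (cid (hc i _ e1)).
have hM i := projT2 (cid (hc i _ e1)).
exists (maxn M0 (\max_i M i)) => n; rewrite geq_max => /andP[n0 /bigmax_leqP n1].
rewrite /formAT; apply: (@le_trans _ _ (e / N.+1%:R + \sum_(i < N) e / N.+1%:R)).
  apply: lerD; first exact: h0.
  apply: ler_sum => i _; apply: le_trans (hM i n (n1 i isT)).
  rewrite le_eqVlt; apply/orP; left; apply/eqP.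
  have Hsv := linear_subspaceB lH (Hs n) Hv.
  have LB : L2U (T i) (AT A T (s n) i - h i).
    by apply: linear_subspaceB (L2U_subspace k (mT i)) _ _ => //; exact: AT_L2U.
  have e2 : ae_eq mu (T i) (AT A T (s n - v) i) (AT A T (s n) i - h i).
    apply: filterS2 (AB i _ _ (Hs n) Hv) (wA_ae (@oT i) (@bT i) (wv i)) => x h1 h2 Dx.
    rewrite h1//; change (AT A T (s n) i x - wA A (T i) v x = AT A T (s n) i x - h i x).
    by rewrite h2.
  by apply: ipU_ae_eq => //; exact: AT_L2U.
by rewrite sumr_const card_ord -mulrS -[leLHS]mulr_natr divfK ?pnatr_eq0.
Qed.

End Mesh.

(** * Traces and their minimal extensions *)

Section Trace.
Context (R : realType) (d : nat) (k : Ukind) (A : diffop R d k).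
Local Notation E := 'rV[R]_d.
Local Notation U := 'M[R]_(Urows k d, Ucols k d).
Local Notation mu := (lebesgue_rV R d).
Context (Omega : set E) (oO : open Omega) (bO : bounded_set Omega).
Context (N : nat) (T : 'I_N -> set E).
Hypothesis oT : forall i, open (T i).
Hypothesis TO : forall i, T i `<=` Omega.
Hypothesis disjT : forall i j, i != j -> T i `&` T j = set0.

Hypothesis nullO : {ae mu, forall x, Omega x -> exists i, T i x}.

Let mO : measurable Omega := open_rV_measurable oO.
Let mT i : measurable (T i) := open_rV_measurable (@oT i).

Let bT i : bounded_set (T i).
Proof. by have [M [Mr h]] := bO; exists M; split=> // x Mx y /TO; exact: h. Qed.

Let L2U_TO i (w : E -> U) : L2U Omega w -> L2U (T i) w.
Proof. exact: L2U_elem. Qed.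

Let pH := formAT_psd A oO bO oT TO.

(** This puts the test functions into every admissible [HtA]. The weak derivative of [phi] is the
    classical one, so the pairing vanishes by the definition of the weak adjoint derivative of
    [w]. *)
Lemma test_H0A (phi : E -> R) : test Omega phi -> H0A A Omega phi.
Proof.
move=> tp; have sp := test_smooth tp.
have Hphi : HA A Omega phi.
  by split; [exact: test_L2|exists (applyA A phi); exact: is_weakA_smooth].
split => //; apply/funext => w; rewrite /gammaG; case: asboolP => // -[Lw ww].
have [LA wE] := wAs_weak ww; have [Lp [g pg]] := Hphi.
have [LwA _] := wA_weak Hphi.2.
have sA := is_weakA_smooth A oO bO sp.
rewrite (psd_sym (L2_psd mO) Lp LA) -wE// (psd_sym (L2U_psd k mO) LwA Lw).
apply/eqP; rewrite subr_eq0; apply/eqP.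
exact: (ipU_ae_eq mO Lw Lw LwA sA.1 (aeW _ (fun _ _ => erefl)) (wA_ae oO bO sA)).
Qed.

Lemma sum_patch_in (f : E -> R) i x : T i x -> \sum_j (f \_ (T j)) x = f x.
Proof.
move=> Tx; rewrite (bigD1 i)//= patchE mem_set// big1 ?addr0// => j ji.
rewrite patchE; case: ifPn => // /set_mem Tjx.
have : (T j `&` T i) x by [].
by rewrite disjT.
Qed.

Lemma sum_patch_out (f : E -> R) x : (forall i, ~ T i x) -> \sum_j (f \_ (T j)) x = 0.
Proof.
move=> Tx; rewrite big1// => j _; rewrite patchE; case: ifPn => // /set_mem Tjx.
by have := Tx j Tjx.
Qed.

Lemma sum_Rintegral_elem (f : E -> R) : mu.-integrable Omega (EFin \o f) ->
  \sum_i \int[mu]_(x in T i) f x = \int[mu]_(x in Omega) (\sum_i (f \_ (T i)) x).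
Proof.
move=> fi; rewrite Rintegral_sum//.
  by apply: eq_bigr => i _; rewrite (Rintegral_patch _ (@TO i)).
by move=> i _; apply: integrable_patch => //; exact: integrableS fi.
Qed.

(** Equality rests on the elements exhausting [Omega] up to a null set, which lets elementwise
    identities be added up to an identity on [Omega]. *)
Lemma sum_Rintegral_elem_eq (f : E -> R) : mu.-integrable Omega (EFin \o f) ->
  \int[mu]_(x in Omega) f x = \sum_i \int[mu]_(x in T i) f x.
Proof.
move=> fi; rewrite sum_Rintegral_elem//; apply: (ae_eq_Rintegral mO).
- by apply/measurable_EFinP; exact: measurable_int fi.
- apply/measurable_EFinP.
  rewrite (_ : _ \o _ = (fun x => \sum_i ((f \_ (T i)) x)%:E)%E); last first.
    by apply/funext => x; rewrite /= -sumEFin.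
  apply: emeasurable_sum => i; apply: (measurable_int mu).
  by apply: integrable_patch => //; exact: integrableS fi.
- by apply: filterS nullO => x h /h[i Ti]; rewrite (sum_patch_in f Ti).
Qed.

Lemma sum_Rintegral_elem_le (f : E -> R) : mu.-integrable Omega (EFin \o f) ->
  (forall x, 0 <= f x) ->
  \sum_i \int[mu]_(x in T i) f x <= \int[mu]_(x in Omega) f x.
Proof.
move=> fi f0; rewrite sum_Rintegral_elem//; apply: le_Rintegral => //.
  rewrite (_ : _ \o _ = (fun x => \sum_i ((f \_ (T i)) x)%:E)%E); last first.
    by apply/funext => x; rewrite /= -sumEFin.
  apply: integrable_sum => // i _; apply: integrable_patch => //.
  exact: integrableS fi.
move=> x _; have [[i Ti]|nT] := pselect (exists i, T i x).
  by rewrite (sum_patch_in f Ti).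
by rewrite sum_patch_out// => i Ti; apply: nT; exists i.
Qed.

Lemma ipT_family_psd : psd_form [set w : 'I_N -> E -> U | forall i, L2U (T i) (w i)]
  (fun w z => ipT T w z).
Proof.
apply: (psd_form_sum (b := fun i (w z : 'I_N -> E -> U) => ipU (T i) (w i) (z i))).
  split; first by move=> i; case: (L2U_subspace k (mT i)).
  by move=> a w z Lw Lz i; apply: (L2U_subspace k (mT i)).2.
move=> i; apply: (psd_form_preim (f := fun w : 'I_N -> E -> U => w i)
  (S' := L2U (T i))) => //; last exact: L2U_psd.
split; first by move=> j; case: (L2U_subspace k (mT j)).
by move=> a w z Lw Lz j; apply: (L2U_subspace k (mT j)).2.
Qed.

Variable HtA : set (E -> R).
Hypothesis HtA_sub : HtA `<=` HAT A Omega T.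

(** Cauchy-Schwarz in each of the two pairings and once more in the plane. *)
Lemma gammaS_le w v : HAs A Omega w -> HtA v ->
  `|gammaS A Omega T HtA w v| <= normAs A Omega w * normAT A Omega T v.
Proof.
move=> [Lw ww] Vv; have [Lv wv] := HtA_sub Vv.
rewrite /gammaS asboolT//; apply: le_trans (ler_normB _ _) _.
have [LA _] := wAs_weak ww.
have c1 := psd_cauchy (L2_psd mO) LA Lv.
have c2 : `|ipT T (fun=> w) (AT A T v)| <= _ :=
  psd_cauchy ipT_family_psd (fun i => L2U_TO i Lw) (fun i => AT_L2U i (HtA_sub Vv)).
apply: le_trans (lerD c1 c2) _.
have nw : psd_norm (fun w z => ipT T w z) (fun=> w) <= norm2U Omega w.
  rewrite ler_wsqrtr//; apply: sum_Rintegral_elem_le; first exact: integrable_frob.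
  by move=> x; exact: frob_ge0.
apply: (@le_trans _ _ (norm2 Omega (wAs A Omega w) * norm2 Omega v +
    norm2U Omega w * normT T (AT A T v))).
  by rewrite lerD2l ler_wpM2r ?sqrtr_ge0.
by rewrite /normAs (addrC (norm2U _ _ ^+ 2)); exact: cauchy_schwarz2.
Qed.

Hypothesis lHtA : linear_subspace HtA.
Hypothesis cHtA : forall (s : nat -> E -> R) v, (forall n, HtA (s n)) ->
  HAT A Omega T v -> normAT A Omega T (s n - v) @[n --> \oo] --> (0 : R) -> HtA v.
Hypothesis H0HtA : H0A A Omega `<=` HtA.

Let pV := psd_formS lHtA HtA_sub pH.

(* The extension of minimal norm is [- A z] on the elements, where [z] is the
   Riesz representative of [chi]; its adjoint derivative is [z] because [chi]
   vanishes on test functions. *)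
Lemma trace_extension (chi : (E -> R) -> R) (K : R) :
  (forall v, ~ HtA v -> chi v = 0) ->
  (forall a u v, HtA u -> HtA v -> chi (a *: u + v) = a * chi u + chi v) ->
  (forall phi, test Omega phi -> chi phi = 0) ->
  0 <= K -> (forall v, HtA v -> `|chi v| <= K * normAT A Omega T v) ->
  exists w, [/\ HAs A Omega w, gammaS A Omega T HtA w = chi & normAs A Omega w <= K].
Proof.
move=> chi0 chil chit K0 chiK.
have [v Vv|s Vs cs|z Vz zchi] := psd_riesz (K := K) pV chil.
- by rewrite -normATE; exact: chiK.
- have [v Hv vc] := HAT_complete oO bO oT TO (fun n => HtA_sub (Vs n)) cs.
  exists v => //; apply: (cHtA Vs Hv); apply/cvgr0Pnorm_lt => e e0.
  have [M hM] := vc _ (exprn_gt0 2 (divr_gt0 e0 (ltr0n R 2))).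
  exists M => // n /= Mn; have := hM n Mn.
  have Hsv : HAT A Omega T (s n - v).
    by apply: linear_subspaceB (psd_sub pH) _ _ => //; exact: HtA_sub.
  rewrite -(sqr_psd_norm pH)// -normATE ler_pXn2r ?nnegrE ?sqrtr_ge0//; last first.
    by rewrite divr_ge0// ltW.
  rewrite ger0_norm ?sqrtr_ge0// => /le_lt_trans; apply.
  by rewrite ltr_pdivrMr// ltr_pMr// ltr1n.
have [Lz wz] := HtA_sub Vz.
have Lg i : L2U (T i) (AT A T z i) := AT_L2U i (HtA_sub Vz).
(* Outside the elements every patch is zero, so [w] takes the value [0], which lies in [U]. *)
pose w : E -> U := fun x => \matrix_(a, b)
  (- \sum_i ((fun y => AT A T z i y a b) \_ (T i)) x).
have wE i x : T i x -> w x = - AT A T z i x.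
  move=> Tx; apply/matrixP => a b; rewrite !mxE; congr (- _).
  rewrite (bigD1 i)//= patchE mem_set// big1 ?addr0// => j ji.
  rewrite patchE; case: ifPn => // /set_mem Tjx.
  by have : (T j `&` T i) x by []; rewrite disjT.
have w0 x : (forall i, ~ T i x) -> w x = 0.
  move=> nT; apply/matrixP => a b; rewrite !mxE big1 ?oppr0// => j _.
  by rewrite patchE; case: ifPn => // /set_mem /(nT j).
have Lw : L2U Omega w.
  split => [a b|x Ox]; last first.
    have [[i Ti]|nT] := pselect (exists i, T i x).
      rewrite (wE i)// -scaleN1r; apply: linear_subspaceZ; first exact: inU_subspace.
      exact: (Lg i).2.
    rewrite w0; first by case: (inU_subspace R k d).
    by move=> i Ti; apply: nT; exists i.
  rewrite (_ : (fun x => _) =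
      (fun x => \sum_i (- 1) * ((fun y => AT A T z i y a b) \_ (T i)) x)).
    apply: L2_sum => // i; have [mg g2] := (Lg i).1 a b; split.
      by apply/measurable_restrict => //; rewrite setIidr//; exact: TO.
    have := integrable_patch mO (mT i) g2; apply: eq_integrable => // x _ /=.
    by rewrite !patchE; case: ifP => // _; rewrite expr0n.
  by apply/funext => x; rewrite mxE -mulr_sumr mulN1r.
have ipOw w' : L2U Omega w' -> ipU Omega w w' = - ipT T (AT A T z) (fun=> w').
  move=> Lw'; rewrite /ipU sum_Rintegral_elem_eq; last exact: integrable_frob.
  - rewrite /ipT -sumrN; apply: eq_bigr => i _.
    rewrite -mulN1r -RintegralZl//; last exact: integrable_frob (L2U_TO i Lw').
    apply: eq_Rintegral => x; rewrite inE => Tx.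
    by rewrite (wE i)// -scaleN1r frobZl.
have ipTw w' : (forall i, L2U (T i) (w' i)) ->
    ipT T (fun=> w) w' = - ipT T (AT A T z) w'.
  move=> Lw'; rewrite /ipT -sumrN; apply: eq_bigr => i _.
  rewrite /ipU -mulN1r -RintegralZl//; last exact: integrable_frob.
  apply: eq_Rintegral => x; rewrite inE => Tx.
  by rewrite (wE i)// -scaleN1r frobZl.
(* The Riesz identity at [phi], where [chi] vanishes, reads
   [(z, phi) = - (A z, A phi)_T = (w, A phi)]. *)
have weakw : is_weakAs A Omega w z.
  split => // phi tp; have Vp : HtA phi by apply: H0HtA; exact: test_H0A.
  have := zchi _ Vp; rewrite (chit _ tp) /formAT => /eqP.
  rewrite addr_eq0 => /eqP ->.
  have Lp : L2U Omega (applyA A phi) by apply: smooth_applyA_L2U => //; exact: test_smooth tp.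
  rewrite ipOw//; congr (- _); apply: eq_bigr => i _.
  have pi := wA_ae (@oT i) (@bT i) (is_weakA_smooth A (@oT i) (@bT i) (test_smooth tp)).
  apply: (ipU_ae_eq (mT i) (Lg i) (Lg i) (L2U_TO i Lp) (AT_L2U i (HtA_sub Vp))
    (aeW _ (fun _ _ => erefl))).
  by apply: filterS pi => x h Tx; rewrite -h.
have Aw : ae_eq mu Omega (wAs A Omega w) z by exact: wAs_ae.
have [LAw _] : is_weakAs A Omega w (wAs A Omega w) by apply: wAs_weak; exists z.
have HAsw : HAs A Omega w by split => //; exists z.
have gw : gammaS A Omega T HtA w = chi.
  apply/funext => v; rewrite /gammaS; case: asboolP => [Vv|/chi0//].
  have [Lv wv] := HtA_sub Vv.
  rewrite ipTw ?opprK; last by move=> i; exact: AT_L2U (HtA_sub Vv).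
  rewrite -zchi// /formAT; congr (_ + _).
  exact: (sqip_ae_eq mO LAw Lz Lv Lv Aw (aeW _ (fun _ _ => erefl))).
exists w; split => //.
(* Isometry: up to sign [w] carries [A z] as its value, and [z] as its adjoint derivative. *)
have nE : normAs A Omega w = normAT A Omega T z.
  rewrite /normAs /normAT /norm2U /norm2 /normT !sqr_sqrtr ?ip_ge0 ?ipU_ge0 ?ipT_ge0//.
  rewrite addrC; congr (Num.sqrt (_ + _)).
    exact: (sqip_ae_eq mO LAw Lz LAw Lz Aw Aw).
  rewrite ipOw//; have -> : ipT T (AT A T z) (fun=> w) = ipT T (fun=> w) (AT A T z).
    exact: (psd_sym ipT_family_psd Lg (fun i => L2U_TO i Lw)).
  by rewrite ipTw ?opprK.
(* [|| z ||^2 = chi z <= K || z ||], divided by [|| z ||] when it is positive. *)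
rewrite nE; have [->//|nz] := eqVneq (normAT A Omega T z) 0.
have nz0 : 0 < normAT A Omega T z by rewrite lt_def nz sqrtr_ge0.
have := chiK _ Vz; rewrite -zchi//.
rewrite -(sqr_psd_norm pH (HtA_sub Vz)) -normATE ger0_norm ?sqr_ge0//.
by rewrite expr2 ler_pM2r.
Qed.

Lemma normAs_ge0 w : 0 <= normAs A Omega w. Proof. exact: sqrtr_ge0. Qed.

Lemma normS_le chi w : HAs A Omega w -> gammaS A Omega T HtA w = chi ->
  normS A Omega T HtA chi <= normAs A Omega w.
Proof.
move=> Hw gw; apply: ge_inf; last by exists w.
by exists 0 => _ [w' _ <-]; exact: normAs_ge0.
Qed.

(** The bound [gammaS_le] holds for each extension; dividing by the norm of [v] lets the infimum be
    taken. If that norm is zero, a single extension already gives zero. *)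
Lemma trace_le_normS chi v : HAsS A Omega T HtA chi -> HtA v ->
  `|chi v| <= normS A Omega T HtA chi * normAT A Omega T v.
Proof.
move=> [w0 Hw0 gw0] Vv.
have [n0|n0] := eqVneq (normAT A Omega T v) 0.
  by have := gammaS_le Hw0 Vv; rewrite gw0 n0 !mulr0.
have nv : 0 < normAT A Omega T v by rewrite lt_def n0 sqrtr_ge0.
rewrite -ler_pdivrMr//; apply: lb_le_inf; first by exists (normAs A Omega w0), w0.
move=> _ [w [Hw gw] <-]; rewrite ler_pdivrMr//.
by have := gammaS_le Hw Vv; rewrite gw.
Qed.

(** What [trace_extension] asks of a functional besides boundedness. Traces vanish on test functions
    because the elementwise derivatives of [phi] agree a.e. with the classical one and the
    elementwise integrals add up. *)
Lemma traceP chi : HAsS A Omega T HtA chi ->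
  [/\ forall v, ~ HtA v -> chi v = 0,
      forall a u v, HtA u -> HtA v -> chi (a *: u + v) = a * chi u + chi v &
      forall phi, test Omega phi -> chi phi = 0].
Proof.
move=> [w [Lw ww] <-]; have [LA wE] := wAs_weak ww; split.
- by move=> v nV; rewrite /gammaS asboolF.
- move=> a u v Vu Vv.
  have Vuv : HtA (a *: u + v) by exact: lHtA.2.
  have [[Lu wu] [Lv wv]] := (HtA_sub Vu, HtA_sub Vv).
  have pL := L2_psd mO.
  have LAT x : HtA x -> forall i, L2U (T i) (AT A T x i).
    by move=> Vx i; exact: AT_L2U (HtA_sub Vx).
  have Lwi i : L2U (T i) w by exact: (L2U_TO i Lw).
  have e1 : ip Omega (wAs A Omega w) (a *: u + v) =
      a * ip Omega (wAs A Omega w) u + ip Omega (wAs A Omega w) v.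
    rewrite (psdDr pL _ Lv LA) ?(psdZr pL a Lu LA)//.
    exact: linear_subspaceZ (L2_subspace mO) Lu.
  have e2 : ipT T (fun=> w) (AT A T (a *: u + v)) =
      a * ipT T (fun=> w) (AT A T u) + ipT T (fun=> w) (AT A T v).
    rewrite /ipT mulr_sumr -big_split; apply: eq_bigr => i _ /=.
    have pU := L2U_psd k (mT i).
    rewrite (psd_sym pU (Lwi i) (LAT _ Vu i)) (psd_sym pU (Lwi i) (LAT _ Vv i)).
    rewrite -(psd_lin pU a (LAT _ Vu i) (LAT _ Vv i) (Lwi i)).
    rewrite (psd_sym pU (Lwi i) (LAT _ Vuv i)).
    apply: (ipU_ae_eq (mT i) (LAT _ Vuv i) _ (Lwi i) (Lwi i)
      (AT_lin oO bO oT TO i a (HtA_sub Vu) (HtA_sub Vv)) (aeW _ (fun _ _ => erefl))).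
    exact: (L2U_subspace k (mT i)).2 (LAT _ Vu i) (LAT _ Vv i).
  have g x : HtA x -> gammaS A Omega T HtA w x =
      ip Omega (wAs A Omega w) x - ipT T (fun=> w) (AT A T x).
    by move=> Vx; rewrite /gammaS asboolT.
  rewrite (g _ Vuv) (g _ Vu) (g _ Vv).
  rewrite e1.
  rewrite e2.
  move: (ip Omega _ u) (ip Omega _ v) (ipT _ _ (AT A T u)) (ipT _ _ (AT A T v)) => x1 x2 x3 x4.
  by rewrite mulrBr opprD addrACA.
- move=> phi tp; have Vp : HtA phi by apply: H0HtA; exact: test_H0A.
  rewrite /gammaS asboolT// -wE//; apply/eqP; rewrite subr_eq0; apply/eqP.
  have sp := test_smooth tp; have Lp := smooth_applyA_L2U A mO bO sp.
  rewrite /ipU sum_Rintegral_elem_eq; last exact: integrable_frob.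
  apply: eq_bigr => i _; have Lwi : L2U (T i) w by exact: (L2U_TO i Lw).
  have pi := wA_ae (@oT i) (@bT i) (is_weakA_smooth A (@oT i) (@bT i) sp).
  apply: (ipU_ae_eq (mT i) Lwi Lwi (L2U_TO i Lp) (AT_L2U i (HtA_sub Vp))
    (aeW _ (fun _ _ => erefl))).
  by apply: filterS pi => x h Tx; rewrite -h.
Qed.

End Trace.

(** * Polyhedral meshes of Lipschitz domains *)

Section Geometry.
Context (R : realType).

Lemma continuous_frob d (a : 'rV[R]_d) : continuous (fun x : 'rV[R]_d => frob a x).
Proof.
rewrite (_ : (fun x => _) = \sum_i \sum_j (fun x : 'rV[R]_d => a i j * x i j)); last first.
  by apply/funext => x; rewrite fct_sumE; apply: eq_bigr => i _; rewrite fct_sumE.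
have cD (f g : 'rV[R]_d -> R) : continuous f -> continuous g -> continuous (f + g).
  by move=> cf cg x; apply: continuousD; [exact: cf|exact: cg].
have c0 : continuous (0 : 'rV[R]_d -> R) by exact: (@cst_continuous _ _ (0 : R)).
apply: (big_ind (fun f : 'rV[R]_d -> R => continuous f)); [exact: c0|exact: cD|].
move=> i _.
apply: (big_ind (fun f : 'rV[R]_d -> R => continuous f)); [exact: c0|exact: cD|].
move=> j _ x.
by apply: continuousM; [exact: cst_continuous|exact: coord_continuous].
Qed.

Lemma frob_rV_cons n (a : 'rV[R]_n.+1) t y : frob a (rV_cons (t, y)) =
  a ord0 ord0 * t + frob (\row_j a ord0 (lift ord0 j)) y.
Proof.
rewrite /frob !big_ord1 big_ord_recl !mxE unlift_none; congr (_ + _).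
by apply: eq_bigr => j _; rewrite !mxE liftK.
Qed.

Lemma measurable_hyperplane n (a : 'rV[R]_n) (c : R) :
  measurable [set x : 'rV[R]_n | frob a x = c].
Proof.
have := continuous_rV_measurable (@continuous_frob n a) measurableT (measurable_set1 c).
by rewrite setTI.
Qed.

(** Induction on the dimension through sections. If a later coefficient is nonzero, every section is
    a hyperplane one dimension lower; otherwise the sections are empty except at one value of the
    first coordinate. *)
Lemma hyperplane_null n (a : 'rV[R]_n) (c : R) : a != 0 ->
  lebesgue_rV R n [set x | frob a x = c] = 0%E.
Proof.
elim: n a c => [|n IH] a c a0; first by rewrite (thinmx0 a) eqxx in a0.
pose a' : 'rV[R]_n := \row_j a ord0 (lift ord0 j).
pose B := @rV_cons R n @^-1` [set x : 'rV[R]_n.+1 | frob a x = c].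
have mB : measurable B.
  rewrite -[B]setTI; apply: measurable_rV_cons => //; exact: measurable_hyperplane.
have xB t : xsection B t = [set y | frob a' y = c - a ord0 ord0 * t].
  apply/seteqP; split => y /=; rewrite /xsection /= inE /B /= frob_rV_cons -/a'.
    by move=> <-; rewrite addrC addKr.
  by move=> ->; rewrite addrC subrK.
have -> : lebesgue_rV R n.+1 [set x | frob a x = c] =
  (\int[@lebesgue_measure R]_t (lebesgue_rV R n \o xsection B) t)%E by [].
have [a'0|a'0] := eqVneq a' 0; last first.
  by apply: integral0_eq => t _ /=; rewrite xB; exact: IH.
have a00 : a ord0 ord0 != 0.
  apply: contra_neq a0 => a00; apply/rowP => j; rewrite mxE.
  case: (unliftP ord0 j) => [i|] ->//.
  by have := congr1 (fun v : 'rV[R]_n => v ord0 i) a'0; rewrite !mxE.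
rewrite -(integral0 (@lebesgue_measure R) setT); apply: ae_eq_integral => //.
  exact: measurable_fun_xsection.
exists [set c / a ord0 ord0]; split; [exact: measurable_set1|exact: lebesgue_measure_set1|].
move=> t /=; apply: contra_notP => tc _; rewrite xB a'0.
rewrite (_ : mkset _ = set0) ?measure0//; apply/seteqP; split => // y /=.
rewrite frob0l => /esym/eqP; rewrite subr_eq0 => /eqP e; apply: tc.
by rewrite e mulrAC divff ?mul1r.
Qed.

Context (d : nat).
Local Notation mu := (lebesgue_rV R d).
Implicit Types D : set 'rV[R]_d.

Lemma near_halfspaces (p : seq ('rV[R]_d * R)) x :
  (forall h, h \in p -> frob h.1 x < h.2) ->
  \forall y \near x, forall h, h \in p -> closed_halfspace h y.
Proof.
elim: p => [|h p IH] hx; first by apply: (@filterE _ _ (nbhs_filter x)).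
have h1 : \forall y \near x, frob h.1 y < h.2.
  by have /cvgr_lt := @continuous_frob d h.1 x; apply; apply: hx; exact: mem_head.
have h2 := IH (fun q qp => hx q (@mem_behead _ (h :: p) q qp)).
apply: filterS2 h1 h2 => y y1 y2 q; rewrite inE => /predU1P[->|/y2//].
exact: ltW.
Qed.

(** If all constraints of a polytope containing [x] were strict, [x] would be interior to the
    closure, hence in [D] as there are no slits. So a boundary point lies on one of finitely many
    hyperplanes. *)
Lemma polyhedral_boundary_null D : polyhedral_domain D ->
  mu.-negligible (closure D `\` D).
Proof.
move=> [_ intD [P [P0 PE]]].
apply: (@negligibleS _ _ _ _ (\big[setU/set0]_(h <- flatten P | h.1 != 0)
    [set x | frob h.1 x = h.2])); last first.
  elim/big_ind : _ => [|B C|h h0]; [exact: negligible_set0|exact: negligibleU|].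
  apply/negligibleP; first exact: measurable_hyperplane.
  exact: hyperplane_null.
move=> x [cx Dx]; have := cx; rewrite PE => -[p pP px].
have [h hp hx] : exists2 h, h \in p & frob h.1 x = h.2.
  apply/not_notP => nh; apply: Dx; rewrite -intD.
  have : \forall y \near x, forall h, h \in p -> closed_halfspace h y.
    apply: near_halfspaces => h hp; rewrite lt_neqAle (px h hp) andbT.
    by apply/eqP => e; apply: nh; exists h.
  by apply: filterS => y yp; rewrite PE; exists p.
rewrite -bigcup_seq_cond; exists h => //=; apply/andP; split; last exact: P0 hp.
by apply/flattenP; exists p.
Qed.

Lemma mesh_ae_cover D N (T : 'I_N -> set 'rV[R]_d) : polyhedral_mesh D T ->
  {ae mu, forall x, D x -> exists i, T i x}.
Proof.
move=> [pT _ cD].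
have : {ae mu, forall x, forall i, ~ (closure (T i) `\` T i) x}.
  apply: filter_forall => i; have := polyhedral_boundary_null (pT i).
  by apply: negligibleS => x /= /contrapT.
apply: filterS => x h Dx; have : closure D x by exact: subset_closure.
rewrite cD => -[i _ ix]; exists i; apply/not_notP => nT.
by apply: (h i).
Qed.

(* A boundary point [x0] lies on or below the graph of [g], so that
   [x0 - t nu] is exterior to [D] for small [t > 0]. *)
Lemma lipschitz_interior_closure D : lipschitz_boundary D -> (closure D)° `<=` D.
Proof.
move=> lip x0 ix0; apply/not_notP => nD.
have cx0 : closure D x0 by exact: interior_subset.
have [nu [r [L [g [nu1 r0 gL gnu gD]]]]] := lip x0 (conj cx0 nD).
have gx0 : frob nu x0 <= g x0.
  by rewrite leNgt; apply/negP => h; apply: nD; apply/(gD x0 (ballxx _ r0)).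
have /nbhs_ballP[e /= e0 he] : nbhs x0 (closure D) by [].
pose m := Num.min e r; have m0 : 0 < m by rewrite lt_min e0.
have nup : 0 < `|nu| + 1 by rewrite ltr_wpDl.
(* Chosen so that [t *: nu] has norm below [m]. *)
pose t := m / (`|nu| + 1); have t0 : 0 < t by rewrite divr_gt0.
pose y0 := x0 - t *: nu.
have y0m : `|x0 - y0| < m.
  rewrite /y0 opprB addrC subrK normrZ gtr0_norm// /t mulrAC ltr_pdivrMr//.
  by rewrite ltr_pM2l// ltrDl.
have y0e : ball x0 e y0.
  by rewrite -ball_normE /ball_/= (lt_le_trans y0m)// ge_min lexx.
have y0r : ball x0 r y0.
  by rewrite -ball_normE /ball_/= (lt_le_trans y0m)// ge_min lexx orbT.
have hy0 : frob nu y0 - g y0 < 0.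
  have -> : g y0 = g x0 by rewrite /y0 -scaleNr gnu.
  rewrite frobC /y0 -scaleNr frobDl frobZl nu1 mulr1 frobC.
  by move: gx0 t0; move: (frob nu x0) (g x0) (t) => ? ? ?; lra.
have cg : continuous g.
  move=> x; apply/(@cvgrPdist_lt _ _ _ _ (nbhs_filter x)) => eps eps0.
  have L1 : 0 < `|L| + 1 by rewrite ltr_wpDl.
  near=> y; apply: le_lt_trans (gL _ _) _.
  apply: (@le_lt_trans _ _ ((`|L| + 1) * `|x - y|)).
    by rewrite ler_wpM2r// (le_trans (ler_norm L))// lerDl.
  rewrite -ltr_pdivlMl// mulrC; near: y.
  by apply: cvgr_dist_lt => //; rewrite divr_gt0.
have near0 : \forall y \near y0, frob nu y - g y < 0.
  exact: (cvgr_lt _ (cvgB (@continuous_frob d nu y0) (cg y0)) _ hy0).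
have nearr : \forall y \near y0, ball x0 r y.
  by apply: open_nbhs_nbhs; split => //; exact: ball_open.
(* [y0] is in the closure of [D], so points of [D] come arbitrarily close to it; yet all points near
   [y0] are below the graph. *)
have [y [Dy [yr y1]]] := he y0 y0e _ (filterI nearr near0).
by have /(gD y yr) := Dy; rewrite -subr_gt0 ltNge ltW.
Unshelve. all: by end_near. Qed.

(** The mesh relates closures only. An open element inside [closure D] lies in the interior of that
    closure, which the Lipschitz condition places in [D]. *)
Lemma mesh_sub D N (T : 'I_N -> set 'rV[R]_d) : lipschitz_boundary D ->
  polyhedral_mesh D T -> forall i, T i `<=` D.
Proof.
move=> lip [pT _ cD] i; apply: subset_trans (lipschitz_interior_closure lip).
have [[oT _ _ _] _ _] := pT i.
rewrite -open_subsetE//; apply: subset_trans (@subset_closure _ (T i)) _.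
by rewrite cD => x ix; exists i.
Qed.

End Geometry.

(** * Mixed discretisation *)

(** Fredholm alternative. Membership in the row space is tested on the columns of the cokernel,
    which symmetry turns into kernel vectors of [G]. *)
Lemma sym_solvable (F : fieldType) n (G : 'M[F]_n) (r : 'rV[F]_n) : G^T = G ->
  (forall y : 'rV_n, y *m G = 0 -> r *m y^T = 0) -> exists x : 'rV_n, x *m G = r.
Proof.
move=> symG h; suff /submxP[x ->] : (r <= G)%MS by exists x.
rewrite submxE; apply/eqP/trmx_inj; rewrite trmx_mul trmx0; apply/row_matrixP => i.
rewrite row_mul row0; apply: trmx_inj; rewrite trmx_mul trmxK trmx0; apply: h.
by rewrite -row_mul -[G in _ *m G]symG -trmx_mul mulmx_coker trmx0 row0.
Qed.

(* The functionals are only linear on [Vh], so the null part [z] of the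
   decomposition is handled explicitly. *)
Lemma saddle_exists (R : realType) (X : lmodType R) (Vh : set X)
    (Ph : set (X -> R)) (c : X -> X -> R) (l : X -> R)
    n (b : 'I_n -> X) m (p : 'I_m -> X -> R) :
  psd_form Vh c -> linear_subspace Ph ->
  (forall a u v, Vh u -> Vh v -> l (a *: u + v) = a * l u + l v) ->
  (forall psi, Ph psi -> forall a u v, Vh u -> Vh v ->
     psi (a *: u + v) = a * psi u + psi v) ->
  (forall i, Vh (b i)) -> (forall j, Ph (p j)) ->
  (forall v, Vh v -> exists (d : 'I_n -> R) (z : X),
     [/\ Vh z, v = \sum_i d i *: b i + z, forall u, Vh u -> c u z = 0,
         forall psi, Ph psi -> psi z = 0 & l z = 0]) ->
  (forall psi, Ph psi -> exists e : 'I_m -> R, psi = \sum_j e j *: p j) ->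
  (forall u psi, Vh u -> Ph psi -> (forall v, Vh v -> c u v + psi v = 0) ->
     (forall phi, Ph phi -> phi u = 0) -> l u = 0) ->
  exists u psi, [/\ Vh u, Ph psi, forall v, Vh v -> c u v + psi v = l v &
    forall phi, Ph phi -> phi u = 0].
Proof.
move=> pc lP ll lpsi Vb Pp spanV spanP uniq.
have lV := psd_sub pc; have V0 : Vh 0 by case: lV.
have lin0 (g : X -> R) : (forall a u v, Vh u -> Vh v -> g (a *: u + v) = a * g u + g v) ->
    g 0 = 0.
  by move=> gl; have := gl 1 0 0 V0 V0; rewrite scale1r addr0 mul1r; lra.
have lin_sum (g : X -> R) : (forall a u v, Vh u -> Vh v -> g (a *: u + v) = a * g u + g v) ->
    forall d : 'I_n -> R, Vh (\sum_i d i *: b i) /\ g (\sum_i d i *: b i) = \sum_i d i * g (b i).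
  move=> gl d; apply: (big_ind2 (fun (u : X) (r : R) => Vh u /\ g u = r))
    => [|u r v s [Vu ur] [Vv vs]|i _].
  - by split=> //; exact: lin0.
  - split; first exact: linear_subspaceD.
    by have := gl 1 u v Vu Vv; rewrite scale1r mul1r ur vs.
  - split; first exact: linear_subspaceZ.
    by have := gl (d i) (b i) 0 (Vb i) V0; rewrite !addr0 (lin0 _ gl) addr0.
have sumE (e : 'I_m -> R) v : (\sum_j e j *: p j) v = \sum_j e j * p j v.
  by rewrite fct_sumE.
have Psum (e : 'I_m -> R) : Ph (\sum_j e j *: p j) by exact: linear_subspace_sum.
(* Equations checked on the vectors [b j] extend to [Vh], because the null part [z] contributes
   nothing to either side. *)
have testV u psi g : Vh u -> Ph psi ->
    (forall a u v, Vh u -> Vh v -> g (a *: u + v) = a * g u + g v) ->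
    (forall z, Vh z -> (forall u, Vh u -> c u z = 0) -> (forall psi, Ph psi -> psi z = 0) ->
       l z = 0 -> g z = 0) ->
    (forall j, c u (b j) + psi (b j) = g (b j)) ->
    forall v, Vh v -> c u v + psi v = g v.
  move=> Vu Ppsi gl gz h v Vv; have [d [z [Vz vE cz pz lz]]] := spanV v Vv.
  have Vs := (lin_sum g gl d).1.
  have step (f : X -> R) : (forall a u v, Vh u -> Vh v -> f (a *: u + v) = a * f u + f v) ->
      f z = 0 -> f v = \sum_i d i * f (b i).
    move=> fl fz; have := fl 1 _ _ Vs Vz.
    by rewrite scale1r -vE mul1r fz addr0 (lin_sum f fl d).2.
  have cl a x y : Vh x -> Vh y -> c u (a *: x + y) = a * c u x + c u y.
    move=> Vx Vy; rewrite (psdDr pc)//; last exact: linear_subspaceZ.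
    by rewrite (psdZr pc).
  have -> := step _ cl (cz u Vu).
  have -> := step _ (lpsi _ Ppsi) (pz _ Ppsi).
  have -> := step _ gl (gz z Vz (fun x Vx => cz x Vx) (fun x Px => pz x Px) lz).
  rewrite -big_split; apply: eq_bigr => i _ /=.
  by rewrite -mulrDr h.
pose G11 : 'M[R]_n := \matrix_(i, j) c (b i) (b j).
pose G12 : 'M[R]_(n, m) := \matrix_(i, j) p j (b i).
pose G : 'M[R]_(n + m) := block_mx G11 G12 G12^T 0.
pose r : 'rV[R]_(n + m) := row_mx (\row_j l (b j)) 0.
have symG : G^T = G.
  rewrite /G tr_block_mx trmxK trmx0; congr block_mx.
  by apply/matrixP => i j; rewrite !mxE (psd_sym pc).
have mulG (y1 : 'rV[R]_n) (y2 : 'rV[R]_m) (u := \sum_i y1 ord0 i *: b i)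
    (psi := \sum_j y2 ord0 j *: p j) :
    row_mx y1 y2 *m G = row_mx (\row_j (c u (b j) + psi (b j))) (\row_j p j u).
  rewrite mul_row_block mulmx0 addr0; congr row_mx; apply/rowP => j; rewrite !mxE.
    rewrite /psi sumE /u (psd_suml pc)//; congr (_ + _).
      by apply: eq_bigr => i _; rewrite !mxE.
    by apply: eq_bigr => i _; rewrite !mxE.
  rewrite /u (lin_sum _ (lpsi _ (Pp j)) _).2.
  by apply: eq_bigr => i _; rewrite !mxE.
have hom u psi : Vh u -> Ph psi -> (forall j, c u (b j) + psi (b j) = 0) ->
    (forall j, p j u = 0) -> l u = 0.
  move=> Vu Ppsi h1 h2; apply: (uniq u psi) => //.
    apply: (testV u psi (fun=> 0)) => // a _ _ _ _; by rewrite mulr0 addr0.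
  by move=> phi /spanP[e ->]; rewrite sumE big1// => j _; rewrite h2 mulr0.
have [y|x xG] := sym_solvable (r := r) symG.
  (* A kernel vector of [G] is a solution of the homogeneous discrete system, on which [l] vanishes
     by [uniq]; this makes the right-hand side compatible. *)
  rewrite -[y]hsubmxK mulG -row_mx0 => /eq_row_mx[/rowP h1 /rowP h2].
  set u := (\sum_i _) in h1 h2; set psi := (\sum_j _) in h1.
  have Vu : Vh u := (lin_sum l ll _).1.
  have lu : l u = 0.
    apply: (hom u psi Vu (Psum _)) => j; first by have := h1 j; rewrite !mxE.
    by have := h2 j; rewrite !mxE.
  rewrite tr_row_mx mul_row_col mul0mx addr0; apply/matrixP => i j; rewrite !mxE.
  rewrite !ord1 -[RHS]lu (lin_sum l ll _).2; apply: eq_bigr => a _.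
  by rewrite !mxE mulrC.
move: xG; rewrite -[x]hsubmxK mulG => /eq_row_mx[/rowP h1 /rowP h2].
set u := (\sum_i _) in h1 h2; set psi := (\sum_j _) in h1.
have Vu : Vh u := (lin_sum l ll _).1.
exists u, psi; split=> //; first exact: Psum.
  apply: testV => //; first exact: Psum.
  by move=> j; have := h1 j; rewrite !mxE.
move=> phi /spanP[e ->]; rewrite sumE big1// => j _.
by have := h2 j; rewrite !mxE => ->; rewrite mulr0.
Qed.

Lemma ae_le_Rintegral d (T : measurableType d) (R : realType)
    (mu : {measure set T -> \bar R}) (D : set T) (f g : T -> R) : measurable D ->
  mu.-integrable D (EFin \o f) -> mu.-integrable D (EFin \o g) ->
  {ae mu, forall x, D x -> f x <= g x} ->
  \int[mu]_(x in D) f x <= \int[mu]_(x in D) g x.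
Proof.
move=> mD fi gi fg; rewrite -subr_ge0 -RintegralB//.
have mfg : measurable_fun D (fun x => g x - f x).
  by apply: measurable_funB; apply/measurable_EFinP;
    [exact: measurable_int gi|exact: measurable_int fi].
rewrite (ae_eq_Rintegral (g := fun x => `|g x - f x|) mD mfg).
- by apply: Rintegral_ge0 => x _; exact: normr_ge0.
- exact: measurableT_comp.
- by apply: filterS fg => x h /h; rewrite -subr_ge0 => /ger0_norm ->.
Qed.

(** * The coefficient tensor *)

Section Tensor.
Context (R : realType) (d : nat) (k : Ukind).
Local Notation E := 'rV[R]_d.
Local Notation U := 'M[R]_(Urows k d, Ucols k d).
Local Notation mu := (lebesgue_rV R d).
Context (Omega : set E) (C : E -> {linear U -> U}) (hC : spd_tensor Omega C).
Context (mO : measurable Omega) (D : set E) (mD : measurable D) (DO : D `<=` Omega).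
Local Notation Cw w := (fun x => C x (w x)).

(** Measurability of the tensor field is given for fixed arguments in [U]; expanding a field over
    fixed elements of [U] reduces to that case. *)
Lemma inU_decomp (w : U) : inU k d w ->
  w = \sum_(p : 'I_(Urows k d) * 'I_(Ucols k d)) w p.1 p.2 *: Uproj (delta_mx p.1 p.2).
Proof.
move=> wU; rewrite -Uproj_sum -[LHS](Uproj_id (UprojP R k d) wU); congr Uproj.
rewrite [LHS]matrix_sum_delta.
by rewrite (pair_bigA _ (fun i j => w i j *: delta_mx i j)).
Qed.

Lemma tensor_L2U (w : E -> U) : L2U D w -> L2U D (Cw w).
Proof.
case: hC => CU Cm [M CM] _ _ Lw; have [L wU] := Lw; split; last first.
  by move=> x Dx; apply: CU; [exact: DO|exact: wU].
move=> i j; have mCw : measurable_fun D (fun x => C x (w x) i j).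
  apply: (eq_measurable_fun (fun x => \sum_(p : 'I_(Urows k d) * 'I_(Ucols k d))
      w x p.1 p.2 * C x (Uproj (delta_mx p.1 p.2)) i j)).
    move=> x /set_mem Dx; rewrite [in RHS](inU_decomp (wU x Dx)) linear_sum summxE.
    by apply: eq_bigr => p _; rewrite linearZ mxE.
  apply: measurable_sum => p; apply: measurable_funM; first exact: (L _ _).1.
  exact: (measurable_funS mO DO (Cm _ i j (Uproj_in (UprojP R k d) _))).
split=> //; have fw := integrable_frob mD Lw Lw.
have [m2 foo] := integrableP _ _ _ (integrableZl mD `|M| fw).
apply/integrableP; split; first by apply/measurable_EFinP; exact: measurable_funX.
apply: le_lt_trans foo; apply: ae_ge0_le_integral => //.
- by apply/measurable_EFinP; apply: measurableT_comp => //; exact: measurable_funX.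
- exact: measurableT_comp.
apply: filterS CM => x h Dx; have {}h := h (DO Dx) (w x) (wU x Dx).
rewrite /= lee_fin ger0_norm ?sqr_ge0// normrM normr_id [X in _ * X]ger0_norm ?frob_ge0//.
apply: le_trans (le_trans h _).
  rewrite /frob (bigD1 i)//= (bigD1 j)//= -expr2 -addrA lerDl addr_ge0//.
    by apply: sumr_ge0 => b _; rewrite -expr2 sqr_ge0.
  by apply: sumr_ge0 => a _; apply: sumr_ge0 => b _; rewrite -expr2 sqr_ge0.
by apply: ler_wpM2r; [exact: frob_ge0|exact: ler_norm].
Qed.

Lemma tensor_psd : psd_form (@L2U R d k D) (fun w z => ipU D (Cw w) z).
Proof.
have pU := L2U_psd k mD; have LC := tensor_L2U; split; first exact: L2U_subspace.
- move=> a w w' z Lw Lw' Lz.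
  rewrite -(psd_lin pU a (LC _ Lw) (LC _ Lw') Lz); congr ipU.
  by apply/funext => x; rewrite linearP.
- move=> w z Lw Lz; rewrite [RHS](psd_sym pU)//; last exact: LC.
  case: hC => _ _ _ sC _; apply: ae_eq_Rintegral => //.
  + by apply/measurable_EFinP; exact: measurable_int (integrable_frob mD (LC _ Lw) Lz).
  + by apply/measurable_EFinP; exact: measurable_int (integrable_frob mD Lw (LC _ Lz)).
  + by apply: filterS sC => x h Dx; apply: h; [exact: DO|exact: Lw.2|exact: Lz.2].
- move=> w Lw; case: hC => _ _ _ _ [c c0 Cc].
  have i1 := integrable_frob mD (LC _ Lw) Lw.
  have := @ae_le_Rintegral _ _ _ mu D (cst 0) (fun x => frob (C x (w x)) (w x)) mD.
  rewrite Rintegral_cst// mul0r; apply=> //; first exact: integrable0.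
  apply: filterS Cc => x h Dx; apply: le_trans (h (DO Dx) (w x) (Lw.2 x Dx)).
  by rewrite mulr_ge0 ?frob_ge0// ltW.
Qed.

End Tensor.

Section TensorBounds.
Context (R : realType) (d : nat) (k : Ukind).
Local Notation E := 'rV[R]_d.
Local Notation U := 'M[R]_(Urows k d, Ucols k d).
Local Notation mu := (lebesgue_rV R d).
Context (Omega : set E) (C : E -> {linear U -> U}) (hC : spd_tensor Omega C).
Context (mO : measurable Omega).

(** The constant is fixed before [D], hence common to all elements of all meshes. *)
Lemma tensor_coercive : exists2 c : R, 0 < c & forall D (w : E -> U),
  measurable D -> D `<=` Omega -> L2U D w ->
  c * ipU D w w <= ipU D (fun x => C x (w x)) w.
Proof.
case: (hC) => _ _ _ _ [c c0 Cc]; exists c => // D w mD DO Lw.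
have fw := integrable_frob mD Lw Lw.
rewrite -RintegralZl//; apply: ae_le_Rintegral => //.
- exact: (integrableZl mD _ fw).
- exact: integrable_frob (tensor_L2U hC mO mD DO Lw) Lw.
- by apply: filterS Cc => x h Dx; apply: h; [exact: DO|exact: Lw.2].
Qed.

(** [2 (C w : w) <= |C w|^2 + |w|^2] and [|C w|^2 <= M |w|^2] give the factor [(|M| + 1) / 2]; the
    absolute value makes it nonnegative. *)
Lemma tensor_bounded : exists2 M : R, 0 <= M & forall D (w : E -> U),
  measurable D -> D `<=` Omega -> L2U D w ->
  ipU D (fun x => C x (w x)) w <= M * ipU D w w.
Proof.
case: (hC) => _ _ [M CM] _ _; exists ((`|M| + 1) / 2).
  by rewrite divr_ge0// addr_ge0.
move=> D w mD DO Lw; have fw := integrable_frob mD Lw Lw.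
rewrite -RintegralZl//; apply: ae_le_Rintegral => //.
- exact: integrable_frob (tensor_L2U hC mO mD DO Lw) Lw.
- exact: (integrableZl mD _ fw).
apply: filterS CM => x h Dx; have {}h := h (DO _ Dx) (w x) (Lw.2 x Dx).
have fp := frob_psd R (Urows k d) (Ucols k d).
have := frob_ge0 (C x (w x) - w x).
rewrite (psdBl fp)// !(psdBr fp)// [frob (w x) (C x (w x))]frobC.
have := ler_wpM2r (frob_ge0 (w x)) (ler_norm M).
move: h; move: (frob _ _) (frob _ _) (frob _ _) => a b c; move: `|M| => m.
by lra.
Qed.

End TensorBounds.

Section TensorMesh.
Context (R : realType) (d : nat) (k : Ukind) (A : diffop R d k).
Local Notation E := 'rV[R]_d.
Local Notation U := 'M[R]_(Urows k d, Ucols k d).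
Local Notation mu := (lebesgue_rV R d).
Context (Omega : set E) (oO : open Omega) (bO : bounded_set Omega).
Context (N : nat) (T : 'I_N -> set E).
Hypothesis oT : forall i, open (T i).
Hypothesis TO : forall i, T i `<=` Omega.
Context (C : E -> {linear U -> U}) (hC : spd_tensor Omega C).

Let mO : measurable Omega := open_rV_measurable oO.
Let mT i : measurable (T i) := open_rV_measurable (@oT i).

Definition tensor_form u v :=
  ipT T (fun i x => C x (AT A T u i x)) (AT A T v).

Lemma tensor_form_psd : psd_form (HAT A Omega T) tensor_form.
Proof.
apply: (psd_form_sum (b := fun i u v => ipU (T i) (fun x => C x (AT A T u i x)) (AT A T v i))).
  exact: HAT_subspace.
move=> i; have pC := tensor_psd hC mO (mT i) (@TO i).
have LC w := tensor_L2U hC mO (mT i) (@TO i) (w := w).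
have LA v := AT_L2U i (v := v) (A := A) (Omega := Omega) (T := T).
split; first exact: HAT_subspace.
- move=> a x y z Hx Hy Hz; rewrite -(psd_lin pC a (LA _ Hx) (LA _ Hy) (LA _ Hz)).
  have L1 := LA _ ((HAT_subspace A oO bO oT TO).2 a _ _ Hx Hy).
  have L2 := (L2U_subspace k (mT i)).2 a _ _ (LA _ Hx) (LA _ Hy).
  apply: (ipU_ae_eq (mT i) (LC _ L1) (LC _ L2) (LA _ Hz) (LA _ Hz) _ (aeW _ (fun _ _ => erefl))).
  by apply: filterS (AT_lin oO bO oT TO i a Hx Hy) => x0 h /h ->.
- by move=> x y /LA ? /LA ?; apply: (psd_sym pC).
- by move=> x /LA ?; apply: (psd_ge0 pC).
Qed.

End TensorMesh.

(** * Abstract quasi-optimality with a Fortin operator *)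

Section QuasiOptimal.
Context (R : realType) (X : lmodType R) (V Vh : set X) (q a c : X -> X -> R).
Hypotheses (pq : psd_form V q) (pa : psd_form V a) (pc : psd_form V c).
Hypotheses (lVh : linear_subspace Vh) (VhV : Vh `<=` V).
Context (c0 M CPF CF : R).
Hypotheses (c0gt0 : 0 < c0) (Mge0 : 0 <= M) (CPFge0 : 0 <= CPF) (CFge0 : 0 <= CF).
Hypothesis c_coercive : forall x, V x -> c0 * a x x <= c x x.
Hypothesis c_bounded : forall x, V x -> c x x <= M * a x x.
Context (Ph : set (X -> R)) (lPh : linear_subspace Ph).
Hypothesis Ph_lin : forall phi, Ph phi -> forall b x y, V x -> V y ->
  phi (b *: x + y) = b * phi x + phi y.
Hypothesis discrete_PF : forall x, Vh x -> (forall phi, Ph phi -> phi x = 0) ->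
  Num.sqrt (q x x) <= CPF * Num.sqrt (a x x).
Context (F : X -> X).
Local Notation nrm := (psd_norm (fun x y => q x y + a x y)).
Hypothesis FVh : forall x, V x -> Vh (F x).
Hypothesis PhF : forall x phi, V x -> Ph phi -> phi (x - F x) = 0.
Hypothesis FC : forall x, V x -> nrm (F x) <= CF * nrm x.

Let pn := psd_formD pq pa.
Let lV := psd_sub pn.

Let PhB phi x y : Ph phi -> V x -> V y -> phi (x - y) = phi x - phi y.
Proof.
move=> Pp Vx Vy; have := Ph_lin Pp (-1) Vy Vx; rewrite scaleN1r mulN1r addrC => ->.
by rewrite addrC.
Qed.

Lemma fortin_eval phi x : Ph phi -> V x -> phi (F x) = phi x.
Proof.
move=> Pp Vx; have := PhF Vx Pp; rewrite PhB//; last exact/VhV/FVh.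
by move/eqP; rewrite subr_eq0 => /eqP.
Qed.

(** Only the quadratic form of [c] is bounded by hypothesis; Cauchy-Schwarz for [c] itself passes
    the same constant to the bilinear form. *)
Lemma form_bound x y : V x -> V y -> `|c x y| <= M * nrm x * nrm y.
Proof.
have b z : V z -> Num.sqrt (c z z) <= Num.sqrt M * nrm z.
  move=> Vz; rewrite -sqrtrM// ler_wsqrtr// (le_trans (c_bounded Vz))// ler_wpM2l//.
  by rewrite lerDr (psd_ge0 pq).
move=> Vx Vy; apply: (le_trans (psd_cauchy pc Vx Vy)).
have := ler_pM (sqrtr_ge0 _) (sqrtr_ge0 _) (b _ Vx) (b _ Vy).
by rewrite mulrACA -expr2 sqr_sqrtr// mulrA.
Qed.

Let nrmB x y : V x -> V y -> nrm (x - y) <= nrm x + nrm y.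
Proof.
move=> Vx Vy; have := psd_normZ pn (-1) Vy; rewrite normrN1 mul1r scaleN1r => <-.
by apply: (psd_normD pn) => //; rewrite -scaleN1r; exact: linear_subspaceZ.
Qed.

(** The discrete inequality gives [q e e <= CPF ^+ 2 * a e e]; adding [a e e] and using coercivity
    produces the factor. *)
Lemma discrete_kernel_bound e : Vh e -> (forall phi, Ph phi -> phi e = 0) ->
  nrm e ^+ 2 <= (CPF ^+ 2 + 1) / c0 * c e e.
Proof.
move=> Ve e0; have Vve := VhV Ve; rewrite (sqr_psd_norm pn)//.
have sa := psd_ge0 pa Vve; have sq := psd_ge0 pq Vve.
have h : q e e <= CPF ^+ 2 * a e e.
  rewrite -(sqr_sqrtr sq) -(sqr_sqrtr sa) -exprMn.
  have r0 : 0 <= CPF * Num.sqrt (a e e) by rewrite mulr_ge0 ?sqrtr_ge0.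
  by rewrite ler_pXn2r// ?nnegrE ?sqrtr_ge0//; exact: discrete_PF.
have cc := c_coercive Vve.
rewrite mulrAC ler_pdivlMr//; apply: (@le_trans _ _ ((CPF ^+ 2 + 1) * (c0 * a e e))).
  by rewrite mulrCA [leRHS]mulrC ler_wpM2r ?(ltW c0gt0)// mulrDl mul1r lerD2r.
by apply: ler_wpM2l => //; rewrite addr_ge0 ?sqr_ge0.
Qed.

(** [kappa] is the inverse coercivity constant on the discrete kernel. [K1] adds the factor [1 + CF]
    for [u - v0] to [kappa] times the bound on the residual. [K2] comes from the error equation at
    [F z]. *)
Let kappa := (CPF ^+ 2 + 1) / c0.
Let K1 := (1 + CF) + kappa * (M * (1 + CF) + 1).
Let K2 := CF * (M * K1 + 1).

(** The number [s] stands for the trace norm of [psi - eta]. The second conclusion bounds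
    [psi - psih] as a functional; the extension result later turns it into a bound in the trace
    norm. *)
Lemma quasi_optimal (l : X -> R) u uh v (psi psih eta : X -> R) (s : R) :
  V u -> Vh uh -> Vh v -> Ph psih -> Ph eta -> 0 <= s ->
  (forall x, V x -> `|psi x - eta x| <= s * nrm x) ->
  (forall x, V x -> c u x + psi x = l x) ->
  (forall x, Vh x -> c uh x + psih x = l x) ->
  (forall phi, Ph phi -> phi u = 0) -> (forall phi, Ph phi -> phi uh = 0) ->
  nrm (u - uh) <= K1 * (nrm (u - v) + s) /\
  forall z, V z -> `|psi z - psih z| <= (s + K2 * (nrm (u - v) + s)) * nrm z.
Proof.
move=> Vu Vuh Vv Ppsih Peta s0 psieta equ equh phiu phiuh.
have kappa0 : 0 <= kappa by rewrite divr_ge0 ?addr_ge0 ?sqr_ge0 ?ltW.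
have Vuv : V (u - v) by apply: linear_subspaceB => //; exact: VhV.
pose v0 := v + F (u - v); pose e := uh - v0; pose t := nrm (u - v).
have t0 : 0 <= t by exact: psd_norm_ge0.
have Vv0 : Vh v0 by apply: linear_subspaceD => //; exact: FVh.
have Ve : Vh e by exact: linear_subspaceB.
have Vuv0 : V (u - v0) by apply: linear_subspaceB => //; exact: VhV.
(* [phi v0 = phi v + phi (F (u - v)) = phi u = 0]: the correction restores the constraint that [v]
   may violate. *)
have phi_e phi : Ph phi -> phi e = 0.
  move=> Pp; rewrite PhB ?phiuh//; [|exact: VhV..].
  have := Ph_lin Pp 1 (VhV Vv) (VhV (FVh Vuv)).
  by rewrite scale1r mul1r fortin_eval// PhB ?phiu//; [move=> ->; lra|exact: VhV].
have n1 : nrm (u - v0) <= (1 + CF) * t.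
  rewrite /v0 opprD addrA mulrDl mul1r.
  by apply: (le_trans (nrmB Vuv (VhV (FVh Vuv)))); rewrite lerD2l FC.
have eqc x : Vh x -> c (u - uh) x = psih x - psi x.
  move=> Vx; have Vvx := VhV Vx; rewrite (psdBl pc)//; last exact: VhV.
  by have := equ _ Vvx; have := equh _ Vx; lra.
have ne0 : 0 <= nrm e by exact: psd_norm_ge0.
have n2 : nrm e <= kappa * (M * (1 + CF) * t + s).
  (* Both [psih] and [eta] vanish at [e]; inserting [eta e] exposes the approximation error
     [psi - eta]. *)
  have cee : c e e = c (u - v0) e + (psi e - eta e).
    have := eqc _ Ve; rewrite (phi_e _ Ppsih) (phi_e _ Peta) {2}/e.
    rewrite !(psdBl pc)//; try exact: VhV.
    by lra.
  have b1 := le_trans (ler_norm _) (form_bound Vuv0 (VhV Ve)).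
  have b2 := le_trans (ler_norm _) (psieta _ (VhV Ve)).
  have b3 : M * nrm (u - v0) * nrm e <= M * ((1 + CF) * t) * nrm e.
    by apply: ler_wpM2r => //; exact: ler_wpM2l.
  have b4 : nrm e ^+ 2 <= kappa * (M * (1 + CF) * t + s) * nrm e.
    apply: (le_trans (discrete_kernel_bound Ve phi_e)); rewrite -/kappa -mulrA.
    apply: ler_wpM2l => //; rewrite cee mulrDl.
    by apply: lerD => //; apply: (le_trans b1); rewrite -[M * (1 + CF) * t]mulrA.
  have [->|nz] := eqVneq (nrm e) 0.
    by rewrite mulr_ge0// addr_ge0// mulr_ge0// mulr_ge0// addr_ge0.
  by move: b4; rewrite expr2 ler_pM2r// lt_neqAle eq_sym nz.
have n3 : nrm (u - uh) <= K1 * (t + s).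
  have -> : u - uh = (u - v0) - e by rewrite /e opprB addrA subrK.
  apply: (le_trans (nrmB Vuv0 (VhV Ve))); apply: (le_trans (lerD n1 n2)).
  have h1 := mulr_ge0 (addr_ge0 ler01 CFge0) s0; have h2 := mulr_ge0 kappa0 t0.
  have h3 := mulr_ge0 (mulr_ge0 kappa0 (mulr_ge0 Mge0 (addr_ge0 ler01 CFge0))) s0.
  rewrite /K1; move: h1 h2 h3; by lra.
split=> // z Vz; have VFz := VhV (FVh Vz).
have Pd : Ph (psih - eta) by exact: linear_subspaceB.
(* By [fortin_eval] the value of [eta - psih] at [z] is that at [F z], which the error equation
   expresses through [u - uh]. *)
have -> : psi z - psih z = (psi z - eta z) - ((psi (F z) - eta (F z)) + c (u - uh) (F z)).
  rewrite (eqc _ (FVh Vz)) (fortin_eval Peta Vz) (fortin_eval Ppsih Vz).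
  by move: (psi z) (psih z) (eta z) (psi (F z)) => ? ? ? ?; lra.
apply: (le_trans (ler_normB _ _)); rewrite mulrDl; apply: lerD; first exact: psieta.
apply: (le_trans (ler_normD _ _)).
have Vuuh : V (u - uh) by apply: linear_subspaceB => //; exact: VhV.
apply: (le_trans (lerD (psieta _ VFz) (form_bound Vuuh VFz))).
rewrite -mulrDl; have h : s + M * nrm (u - uh) <= (M * K1 + 1) * (t + s).
  apply: (le_trans (lerD (lexx s) (ler_wpM2l Mge0 n3))).
  by rewrite [leRHS]mulrDl mul1r -mulrA [leLHS]addrC lerD2l lerDr.
have S0 : 0 <= (M * K1 + 1) * (t + s).
  by apply: le_trans h; rewrite addr_ge0// mulr_ge0// psd_norm_ge0.
apply: (@le_trans _ _ ((M * K1 + 1) * (t + s) * nrm (F z))).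
  by apply: ler_wpM2r => //; exact: psd_norm_ge0.
apply: (le_trans (ler_wpM2l S0 (FC Vz))).
by rewrite /K2 -/t mulrCA !mulrA.
Qed.
End QuasiOptimal.

(** * The discrete problem: uniqueness, existence, error estimate *)

Section Discrete.
Context (R : realType) (d : nat) (k : Ukind) (A : diffop R d k).
Local Notation E := 'rV[R]_d.
Local Notation U := 'M[R]_(Urows k d, Ucols k d).
Local Notation mu := (lebesgue_rV R d).
Context (Omega : set E) (oO : open Omega) (bO : bounded_set Omega).
Context (N : nat) (T : 'I_N -> set E).
Hypothesis oT : forall i, open (T i).
Hypothesis TO : forall i, T i `<=` Omega.
Hypothesis disjT : forall i j, i != j -> T i `&` T j = set0.
Hypothesis nullO : {ae mu, forall x, Omega x -> exists i, T i x}.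

Let mO : measurable Omega := open_rV_measurable oO.
Let mT i : measurable (T i) := open_rV_measurable (@oT i).
Let bT i : bounded_set (T i).
Proof. by have [M [Mr h]] := bO; exists M; split=> // x Mx y /TO; exact: h. Qed.

Let pA := ipT_AT_psd A oO bO oT TO.
Let pO := ipO_psd A oO bO oT TO.

(** Expansions in a finite-dimensional space hold only a.e., whereas [AT] depends on the
    representative; uniqueness of weak derivatives reconciles the two. *)
Lemma ae0_normAT z : HAT A Omega T z -> ae_eq mu Omega z (cst 0) -> normAT A Omega T z = 0.
Proof.
move=> Hz z0; have [Lz wz] := Hz.
have H0 : HAT A Omega T 0 := (HAT_subspace A oO bO oT TO).1; have [L0 w0] := H0.
have zz : ip Omega z z = 0 := ae_eq_sqip0 mO Lz z0.
rewrite normATE /psd_norm /formAT zz add0r.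
suff -> : ipT T (AT A T z) (AT A T z) = ipT T (AT A T 0) (AT A T 0).
  by rewrite (psd0l pA)// sqrtr0.
apply: eq_bigr => i _; have Lz0 : L2U (T i) (AT A T 0 i) := AT_L2U i H0.
have e : ae_eq mu (T i) (AT A T z i) (AT A T 0 i).
  apply: wA_ae => //; apply: (is_weakA_ae (mT i) (@bT i) _ _ _ (wA_weak (w0 i))).
  - exact: (L2_elem oO oT TO i L0).
  - exact: (L2_elem oO oT TO i Lz).
  - by apply: filterS z0 => x h /TO /h.
by have Lz1 := AT_L2U i Hz; exact: (ipU_ae_eq (mT i) Lz1 Lz0 Lz1 Lz0 e e).
Qed.

Variable HtA : set (E -> R).
Hypothesis HtA_sub : HtA `<=` HAT A Omega T.
Hypothesis lHtA : linear_subspace HtA.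
Hypothesis cHtA : forall (s : nat -> E -> R) v, (forall n, HtA (s n)) ->
  HAT A Omega T v -> normAT A Omega T (s n - v) @[n --> \oo] --> (0 : R) -> HtA v.
Hypothesis H0HtA : H0A A Omega `<=` HtA.
Local Notation HS := (HAsS A Omega T HtA).
Local Notation nS := (normS A Omega T HtA).
Local Notation nA := (normAT A Omega T).

(** The difference meets the hypotheses of [trace_extension]. Its membership in the trace space
    comes from the same extension instead of linearity of the trace operator. *)
Lemma trace_sub chi chi' (K : R) : HS chi -> HS chi' -> 0 <= K ->
  (forall v, HtA v -> `|chi v - chi' v| <= K * nA v) ->
  HS (chi - chi') /\ nS (chi - chi') <= K.
Proof.
move=> h h' K0 hK.
have tr := traceP oO bO oT TO disjT nullO HtA_sub lHtA H0HtA.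
have [z l t] := tr _ h; have [z' l' t'] := tr _ h'.
have [w [Hw gw wK]] : exists w, [/\ HAs A Omega w, gammaS A Omega T HtA w = chi - chi' &
    normAs A Omega w <= K].
  apply: (trace_extension oO bO oT TO disjT nullO HtA_sub lHtA cHtA H0HtA) => //.
  - by move=> v nv; rewrite !fctE z// z'// subrr.
  - move=> a u v Vu Vv; rewrite !fctE l// l'// mulrBr opprD addrACA.
    by [].
  - by move=> phi tp; rewrite !fctE t// t'// subrr.
split; first by exists w.
exact: le_trans (normS_le Hw gw) wK.
Qed.

Lemma normS_ge0 chi : HS chi -> 0 <= nS chi.
Proof.
move=> [w Hw gw]; apply: lb_le_inf; first by exists (normAs A Omega w), w.
by move=> _ [w' _ <-]; exact: normAs_ge0.
Qed.

(** The crude constant [nS chi + nS chi'] shows that the difference is a trace; its own norm is then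
    a valid bound. *)
Lemma trace_sub_bound chi chi' : HS chi -> HS chi' ->
  HS (chi - chi') /\ forall v, HtA v -> `|chi v - chi' v| <= nS (chi - chi') * nA v.
Proof.
move=> h h'; have tb := trace_le_normS oO oT TO disjT HtA_sub.
have [hs _] : HS (chi - chi') /\ nS (chi - chi') <= nS chi + nS chi'.
  apply: trace_sub => //; first by rewrite addr_ge0// normS_ge0.
  move=> v Vv; apply: (le_trans (ler_normB _ _)); rewrite mulrDl.
  by apply: lerD; exact: tb.
by split=> // v Vv; exact: (tb _ _ hs Vv).
Qed.

Context (C : E -> {linear U -> U}) (hC : spd_tensor Omega C).
Context (c0 M : R) (c0_gt0 : 0 < c0) (M_ge0 : 0 <= M).
Local Notation cf := (tensor_form A T C).
Local Notation af := (fun u v => ipT T (AT A T u) (AT A T v)).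
Hypothesis cf_coercive : forall v, HAT A Omega T v -> c0 * af v v <= cf v v.
Hypothesis cf_bounded : forall v, HAT A Omega T v -> cf v v <= M * af v v.
Variables (HhA : set (E -> R)) (HhS : set ((E -> R) -> R)) (F : (E -> R) -> (E -> R)).
Hypothesis HhA_sub : HhA `<=` HtA.
Hypothesis lHhA : linear_subspace HhA.
Hypothesis HhS_sub : HhS `<=` HS.
Hypothesis lHhS : linear_subspace HhS.
Variables (CF CPFd : R).
Hypothesis hF : forall v, HtA v -> [/\ HhA (F v),
  forall dpsi, HhS dpsi -> dpsi (v - F v) = 0 & nA (F v) <= CF * nA v].
Hypothesis hPFd : forall v, HhA v -> (forall dpsi, HhS dpsi -> dpsi v = 0) ->
  norm2 Omega v <= CPFd * normT T (AT A T v).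
Variables (f : E -> R) (hf : L2 Omega f).

Let HhAT : HhA `<=` HAT A Omega T := subset_trans HhA_sub HtA_sub.
Let pC := tensor_form_psd A oO bO oT TO hC.
Let pCh := psd_formS lHhA HhAT pC.
Let tr := traceP oO bO oT TO disjT nullO HtA_sub lHtA H0HtA.

Let HhS_lin phi : HhS phi -> forall b x y, HtA x -> HtA y ->
  phi (b *: x + y) = b * phi x + phi y.
Proof. by move=> /HhS_sub/tr[]. Qed.

(** Coercivity kills the derivatives, then the discrete Poincaré-Friedrichs inequality kills the
    function. This serves both uniqueness and solvability. *)
Lemma discrete_kernel u : HhA u -> (forall phi, HhS phi -> phi u = 0) ->
  cf u u = 0 -> ip Omega u u = 0.
Proof.
move=> Hu u0 cu; have au : af u u = 0.
  apply/eqP; rewrite eq_le (psd_ge0 pA) ?andbT//; last exact: HhAT.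
  by have := cf_coercive (HhAT Hu); rewrite cu pmulr_rle0.
have := hPFd Hu u0; rewrite /norm2 /normT au sqrtr0 mulr0 => h.
have h0 : Num.sqrt (ip Omega u u) == 0 by rewrite eq_le h sqrtr_ge0.
by apply/eqP; rewrite eq_le ip_ge0 andbT -sqrtr_eq0.
Qed.

(** The difference of the two functions is annihilated by the form. The multipliers then agree on
    [HhA], hence at [F x], and the Fortin property carries this back to every [x] in [HtA];
    elsewhere both are zero. *)
Lemma discrete_unique u psi u' psi' :
  mixed_solution A Omega T C f HhA HhS u psi ->
  mixed_solution A Omega T C f HhA HhS u' psi' ->
  ae_eq mu Omega u' u /\ psi' = psi.
Proof.
move=> [Hu Hpsi e1 e2] [Hu' Hpsi' e1' e2'].
have Hd : HhA (u' - u) by exact: linear_subspaceB.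
have sub x : HhA x -> cf (u' - u) x = psi x - psi' x.
  move=> Hx; rewrite (psdBl pCh)//.
  have := e1 x Hx; have := e1' x Hx; rewrite -/(cf u x) -/(cf u' x).
  move: (cf u x) (cf u' x) (psi x) (psi' x) (ip _ _ _) => x1 x2 x3 x4 x5; lra.
have phiB phi x y : HhS phi -> HhA x -> HhA y -> phi (x - y) = phi x - phi y.
  move=> Hp Hx Hy; have := HhS_lin Hp (-1) (HhA_sub Hy) (HhA_sub Hx).
  by rewrite scaleN1r addrC => ->; rewrite mulN1r addrC.
have d0 phi : HhS phi -> phi (u' - u) = 0.
  by move=> Hp; rewrite phiB// e2// e2'// subrr.
have cd : cf (u' - u) (u' - u) = 0 by rewrite sub// !d0// subrr.
have Ld : L2 Omega (u' - u) by case: (HhAT Hd).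
have := sqip_eq0 mO Ld (discrete_kernel Hd d0 cd) => aed; split.
  by apply: filterS aed => x /= h /h /eqP; rewrite !fctE subr_eq0 => /eqP.
have eqh x : HhA x -> psi' x = psi x.
  move=> Hx; have := sub x Hx; rewrite (psd_norm_eq0 pCh Hd Hx cd).
  by move/esym/eqP; rewrite subr_eq0 => /eqP.
have [z _ _] := tr (HhS_sub Hpsi); have [z' _ _] := tr (HhS_sub Hpsi').
apply/funext => x; have [Vx|nx] := pselect (HtA x); last by rewrite z// z'.
have [HF F0 _] := hF Vx.
have FE phi : HhS phi -> phi x = phi (F x).
  move=> Hp; have := HhS_lin Hp (-1) (HhA_sub HF) Vx.
  by rewrite scaleN1r addrC (F0 _ Hp) mulN1r addrC => /esym/eqP; rewrite subr_eq0 => /eqP.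
by rewrite !FE// eqh.
Qed.

Lemma discrete_exists : finite_dim_L2 Omega HhA -> finite_dim HhS ->
  exists u psi, mixed_solution A Omega T C f HhA HhS u psi.
Proof.
move=> [n [b [Hb spanb]]] [m [p [Hp spanp]]].
have ll a u v : HAT A Omega T u -> HAT A Omega T v ->
    ip Omega f (a *: u + v) = a * ip Omega f u + ip Omega f v.
  move=> [Lu _] [Lv _]; have pL := L2_psd mO.
  rewrite (psdDr pL _ Lv hf); first by rewrite (psdZr pL a Lu hf).
  exact: linear_subspaceZ (L2_subspace mO) Lu.
have [u [psi [Hu Hpsi e1 e2]]] : exists u psi, [/\ HhA u, HhS psi,
    forall v, HhA v -> cf u v + psi v = ip Omega f v &
    forall phi, HhS phi -> phi u = 0].
  apply: (saddle_exists pCh lHhS _ _ Hb Hp).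
  - by move=> a u v /HhAT Hu /HhAT; exact: ll.
  - by move=> psi Hpsi a u v /HhA_sub Vu /HhA_sub; exact: HhS_lin.
  (* The remainder [z] of the a.e. expansion has zero [normAT], so it is invisible to the form, the
     traces and the load. *)
  - move=> v Hv; have [e ve] := spanb v Hv; exists e; exists (v - \sum_i e i *: b i).
    have Hs : HhA (\sum_i e i *: b i) by exact: linear_subspace_sum.
    have Hz : HhA (v - \sum_i e i *: b i) by exact: linear_subspaceB.
    move: (v - _) Hz (subrKC (\sum_i e i *: b i) v) => z Hz vE.
    have z0 : ae_eq mu Omega z (cst 0).
      apply: filterS ve => x h /h; rewrite -vE fctE => /eqP.
      by rewrite -subr_eq0 addrAC subrr add0r => /eqP.
    have nz := ae0_normAT (HhAT Hz) z0.
    have zz : ip Omega z z = 0 := ae_eq_sqip0 mO (HhAT Hz).1 z0.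
    have az : af z z = 0.
      move: nz; rewrite normATE => /eqP; rewrite sqrtr_eq0 /formAT zz add0r => h.
      by apply/eqP; rewrite eq_le h ipT_ge0.
    have cz : cf z z = 0.
      apply/eqP; rewrite eq_le (psd_ge0 pCh) ?andbT//.
      by have := cf_bounded (HhAT Hz); rewrite az mulr0.
    split.
    + exact: Hz.
    + exact/esym/vE.
    + by move=> x Hx; rewrite (psd_sym pCh Hx Hz); exact: (psd_norm_eq0 pCh Hz Hx cz).
    + move=> psi Hpsi.
      have := trace_le_normS oO oT TO disjT HtA_sub (HhS_sub Hpsi) (HhA_sub Hz).
      by rewrite nz mulr0 normr_le0 => /eqP.
    + have pL := L2_psd mO; have Lz := (HhAT Hz).1.
      by rewrite (psd_sym pL hf Lz); exact: (psd_norm_eq0 pL Lz hf zz).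
  - by move=> psi /spanp.
  (* A homogeneous solution has a function part of zero [L_2] norm, so the load vanishes on it. *)
  - move=> u psi Hu Hpsi h1 h2.
    have cu : cf u u = 0 by have := h1 u Hu; rewrite (h2 _ Hpsi) addr0.
    have pL := L2_psd mO; have Lu := (HhAT Hu).1.
    rewrite (psd_sym pL hf Lu); apply: (psd_norm_eq0 pL Lu hf).
    exact: (discrete_kernel Hu h2 cu).
by exists u, psi.
Qed.

(** [K1] bounds the error of [u]; the multiplier adds [1] from [psi - eta] and [CF * (M * K1 + 1)]
    from its discrete part. *)
Lemma discrete_cea u psi uh psih v eta
    (K1 := (1 + CF) + (CPFd ^+ 2 + 1) / c0 * (M * (1 + CF) + 1)) :
  0 <= CF -> 0 <= CPFd ->
  mixed_solution A Omega T C f HtA HS u psi ->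
  mixed_solution A Omega T C f HhA HhS uh psih -> HhA v -> HhS eta ->
  nA (u - uh) + nS (psi - psih) <=
    (K1 + 1 + CF * (M * K1 + 1)) * (nA (u - v) + nS (psi - eta)).
Proof.
move=> CF0 CPFd0 [Hu Hpsi e1 e2] [Huh Hpsih eh1 eh2] Hv Heta.
have [Hd de] := trace_sub_bound Hpsi (HhS_sub Heta).
have pOV := psd_formS lHtA HtA_sub pO; have pAV := psd_formS lHtA HtA_sub pA.
have pCV := psd_formS lHtA HtA_sub pC.
have qo := quasi_optimal pOV pAV pCV lHhA HhA_sub c0_gt0 M_ge0 CPFd0 CF0
  (fun x Vx => cf_coercive (HtA_sub Vx)) (fun x Vx => cf_bounded (HtA_sub Vx))
  lHhS HhS_lin hPFd (F := F).
have nE x : psd_norm (fun x y => ip Omega x y + ipT T (AT A T x) (AT A T y)) x = nA x.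
  by rewrite normATE.
have s0 := normS_ge0 Hd.
have [||||n1 n2] := qo _ _ _ (ip Omega f) u uh v psi psih eta (nS (psi - eta))
  Hu Huh Hv Hpsih Heta s0 _ e1 eh1 (fun phi Hp => e2 phi (HhS_sub Hp)) eh2.
- by move=> x /hF[].
- by move=> x phi /hF[_ h _]; exact: h.
- by move=> x Vx; rewrite !nE; case: (hF Vx).
- by move=> x Vx; rewrite nE; exact: de.
rewrite -/K1 !nE in n1; have {}n2 z : HtA z -> `|psi z - psih z| <=
    (nS (psi - eta) + CF * (M * K1 + 1) * (nA (u - v) + nS (psi - eta))) * nA z.
  by move=> /n2; rewrite !nE.
have kappa0 : 0 <= (CPFd ^+ 2 + 1) / c0 by rewrite divr_ge0 ?addr_ge0 ?sqr_ge0// ltW.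
have K10 : 0 <= K1.
  by rewrite addr_ge0 ?addr_ge0// mulr_ge0// addr_ge0// mulr_ge0// addr_ge0.
have K20 : 0 <= CF * (M * K1 + 1) by rewrite mulr_ge0// addr_ge0// mulr_ge0.
set t := nA (u - v) in n1 n2 *; have t0 : 0 <= t by exact: sqrtr_ge0.
have [_ n3] := trace_sub Hpsi (HhS_sub Hpsih)
  (addr_ge0 s0 (mulr_ge0 K20 (addr_ge0 t0 s0))) n2.
apply: (le_trans (lerD n1 n3)).
move: (CF * _) (nS _) K10 K20 s0 t0 => K2 s K10 K20 s0 t0.
rewrite -/K1 [leRHS]mulrDl addrA lerD2r [leRHS]mulrDl mul1r lerD2l.
by rewrite lerDr.
Qed.

End Discrete.

Theorem theorem2 (R : realType) (d : nat) (hd : (0 < d)%N) (k : Ukind)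
  (Omega : set 'rV[R]_d) (hOmega : bounded_lipschitz_domain Omega)
  (A : diffop R d k)
  (C : 'rV[R]_d ->
       {linear 'M[R]_(Urows k d, Ucols k d) -> 'M[R]_(Urows k d, Ucols k d)})
  (hC : spd_tensor Omega C)
  (CPF : R) (hCPF : 0 < CPF) (hPF : poincare_friedrichs A Omega CPF)
  (CF CPFd : R) (hCF : 0 < CF) (hCPFd : 0 < CPFd) :
  exists2 K : R, 0 < K &
  forall (N : nat) (T : 'I_N -> set 'rV[R]_d) (hT : polyhedral_mesh Omega T)
    (HtA : set ('rV[R]_d -> R)) (hHtA : closed_subspace_AT A Omega T HtA)
    (hH0 : H0A A Omega `<=` HtA)
    (HhA : set ('rV[R]_d -> R)) (HhS : set (('rV[R]_d -> R) -> R))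
    (hHhA : [/\ HhA `<=` HtA, linear_subspace HhA & finite_dim_L2 Omega HhA])
    (hHhS : [/\ HhS `<=` HAsS A Omega T HtA, linear_subspace HhS
              & finite_dim HhS])
    (F : ('rV[R]_d -> R) -> ('rV[R]_d -> R))
    (hF : forall v, HtA v ->
       [/\ HhA (F v),
           forall dpsi, HhS dpsi -> dpsi (v - F v) = 0
         & normAT A Omega T (F v) <= CF * normAT A Omega T v])
    (hPFd : forall v, HhA v -> (forall dpsi, HhS dpsi -> dpsi v = 0) ->
       norm2 Omega v <= CPFd * normT T (AT A T v))
    (f : 'rV[R]_d -> R) (hf : L2 Omega f),
  exists (uh : 'rV[R]_d -> R) (psih : ('rV[R]_d -> R) -> R),
    [/\ mixed_solution A Omega T C f HhA HhS uh psih,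
        forall uh' psih', mixed_solution A Omega T C f HhA HhS uh' psih' ->
          ae_eq (lebesgue_rV R d) Omega uh' uh /\ psih' = psih
      & forall u psi,
          mixed_solution A Omega T C f HtA (HAsS A Omega T HtA) u psi ->
          forall v eta, HhA v -> HhS eta ->
          normAT A Omega T (u - uh) + normS A Omega T HtA (psi - psih)
            <= K * (normAT A Omega T (u - v)
                    + normS A Omega T HtA (psi - eta))].
Proof.
Proof.
have [[oO _ _ bO] lip] := hOmega; have mO := open_rV_measurable oO.
have [c0 c0_gt0 hc0] := tensor_coercive hC mO.
have [M M_ge0 hM] := tensor_bounded hC mO.
pose K1 := (1 + CF) + (CPFd ^+ 2 + 1) / c0 * (M * (1 + CF) + 1).
have CF0 := ltW hCF; have CPFd0 := ltW hCPFd.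
have K10 : 0 < K1.
  apply: ltr_wpDr; last by rewrite addr_gt0.
  apply: mulr_ge0; first by rewrite divr_ge0 ?addr_ge0 ?sqr_ge0// ltW.
  by rewrite addr_ge0// mulr_ge0// addr_ge0.
(* All ingredients are fixed before the mesh, the discrete spaces and [f]. *)
exists (K1 + 1 + CF * (M * K1 + 1)).
  apply: addr_gt0; first exact: addr_gt0.
  by apply: mulr_gt0 => //; apply: ltr_wpDl => //; apply: mulr_ge0 => //; exact: ltW.
move=> N T hT HtA [HtA_sub lHtA cHtA] hH0 HhA HhS [HhA_sub lHhA finA] [HhS_sub lHhS finS]
  F hF hPFd f hf.
have [pT disjT _] := hT.
have oT i : open (T i) by have [[]] := pT i.
have TO := mesh_sub lip hT; have nullO := mesh_ae_cover hT.
have coer v : HAT A Omega T v ->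
    c0 * ipT T (AT A T v) (AT A T v) <= tensor_form A T C v v.
  move=> Hv; rewrite /ipT mulr_sumr; apply: ler_sum => i _.
  by apply: hc0; [exact: open_rV_measurable|exact: TO|exact: AT_L2U Hv].
have bnd v : HAT A Omega T v ->
    tensor_form A T C v v <= M * ipT T (AT A T v) (AT A T v).
  move=> Hv; rewrite /ipT mulr_sumr; apply: ler_sum => i _.
  by apply: hM; [exact: open_rV_measurable|exact: TO|exact: AT_L2U Hv].
have [uh [psih hs]] := discrete_exists oO bO oT TO disjT nullO HtA_sub lHtA hH0 hC
  c0_gt0 coer bnd HhA_sub lHhA HhS_sub lHhS hPFd hf finA finS.
exists uh, psih; split=> //.
- move=> uh' psih' hs'.
  exact: (discrete_unique oO bO oT TO disjT nullO HtA_sub lHtA hH0 hC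
    c0_gt0 coer HhA_sub lHhA HhS_sub hF hPFd hs hs').
- move=> u psi hcs v eta Hv Heta.
  exact: (discrete_cea oO bO oT TO disjT nullO HtA_sub lHtA cHtA hH0 hC
    c0_gt0 M_ge0 coer bnd HhA_sub lHhA HhS_sub lHhS hF hPFd CF0 CPFd0 hcs hs Hv Heta).
Qed.
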